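(* Assume: (i) there exist constants $K>0$ and $q>2$ such that for all $x,y,\bar x,\bar y\in\mathbb R^d$ $$\langle x-\bar x,\alpha(x,y)-\alpha(\bar x,\bar y)\rangle+\frac{q-1}{2}\|\beta(x,y)-\beta(\bar x,\bar y)\|^2\le K\big(|x-\bar x|^2+|y-\bar y|^2\big);$$ (ii) the SDDE $dx(t)=\alpha(x(t),x(t-\tau))\,dt+\beta(x(t),x(t-\tau))\,dW(t)$ with initial data $x(\theta)=\varphi(\theta)$, $\theta\in[-\tau,0]$, admits a unique $\{\mathcal F_t\}_{t\in[0,T]}$-adapted solution with continuous sample paths, $\sup_{s\in[0,T]}\mathbb E|x(s)|^2<\infty$, $\sup_{s\in[0,T]}\mathbb E|\alpha(x(s),x(s-\tau))|^2<\infty$, and the backward Euler method admits a unique $\{\mathcal F_{t_n}\}$-adapted solution $\{Z_n\}_{n=0}^N$; (iii) $0<2K\Delta<1$. Then there is a constant $C>0$, independent of $n$ and of the step size $\Delta$, such that for all $n\in\{1,2,\dots,N\}$ $$\mathbb E|x(t_n)-Z_n|^2\le C\left(\sum_{i=1}^n\mathbb E|\mathcal R_i|^2+\Delta^{-1}\sum_{i=1}^n\mathbb E\big[|\mathbb E(\mathcal R_i\mid\mathcal F_{t_{i-1}})|^2\big]\right),$$ where $$\mathcal R_i=\int_{t_{i-1}}^{t_i}\big[\alpha(x(s),x(s-\tau))-\alpha(x(t_i),x(t_{i-M}))\big]ds+\int_{t_{i-1}}^{t_i}\big[\beta(x(s),x(s-\tau))-\beta(x(t_{i-1}),x(t_{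i-1-M}))\big]dW(s).$$
   Context: $(\Omega,\mathcal F,\{\mathcal F_t\}_{t\in[0,T]},\mathbb P)$ is a complete filtered probability space satisfying the usual conditions, and $W$ is an $m$-dimensional Brownian motion on it. $\tau>0$, $T>0$ are fixed, $\varphi\in\mathcal C([-\tau,0];\mathbb R^d)$ is a (deterministic) continuous initial function, $\alpha:\mathbb R^d\times\mathbb R^d\to\mathbb R^d$ and $\beta:\mathbb R^d\times\mathbb R^d\to\mathbb R^{d\times m}$. $|\cdot|$ and $\langle\cdot,\cdot\rangle$ are the Euclidean norm and inner product, and $\|A\|=\sqrt{\mathrm{trace}(A^TA)}$ for matrices. The step size is $\Delta=T/N=\tau/M$ with $N,M$ positive integers, $t_n=n\Delta$, and $\Delta W_{n-1}=W(t_n)-W(t_{n-1})$. The backward Euler method (BEM) is: $Z_n=\varphi(n\Delta)$ for $n=-M,\dots,0$, and $$Z_n=Z_{n-1}+\alpha(Z_n,Z_{n-M})\Delta+\beta(Z_{n-1},Z_{n-1-M})\Delta W_{n-1},\qquad n=1,\dots,N.$$ *)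

(* Defs.v *)
From mathcomp Require Import all_boot all_order all_algebra.
From mathcomp Require Import all_classical all_reals all_analysis.

Set Implicit Arguments.
Unset Strict Implicit.
Unset Printing Implicit Defensive.

Import Order.TTheory GRing.Theory Num.Theory.
Import numFieldNormedType.Exports.

Local Open Scope classical_set_scope.
Local Open Scope ring_scope.

(* Points of R^d are column vectors. The norm that the library puts on matrices
   is the sup norm, hence the following two definitions; on column vectors
   [enorm] is the Euclidean norm, on d x m matrices the trace norm. *)
Definition dotp (R : realType) (d : nat) (x y : 'cV[R]_d) : R :=
  \sum_(i < d) x i 0 * y i 0.

Definition enorm (R : realType) (p q : nat) (A : 'M[R]_(p, q)) : R :=
  Num.sqrt (\tr (A^T *m A)).

Section StochasticCalculus.
Context (disp : measure_display) (Omega : measurableType disp) (R : realType).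
Variable P : probability Omega R.

(* A sub-sigma-algebra is given by its set of events; random vectors and
   matrices are measurable when all their entries are. *)
Definition measurable_wrt (G : set (set Omega)) (p q : nat)
    (X : Omega -> 'M[R]_(p, q)) : Prop :=
  forall i j (B : set R), measurable B -> G ((fun w => X w i j) @^-1` B).

(* The filtration is indexed by R, but only its values on [0, T] matter. *)
Record usual_filtration (T : R) (F : R -> set (set Omega)) : Prop := {
  filt_sigma : forall t, t \in `[0, T] -> sigma_algebra setT (F t);
  filt_sub : forall t, t \in `[0, T] -> F t `<=` measurable;
  filt_mono : forall s t, 0 <= s -> s <= t -> t <= T -> F s `<=` F t;
  filt_complete : forall A, P.-negligible A -> F 0 A;
  filt_rcont : forall t, 0 <= t -> t < T ->
    \bigcap_(s in `]t, T]) F s `<=` F t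
}.

(* The product rule in [bm_increment] says at once that W(t) - W(s) is
   independent of F_s, that its coordinates are independent, and that each of
   them has law N(0, t - s) (normal_prob takes a standard deviation). *)
Record brownian_motion (T : R) (F : R -> set (set Omega)) (m : nat)
    (W : R -> Omega -> 'cV[R]_m) : Prop := {
  bm_zero : {ae P, forall w, W 0 w = 0};
  bm_adapted : forall t, t \in `[0, T] -> measurable_wrt (F t) (W t);
  bm_increment : forall s t, 0 <= s -> s < t -> t <= T ->
    forall (A : set Omega) (B : 'I_m -> set R),
    F s A -> (forall j, measurable (B j)) ->
    P (A `&` [set w | forall j, B j ((W t w - W s w) j 0)]) =
    (P A * \prod_(j < m) normal_prob 0 (Num.sqrt (t - s)) (B j))%E;
  bm_cont : {ae P, forall w, {within `[0, T], continuous (W ^~ w)}}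
}.

Definition cvg_to_0_in_prob (X : nat -> Omega -> \bar R) : Prop :=
  forall eps : R, 0 < eps ->
  P [set w | (eps%:E <= X k w)%E] @[k --> \oo] --> 0%E.

(* The class L^r([a, b]): jointly measurable adapted processes g such that
   int_a^b |g(s)|^r ds < oo almost surely. *)
Record adapted_Lp (F : R -> set (set Omega)) (a b : R) (r p q : nat)
    (g : R -> Omega -> 'M[R]_(p, q)) : Prop := {
  Lp_measurable : forall i j, measurable_fun (`[a, b] `*` setT)
    (fun u : R * Omega => g u.1 u.2 i j);
  Lp_adapted : forall s, s \in `[a, b] -> measurable_wrt (F s) (g s);
  Lp_finite : {ae P, forall w,
    (\int[lebesgue_measure]_(s in `[a, b]) (enorm (g s w) ^+ r)%:E < +oo)%E}
}.

(* The simple process equal to sp_val j on [sp_time j, sp_time j.+1[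
   for j < sp_size. *)
Record simple_process (p q : nat) : Type := SimpleProcess {
  sp_size : nat;
  sp_time : nat -> R;
  sp_val : nat -> Omega -> 'M[R]_(p, q)
}.

Record simple_on (F : R -> set (set Omega)) (a b : R) (p q : nat)
    (h : simple_process p q) : Prop := {
  simple_first : sp_time h 0 = a;
  simple_last : sp_time h (sp_size h) = b;
  simple_incr : forall j, (j < sp_size h)%N -> sp_time h j < sp_time h j.+1;
  simple_adapted : forall j, (j < sp_size h)%N ->
    measurable_wrt (F (sp_time h j)) (sp_val h j);
  simple_bounded : exists c : R, forall j w, (j < sp_size h)%N ->
    enorm (sp_val h j w) <= c
}.

Definition simple_fun (p q : nat) (h : simple_process p q) (s : R) (w : Omega)
    : 'M[R]_(p, q) :=
  \sum_(j < sp_size h)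
    (\1_(`[sp_time h j, sp_time h j.+1[%classic) s : R) *: sp_val h j w.

Definition simple_integral (m : nat) (W : R -> Omega -> 'cV[R]_m) (d : nat)
    (h : simple_process d m) (w : Omega) : 'cV[R]_d :=
  \sum_(j < sp_size h)
    sp_val h j w *m (W (sp_time h j.+1) w - W (sp_time h j) w).

(* J is (a version of) the Ito integral of g against W over [a, b]: the limit
   in probability of the integrals of simple processes h_k such that
   int_a^b |h_k - g|^2 ds tends to 0 in probability. *)
Definition ito_integral (F : R -> set (set Omega)) (m : nat)
    (W : R -> Omega -> 'cV[R]_m) (a b : R) (d : nat)
    (g : R -> Omega -> 'M[R]_(d, m)) (J : Omega -> 'cV[R]_d) : Prop :=
  [/\ adapted_Lp F a b 2 g, measurable_wrt (F b) J &
    exists h : nat -> simple_process d m,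
    [/\ forall k, simple_on F a b (h k),
        cvg_to_0_in_prob (fun k w =>
          (\int[lebesgue_measure]_(s in `[a, b])
             (enorm (simple_fun (h k) s w - g s w) ^+ 2)%:E)%E) &
        cvg_to_0_in_prob (fun k w =>
          (enorm (simple_integral W (h k) w - J w))%:E)]].

Definition time_integral (a b : R) (d : nat) (g : R -> Omega -> 'cV[R]_d)
    (w : Omega) : 'cV[R]_d :=
  \col_(i < d) \int[lebesgue_measure]_(s in `[a, b]) (g s w i 0).

(* Y is (a version of) E(X | G). *)
Definition cond_expectation (G : set (set Omega)) (d : nat)
    (X Y : Omega -> 'cV[R]_d) : Prop :=
  measurable_wrt G Y /\
  forall i : 'I_d,
  [/\ P.-integrable setT (fun w => (X w i 0)%:E),
      P.-integrable setT (fun w => (Y w i 0)%:E) &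
      forall A, G A ->
        (\int[P]_(w in A) (Y w i 0)%:E = \int[P]_(w in A) (X w i 0)%:E)%E].

Section DelayEquation.
Variables (d m : nat) (T tau : R) (F : R -> set (set Omega)).
Variable W : R -> Omega -> 'cV[R]_m.
Variable phi : R -> 'cV[R]_d.
Variable alpha : 'cV[R]_d -> 'cV[R]_d -> 'cV[R]_d.
Variable beta : 'cV[R]_d -> 'cV[R]_d -> 'M[R]_(d, m).

Record sdde_solution (x : R -> Omega -> 'cV[R]_d) : Prop := {
  sdde_initial : forall th w, th \in `[- tau, 0] -> x th w = phi th;
  sdde_adapted : forall t, t \in `[0, T] -> measurable_wrt (F t) (x t);
  sdde_cont : {ae P, forall w, {within `[0, T], continuous (x ^~ w)}};
  sdde_drift :
    adapted_Lp F 0 T 1 (fun s w => alpha (x s w) (x (s - tau) w));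
  sdde_diffusion :
    adapted_Lp F 0 T 2 (fun s w => beta (x s w) (x (s - tau) w));
  sdde_eq : forall t, t \in `[0, T] ->
    exists2 J : Omega -> 'cV[R]_d,
      ito_integral F W 0 t (fun s w => beta (x s w) (x (s - tau) w)) J &
      {ae P, forall w,
        x t w = phi 0
          + time_integral 0 t (fun s w' => alpha (x s w') (x (s - tau) w')) w
          + J w}
}.

Definition sdde_unique_solution (x : R -> Omega -> 'cV[R]_d) : Prop :=
  sdde_solution x /\
  forall y, sdde_solution y ->
    {ae P, forall w, forall t, t \in `[0, T] -> x t w = y t w}.

Definition grid (Delta : R) (n : int) : R := n%:~R * Delta.

Record bem_solution (N M : nat) (Delta : R) (Z : int -> Omega -> 'cV[R]_d)
    : Prop := {
  bem_initial : forall (n : int) w, - M%:Z <= n -> n <= 0 ->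
    Z n w = phi (grid Delta n);
  bem_adapted : forall n : nat, (n <= N)%N ->
    measurable_wrt (F (grid Delta n%:Z)) (Z n%:Z);
  bem_step : forall n : int, 1 <= n -> n <= N%:Z ->
    {ae P, forall w,
      Z n w = Z (n - 1) w + Delta *: alpha (Z n w) (Z (n - M%:Z) w)
        + beta (Z (n - 1) w) (Z (n - 1 - M%:Z) w)
            *m (W (grid Delta n) w - W (grid Delta (n - 1)) w)}
}.

Definition bem_unique_solution (N M : nat) (Delta : R)
    (Z : int -> Omega -> 'cV[R]_d) : Prop :=
  bem_solution N M Delta Z /\
  forall Z', bem_solution N M Delta Z' ->
    {ae P, forall w, forall n : nat, (n <= N)%N -> Z n%:Z w = Z' n%:Z w}.

(* r is (a version of) the local truncation error R_i. *)
Definition bem_remainder (x : R -> Omega -> 'cV[R]_d) (M : nat) (Delta : R)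
    (i : int) (r : Omega -> 'cV[R]_d) : Prop :=
  let a := grid Delta (i - 1) in
  let b := grid Delta i in
  exists2 J : Omega -> 'cV[R]_d,
    ito_integral F W a b
      (fun s w => beta (x s w) (x (s - tau) w)
         - beta (x a w) (x (grid Delta (i - 1 - M%:Z)) w)) J &
    forall w, r w =
      time_integral a b
        (fun s w' => alpha (x s w') (x (s - tau) w')
           - alpha (x b w') (x (grid Delta (i - M%:Z)) w')) w + J w.

End DelayEquation.
End StochasticCalculus.

(* Main.v *)
From HB Require Import structures.
From mathcomp Require Import all_boot all_order all_algebra.
From mathcomp Require Import all_classical all_reals all_analysis.
From mathcomp Require Import measurable_realfun ring lra.
Require Import Defs.
Import Order.TTheory GRing.Theory Num.Theory.
Import numFieldNormedType.Exports.
Local Open Scope classical_set_scope.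
Local Open Scope ring_scope.
Set Implicit Arguments.
Unset Strict Implicit.
Unset Printing Implicit Defensive.

Import HBNNSimple.

(** Let [e_k = x(t_k) - Z_k], let [B_k] be the difference of the two diffusion
    coefficients at [t_k], and [dW] the increment of [W] over the [k]-th step.
    Subtracting the scheme from the equation gives
      e_k - Delta (alpha-difference at t_k) = e_(k-1) + B_(k-1) dW + R_k.
    Squaring the left-hand side, the coupled monotonicity condition turns the
    implicit drift into a gain: pathwise,
      (1 - 2 K Delta) |e_k|^2 + (q - 1) Delta |B_k|^2
        <= |e_(k-1) + B_(k-1) dW + R_k|^2 + 2 K Delta |e_(k-M)|^2
    ([bem_err_recursion], [bem_err_ineq]). Expectations are then taken of the
    right-hand side ([error_step]). The increment is independent of the past, so
    E|B_(k-1) dW|^2 = Delta E|B_(k-1)|^2 and the product of e_(k-1) with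
    B_(k-1) dW has mean zero. In the product of e_(k-1) with R_k one may replace
    R_k by its conditional expectation, and Young's inequality with weight Delta
    produces Delta^-1 E|E(R_k | F)|^2. In the product of B_(k-1) dW with R_k,
    Young's inequality with weight q - 2 costs (q - 2) Delta E|B_(k-1)|^2. The
    diffusion errors thus occur on both sides with the same weight (q - 1) Delta:
    this is where q > 2 is used, and they telescope. What remains is a Gronwall
    inequality with delay ([delayed_gronwall]), whose constant is uniform because
    2 K Delta = 2 K T / N < 1 leaves a gap below 1 that does not depend on N
    ([gronwall_constant]). Square integrability of the errors propagates from
    step to step through the same inequality ([bem_err_moment]); if a moment of
    some R_i or of its conditional expectation is infinite, so is the bound.

    Two points lie below this computation. First, the equation gives Ito integrals
    over [0, t_(k-1)] and [0, t_k], the local error one over [t_(k-1), t_k], each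
    of them a limit in probability along its own simple processes; they have to be
    related almost surely ([ito_integral_additive]). On a common refinement the
    defect of additivity of the approximations is a discrete stochastic integral
    whose quadratic sum is small, and such an integral is small in probability
    ([ito_sum_in_prob]). Second, the diffusion error of the scheme has to be
    adapted: the coupled condition makes beta continuous ([beta_continuous]), hence
    measurable along the scheme ([measurable_continuous_comp]). *)

(** * Integrals against multipliers measurable for a sub-sigma-algebra *)

Section multiplier.
Local Open Scope ereal_scope.
Context d (T : measurableType d) (R : realType).

Definition sub_measurable (G : set (set T)) (U : T -> R) :=
  forall B : set R, measurable B -> G (U @^-1` B).

Lemma sub_measurableP (G : set (set T)) (U : T -> R) :
  sigma_algebra setT G ->
  sub_measurable G U <-> measurable_fun setT (U : g_sigma_algebraType G -> R).
Proof.
move=> sG; have GE : <<s G >> = G by exact: sigma_algebra_id.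
split=> [GU _ B mB|GU B mB].
  by rewrite setTI; apply: sub_sigma_algebra; exact: GU.
have := GU measurableT B mB; rewrite setTI.
by rewrite /measurable/= GE.
Qed.

Lemma sub_measurable_measurable (G : set (set T)) (U : T -> R) :
  G `<=` measurable -> sub_measurable G U -> measurable_fun setT U.
Proof. by move=> GM GU _ B mB; rewrite setTI; apply: GM; exact: GU. Qed.

Lemma ge0_integral_simple_mul (m : {measure set T -> \bar R}) (G : set (set T))
    (f X : T -> R) :
  sigma_algebra setT G -> G `<=` measurable ->
  sub_measurable G f -> finite_set (range f) -> (forall t, 0 <= f t)%R ->
  measurable_fun setT X -> (forall t, 0 <= X t)%R ->
  \int[m]_t (f t * X t)%:E =
  \sum_(y \in range f) (y%:E * \int[m]_(t in f @^-1` [set y]) (X t)%:E).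
Proof.
move=> sG GM Gf finf f0 mX X0.
have mA y : measurable (f @^-1` [set y]) by apply/GM/Gf.
have fE t : (f t * X t)%:E =
    \sum_(y \in range f) (y * \1_(f @^-1` [set y]) t * X t)%:E.
  rewrite (fsbigD1 (f t))//=; last by exists t.
  rewrite fsbig1 ?adde0; last first.
    move=> y [_ /eqP yt]/=; rewrite indicE memNset ?mulr0 ?mul0r//.
    by move=> ftE; move/eqP: yt; apply.
  by rewrite indicE mem_set ?mulr1.
under eq_integral do rewrite fE.
have term0 y t : 0 <= (y * \1_(f @^-1` [set y]) t * X t)%:E.
  rewrite lee_fin mulr_ge0// indicE; case: (boolP (t \in _)) => [|_].
    by rewrite inE/= => <-; rewrite mulr1.
  by rewrite mulr0.
rewrite ge0_integral_fsum//=; last first.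
  move=> y; apply/measurable_EFinP/measurable_funM => //.
  by apply: measurable_funM => //; exact: measurable_indic.
apply: eq_fsbigr => y /[!inE] -[t0 _ ft0].
rewrite [in RHS]integral_mkcond -ge0_integralZl//=.
- apply: eq_integral => t _; rewrite -mulrA EFinM patchE indicE.
  by case: ifPn; rewrite ?mul1r ?mul0r.
- apply/measurable_restrict => //; apply: measurable_funTS.
  exact/measurable_EFinP.
- by move=> t _; rewrite patchE; case: ifPn => //; rewrite lee_fin.
- by rewrite lee_fin -ft0.
Qed.

(** Simple [G]-measurable functions approximate [U] from below, and for them the
    integral is a combination of the weighted measures of events of [G]. *)
Lemma eq_ge0_integral_multiplier (m1 m2 : {measure set T -> \bar R})
    (G : set (set T)) (U X Y : T -> R) :
  sigma_algebra setT G -> G `<=` measurable ->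
  sub_measurable G U -> (forall t, 0 <= U t)%R ->
  measurable_fun setT X -> measurable_fun setT Y ->
  (forall t, 0 <= X t)%R -> (forall t, 0 <= Y t)%R ->
  (forall A, G A ->
    \int[m1]_(t in A) (X t)%:E = \int[m2]_(t in A) (Y t)%:E) ->
  \int[m1]_t (U t * X t)%:E = \int[m2]_t (U t * Y t)%:E.
Proof.
move=> sG GM /(sub_measurableP _ sG) mU U0 mX mY X0 Y0 XY.
have mU' : measurable_fun setT (EFin \o (U : g_sigma_algebraType G -> R)).
  exact/measurable_EFinP.
pose f n : T -> R := nnsfun_approx measurableT mU' n.
have Gf n : sub_measurable G (f n).
  by apply/(sub_measurableP _ sG); exact: measurable_funPT.
have fU t : (f n t)%:E @[n --> \oo] --> (U t)%:E.
  by apply: (cvg_nnsfun_approx measurableT mU') => //= x _; rewrite lee_fin.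
have f0 n t : (0 <= f n t)%R by exact: fun_ge0.
have finf n : finite_set (range (f n)) by exact: (@fimfunP _ _ (nnsfun_approx measurableT mU' n)).
have fnd t : {homo f^~ t : n p / (n <= p)%N >-> (n <= p)%R}.
  by move=> n p np; have /lefP := nd_nnsfun_approx measurableT mU' np; exact.
have lim (m : {measure set T -> \bar R}) (Z : T -> R) :
    measurable_fun setT Z -> (forall t, 0 <= Z t)%R ->
    \int[m]_t (f n t * Z t)%:E @[n --> \oo] --> \int[m]_t (U t * Z t)%:E.
  move=> mZ Z0.
  have -> : \int[m]_t (U t * Z t)%:E =
      \int[m]_t limn (fun n => (f n t * Z t)%:E).
    apply: eq_integral => t _; apply/esym/cvg_lim => //.
    under eq_fun do rewrite EFinM.
    by rewrite EFinM; apply: cvgeM; [|exact: fU|exact: cvg_cst].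
  apply: cvg_monotone_convergence => //.
  - move=> n; apply/measurable_EFinP/measurable_funM => //.
    exact: sub_measurable_measurable (Gf n).
  - by move=> n t _; rewrite lee_fin mulr_ge0.
  - by move=> t _ n p np; rewrite lee_fin ler_wpM2r// fnd.
apply: (cvg_unique _ (lim m1 X mX X0)); first exact: ereal_hausdorff.
rewrite (_ : (fun n => _) = (fun n => \int[m2]_t (f n t * Y t)%:E)).
  exact: lim.
apply/funext => n.
rewrite !(ge0_integral_simple_mul _ sG GM (Gf n))//.
by apply: eq_fsbigr => y _; congr (_ * _); apply: XY; exact: Gf.
Qed.

(** Independence and conditional expectations are known on the events of [G]; this
    is how they are transported to products with [G]-measurable functions. *)
Lemma eq_integral_multiplier (m : {measure set T -> \bar R})
    (G : set (set T)) (U X Y : T -> R) :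
  sigma_algebra setT G -> G `<=` measurable ->
  sub_measurable G U ->
  m.-integrable setT (EFin \o X) -> m.-integrable setT (EFin \o Y) ->
  m.-integrable setT (EFin \o (U \* X)%R) ->
  m.-integrable setT (EFin \o (U \* Y)%R) ->
  (forall A, G A ->
    \int[m]_(t in A) (X t)%:E = \int[m]_(t in A) (Y t)%:E) ->
  \int[m]_t (U t * X t)%:E = \int[m]_t (U t * Y t)%:E.
Proof.
move=> sG GM GU iX iY iUX iUY XY.
have mU := sub_measurable_measurable GM GU.
have mX : measurable_fun setT X.
  by apply/measurable_EFinP; exact: measurable_int iX.
have mY : measurable_fun setT Y.
  by apply/measurable_EFinP; exact: measurable_int iY.
suff H V : sub_measurable G V -> (forall t, 0 <= V t <= `|U t|)%R ->
    m.-integrable setT (EFin \o (V \* X)%R) /\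
    m.-integrable setT (EFin \o (V \* Y)%R) /\
    \int[m]_t (V t * X t)%:E = \int[m]_t (V t * Y t)%:E.
  have GUp : sub_measurable G (fun t => Num.max (U t) 0)%R.
    apply/(sub_measurableP _ sG); apply: measurable_maxr => //.
    exact/(sub_measurableP _ sG).
  have GUn : sub_measurable G (fun t => Num.max (- U t) 0)%R.
    apply/(sub_measurableP _ sG); apply: measurable_maxr => //.
    by apply: measurableT_comp => //; exact/(sub_measurableP _ sG).
  have [t|iUpX [iUpY Up]] := H _ GUp.
    by rewrite le_max lexx orbT/= ge_max ler_norm/=.
  have [t|iUnX [iUnY Un]] := H _ GUn.
    by rewrite le_max lexx orbT/= ge_max -normrN ler_norm/=.
  have UE t : U t = (Num.max (U t) 0 - Num.max (- U t) 0)%R.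
    by have [u0|u0] := leP (U t) 0%R; have [v0|v0] := leP (- U t)%R 0%R; lra.
  under eq_integral do rewrite UE mulrBl EFinB.
  rewrite integralB_EFin// Up Un -integralB_EFin//.
  by under eq_integral do rewrite -EFinB -mulrBl -UE.
move=> GV V0.
have mV := sub_measurable_measurable GM GV.
have iV Z : measurable_fun setT Z -> m.-integrable setT (EFin \o (U \* Z)%R) ->
    m.-integrable setT (EFin \o (V \* Z)%R).
  move=> mZ; apply: le_integrable => //.
    exact/measurable_EFinP/measurable_funM.
  move=> t _ /=; rewrite lee_fin !normrM ler_wpM2r//.
  by have /andP[V0t VU] := V0 t; rewrite ger0_norm.
have iVX := iV _ mX iUX; have iVY := iV _ mY iUY.
split=> //; split=> //.
(* adding |X| + |Y| to both sides makes the weights nonnegative *)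
pose D : T -> R := fun t => (`|X t| + `|Y t|)%R.
have iD : m.-integrable setT (EFin \o D).
  by apply: (integrableD measurableT (integrable_norm iX) (integrable_norm iY)).
have mD : measurable_fun setT D.
  by apply/measurable_EFinP; exact: measurable_int iD.
have iVD : m.-integrable setT (EFin \o (V \* D)%R).
  have := integrableD measurableT (integrable_norm iVX) (integrable_norm iVY).
  apply: eq_integrable => // t _ /=; rewrite -EFinD !normrM.
  by rewrite (ger0_norm (proj1 (andP (V0 t)))) -mulrDr.
have fVD : \int[m]_t (V t * D t)%:E \is a fin_num.
  exact: integrable_fin_num iVD.
have : \int[m]_t (V t * (X t + D t))%:E = \int[m]_t (V t * (Y t + D t))%:E.
  apply: (@eq_ge0_integral_multiplier m m G V (X \+ D)%R (Y \+ D)%R) => //.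
  - by move=> t; have /andP[] := V0 t.
  - exact: measurable_funD.
  - exact: measurable_funD.
  - move=> t; rewrite /D/=.
    by have := ler_norm (- X t); have := normr_ge0 (Y t); rewrite normrN; lra.
  - move=> t; rewrite /D/=.
    by have := ler_norm (- Y t); have := normr_ge0 (X t); rewrite normrN; lra.
  - move=> A GA; have mA := GM _ GA.
    have iA (Z : T -> R) : m.-integrable setT (EFin \o Z) ->
        m.-integrable A (EFin \o Z) by exact: integrableS.
    have add (Z : T -> R) : m.-integrable setT (EFin \o Z) ->
        \int[m]_(t in A) ((Z \+ D)%R t)%:E =
        \int[m]_(t in A) (Z t)%:E + \int[m]_(t in A) (D t)%:E.
      by move=> iZ; rewrite -integralD_EFin//; exact: iA.
    by rewrite !add// XY.
have add (Z : T -> R) : m.-integrable setT (EFin \o (V \* Z)%R) ->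
    \int[m]_t (V t * (Z t + D t))%:E =
    \int[m]_t (V t * Z t)%:E + \int[m]_t (V t * D t)%:E.
  by move=> iZ; rewrite -integralD_EFin//; under eq_integral do rewrite mulrDr.
rewrite !add// => /(congr1 (fun z => z - \int[m]_t (V t * D t)%:E)).
by rewrite !addeK.
Qed.

End multiplier.

(** * Moments of the centred normal law *)

Section normal_moments.
Context (R : realType).
Notation mu := (@lebesgue_measure R).

(** The normal law is defined by its values on events, so its density is read off
    from the case where all measurable sets are taken for [G]. *)
Lemma ge0_integral_normal_prob (a s : R) (f : R -> R) :
  measurable_fun setT f -> (forall x, 0 <= f x) ->
  (\int[normal_prob a s]_x (f x)%:E = \int[mu]_x (f x * normal_pdf a s x)%:E)%E.
Proof.
move=> mf f0.
have := @eq_ge0_integral_multiplier _ _ R (normal_prob a s) mu measurable f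
  (cst 1) (normal_pdf a s).
rewrite /=; under eq_integral do rewrite mulr1.
apply => //.
- exact: sigma_algebra_measurable.
- by move=> B mB; rewrite -[X in measurable X]setTI; exact: mf.
- exact: measurable_normal_pdf.
- by move=> x; exact: normal_pdf_ge0.
- by move=> A mA; rewrite integral_cst// mul1e.
Qed.

Lemma normal_pdf_even (s x : R) : s != 0 ->
  normal_pdf 0 s (- x) = normal_pdf 0 s x.
Proof. by move=> s0; rewrite !normal_pdfE// /normal_fun !subr0 sqrrN. Qed.

Lemma is_derive_normal_pdf (s x : R) : 0 < s ->
  is_derive x (1 : R) (normal_pdf 0 s) (- (x / s ^+ 2) * normal_pdf 0 s x).
Proof.
move=> s0; rewrite normal_pdfE ?gt_eqF// /normal_fun.
apply: is_derive_eq; rewrite /GRing.scale/= !subr0 mulr1 mulr0 add0r -mulr_natl.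
have s0' := lt0r_neq0 s0; set e := expR _; field.
exact: s0'.
Qed.

Lemma is_derive_mul_normal_pdf (s x : R) : 0 < s ->
  is_derive x (1 : R) (fun y => - s ^+ 2 * (y * normal_pdf 0 s y))
    (x ^+ 2 * normal_pdf 0 s x - s ^+ 2 * normal_pdf 0 s x).
Proof.
move=> s0; have dp := is_derive_normal_pdf x s0.
apply: is_derive_eq; rewrite /GRing.scale/=.
by have := lt0r_neq0 s0 => s0'; field.
Qed.

Lemma cvg_mul_normal_pdf (s : R) : 0 < s ->
  - s ^+ 2 * (x * normal_pdf 0 s x) @[x --> +oo] --> 0.
Proof.
move=> s0.
rewrite [X in _ --> X](_ : _ = - s ^+ 2 * 0); last by rewrite mulr0.
apply: cvgM; first exact: cvg_cst.
have B : \forall x \near +oo,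
  0 <= x * normal_pdf 0 s x <= normal_peak s * (s ^+ 2 *+ 2) / x.
  near=> x.
  have x0 : 0 < x by near: x; exact: nbhs_pinfty_gt.
  apply/andP; split; first by rewrite mulr_ge0 ?normal_pdf_ge0 ?ltW.
  rewrite normal_pdfE ?gt_eqF// /normal_fun subr0 mulNr expRN.
  set y := x ^+ 2 / (s ^+ 2 *+ 2).
  have y0 : 0 < y by rewrite divr_gt0// ?exprn_gt0// pmulrn_lgt0// exprn_gt0.
  have ey : y <= expR y by apply: le_trans (expR_ge1Dx y); rewrite lerDr.
  have : (expR y)^-1 <= y^-1 by rewrite lef_pV2 ?posrE ?expR_gt0.
  have -> : y^-1 = (s ^+ 2 *+ 2) * (x ^+ 2)^-1 by rewrite /y invf_div.
  move=> H; rewrite mulrCA -!mulrA ler_wpM2l ?normal_peak_ge0//.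
  apply: le_trans (ler_wpM2l (ltW x0) H) _.
  rewrite mulrCA ler_wpM2l ?mulrn_wge0 ?sqr_ge0//.
  by rewrite expr2 invfM mulrA divff ?mul1r// gt_eqF.
apply/cvgr0Pnorm_lt => e e0; near=> x.
have [xp0 xpB] : 0 <= x * normal_pdf 0 s x /\
    x * normal_pdf 0 s x <= normal_peak s * (s ^+ 2 *+ 2) / x.
  by apply/andP; near: x.
rewrite ger0_norm//; apply: le_lt_trans xpB _.
have x0 : 0 < x by near: x; exact: nbhs_pinfty_gt.
rewrite ltr_pdivrMr// -ltr_pdivrMl//.
by near: x; apply: nbhs_pinfty_gt; rewrite num_real.
Unshelve. all: by end_near. Qed.

(** [(x^2 - s^2) p(x)] is the derivative of [- s^2 x p(x)], which vanishes at 0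
    and at infinity. It changes sign at [s], so the integrals over [[0, s]] and
    [[s, +oo[] are computed separately. *)
Lemma normal_second_moment (s : R) : 0 < s ->
  (\int[normal_prob 0 s]_x (x ^+ 2)%:E = (s ^+ 2)%:E)%E.
Proof.
move=> s0.
pose p := @normal_pdf R 0 s.
have p0 x : 0 <= p x by exact: normal_pdf_ge0.
have cp : continuous p by apply: continuous_normal_pdf; rewrite gt_eqF.
pose F := fun y : R => - s ^+ 2 * (y * p y).
have dF (x : R) : is_derive x 1 F (x ^+ 2 * p x - s ^+ 2 * p x).
  exact: is_derive_mul_normal_pdf.
have cF : continuous F.
  move=> x; apply/differentiable_continuous/derivable1_diffP.
  by have [] := dF x.
have F' : F^`()%classic =1 (fun x : R => x ^+ 2 * p x - s ^+ 2 * p x).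
  by move=> x; rewrite derive1E; have [_ ->] := dF x.
have cf1 : continuous (fun x : R => x ^+ 2 * p x).
  by move=> x; apply: cvgM; [exact: exprn_continuous|exact: cp].
have cf2 : continuous (fun x : R => s ^+ 2 * p x).
  by move=> x; apply: cvgM; [exact: cvg_cst|exact: cp].
have cF' : continuous (fun x : R => x ^+ 2 * p x - s ^+ 2 * p x).
  by move=> x; apply: cvgB; [exact: cf1|exact: cf2].
have tail : (\int[mu]_(x in `[s, +oo[) (x ^+ 2 * p x - s ^+ 2 * p x)%:E =
    (- F s)%:E)%E.
  rewrite (@ge0_continuous_FTC2y _ _ F s 0) ?add0e//.
  - move=> x sx; rewrite -mulrBl mulr_ge0// subr_ge0 ler_sqr ?nnegrE//.
    + exact: ltW.
    + exact: le_trans (ltW s0) sx.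
  - exact: continuous_subspaceT.
  - exact: cvg_mul_normal_pdf.
  - by apply: cvg_at_right_filter; exact: cF.
have head : (\int[mu]_(x in `[0%R, s]) (s ^+ 2 * p x - x ^+ 2 * p x)%:E =
    (- F s)%:E)%E.
  have -> : - F s = (- F) s - (- F) 0.
    transitivity (- F s - - F 0); last by [].
    by rewrite {3}/F mul0r mulr0 oppr0 subr0.
  rewrite (@continuous_FTC2 _ _ (- F))//.
  - apply: continuous_subspaceT => x.
    by apply: cvgB; [exact: cf2|exact: cf1].
  - split.
    + by move=> x _; apply: derivableN; have [] := dF x.
    + by apply: cvg_at_right_filter; apply: cvgN; exact: cF.
    + by apply: cvg_at_left_filter; apply: cvgN; exact: cF.
  - move=> x _; rewrite derive1E deriveN; last by have [] := dF x.
    by have [_ ->] := dF x; rewrite opprB.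
have mp : measurable_fun setT p by exact: measurable_normal_pdf.
have mf1 : measurable_fun setT (fun x : R => x ^+ 2 * p x).
  by apply: measurable_funM => //; exact: measurable_funX.
have mf2 : measurable_fun setT (fun x : R => s ^+ 2 * p x).
  exact: measurable_funM.
have half : (\int[mu]_(x in `[0%R, +oo[) (x ^+ 2 * p x)%:E =
    \int[mu]_(x in `[0%R, +oo[) (s ^+ 2 * p x)%:E)%E.
  have split (f : R -> R) : measurable_fun setT f -> (forall x, 0 <= f x) ->
    (\int[mu]_(x in `[0%R, +oo[) (f x)%:E =
     \int[mu]_(x in `[0%R, s]) (f x)%:E + \int[mu]_(x in `[s, +oo[) (f x)%:E)%E.
    move=> mf f0.
    rewrite (@itv_bndbnd_setU _ _ _ (BRight s)) ?bnd_simp ?(ltW s0)//.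
    have mf' : measurable_fun setT (EFin \o f) by exact/measurable_EFinP.
    rewrite ge0_integral_setU//=.
    - by congr (_ + _)%E; rewrite integral_itv_obnd_cbnd//; exact: measurable_funTS.
    - exact: measurable_funTS.
    - by move=> x _; rewrite lee_fin.
    - apply/disj_setPS => x [/=]; rewrite !in_itv/= andbT => /andP[_ xs].
      by rewrite ltNge xs.
  have x2p0 (x : R) : 0 <= x ^+ 2 * p x by rewrite mulr_ge0 ?sqr_ge0.
  have s2p0 x : 0 <= s ^+ 2 * p x by rewrite mulr_ge0 ?sqr_ge0.
  rewrite !split//.
  have -> : (\int[mu]_(x in `[0%R, s]) (s ^+ 2 * p x)%:E =
      \int[mu]_(x in `[0%R, s]) (x ^+ 2 * p x)%:E + (- F s)%:E)%E.
    rewrite -head -ge0_integralD//=.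
    - by apply: eq_integral => x _; rewrite -EFinD addrC subrK.
    - by move=> x _; rewrite lee_fin.
    - by apply: measurable_funTS; exact/measurable_EFinP.
    - move=> x; rewrite /= in_itv/= => /andP[x0 xs]; rewrite lee_fin -mulrBl.
      by rewrite mulr_ge0// subr_ge0 ler_sqr ?nnegrE// ltW.
    - apply: measurable_funTS; apply/measurable_EFinP.
      exact: measurable_funB.
  have -> : (\int[mu]_(x in `[s, +oo[) (x ^+ 2 * p x)%:E =
      (- F s)%:E + \int[mu]_(x in `[s, +oo[) (s ^+ 2 * p x)%:E)%E.
    rewrite -tail -ge0_integralD//=.
    - by apply: eq_integral => x _; rewrite -EFinD subrK.
    - move=> x; rewrite /= in_itv/= andbT => sx; rewrite lee_fin -mulrBl.
      rewrite mulr_ge0// subr_ge0 ler_sqr ?nnegrE//; first exact: ltW.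
      exact: le_trans (ltW s0) sx.
    - apply: measurable_funTS; apply/measurable_EFinP.
      exact: measurable_funB.
    - by move=> x _; rewrite lee_fin.
    - by apply: measurable_funTS; exact/measurable_EFinP.
  by rewrite addeA.
have even_p x : p (- x) = p x.
  by rewrite /p normal_pdf_even ?gt_eqF.
have nneg : [set x : R | 0 <= x] = `[0, +oo[%classic.
  by apply/seteqP; split=> x /=; rewrite in_itv/= andbT.
rewrite ge0_integral_normal_prob//; last by move=> x; exact: sqr_ge0.
rewrite ge0_symfun_integralT//.
- rewrite nneg half -nneg -ge0_symfun_integralT//.
  + under eq_integral do rewrite EFinM.
    have mp' : measurable_fun setT (EFin \o p) by exact/measurable_EFinP.
    rewrite ge0_integralZl ?lee_fin ?sqr_ge0//; last first.
      by move=> x _; rewrite lee_fin.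
    by rewrite integral_normal_pdf mule1.
  + by move=> x; rewrite mulr_ge0// sqr_ge0.
  + by move=> x /=; rewrite even_p.
- by move=> x; rewrite mulr_ge0// sqr_ge0.
- by move=> x; rewrite [RHS]/= sqrrN -/(p (- x)) even_p.
Qed.

(** Reflecting the line turns the positive part of the identity into its
    negative part. *)
Lemma normal_first_moment (s : R) : 0 < s ->
  (\int[normal_prob 0 s]_x (Num.max x 0)%:E =
   \int[normal_prob 0 s]_x (Num.max (- x) 0)%:E)%E.
Proof.
move=> s0.
have mmax (g : R -> R) : measurable_fun setT g ->
    measurable_fun setT (fun x => Num.max (g x) 0).
  by move=> mg; exact: measurable_maxr.
rewrite !ge0_integral_normal_prob//; last 4 first.
- by apply: mmax; exact: oppr_measurable.
- by move=> x; rewrite le_max lexx orbT.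
- exact: mmax.
- by move=> x; rewrite le_max lexx orbT.
pose h x : R := Num.max x 0 * normal_pdf 0 s x.
have mh : measurable_fun setT h.
  by apply: measurable_funM; [exact: mmax|exact: measurable_normal_pdf].
have h0 x : (0 <= (h x)%:E)%E.
  by rewrite lee_fin mulr_ge0 ?normal_pdf_ge0// le_max lexx orbT.
transitivity (\int[pushforward mu (-%R : _ -> measurableTypeR R)]_x (h x)%:E)%E.
  by apply: eq_measure_integral => A mA _; apply/esym; exact: lebesgue_measureN.
have mh' : measurable_fun setT (EFin \o h) by exact/measurable_EFinP.
rewrite ge0_integral_pushforward; last 4 first.
- exact: oppr_measurable.
- exact: measurableT.
- exact: mh'.
- by move=> x _; exact: h0.
rewrite preimage_setT.
apply: eq_integral => x _; rewrite /h /= normal_pdf_even//.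
by rewrite gt_eqF.
Qed.

End normal_moments.

(** * Integrable and square integrable random variables *)

Section square_integrable.
Context d (Omega : measurableType d) (R : realType) (P : probability Omega R).
Implicit Types X Y : Omega -> R.

Definition intg (X : Omega -> R) := P.-integrable setT (EFin \o X).

(** Real valued, so that expectations obey the linear arithmetic of a field. *)
Definition Ex (X : Omega -> R) : R := \int[P]_w X w.

Lemma intg_measurable X : intg X -> measurable_fun setT X.
Proof. by move=> iX; apply/measurable_EFinP; exact: measurable_int iX. Qed.

Lemma ExE X : intg X -> ('E_P[X] = (Ex X)%:E)%E.
Proof.
by move=> iX; rewrite unlock /Ex /Rintegral fineK//; exact: integrable_fin_num.
Qed.

Lemma eq_Ex X Y : X =1 Y -> Ex X = Ex Y.
Proof. by move=> XY; apply: eq_Rintegral => w _; exact: XY. Qed.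

Lemma eq_intg X Y : X =1 Y -> intg X -> intg Y.
Proof. by move=> XY; apply: eq_integrable => // w _ /=; rewrite XY. Qed.

Lemma intg_cst c : intg (cst c).
Proof. exact: finite_measure_integrable_cst. Qed.

Lemma Ex_cst c : Ex (cst c) = c.
Proof. by rewrite /Ex Rintegral_cst// -[X in fine X]/(P setT) probability_setT/= mulr1. Qed.

Lemma intgD X Y : intg X -> intg Y -> intg (X \+ Y).
Proof. by move=> iX iY; exact: (integrableD measurableT iX iY). Qed.

Lemma intgZ c X : intg X -> intg (c \*o X).
Proof. by move=> iX; exact: (integrableZl measurableT c iX). Qed.

Lemma intg_sum I (r : seq I) (Q : pred I) (X : I -> Omega -> R) :
  (forall i, intg (X i)) -> intg (fun w => \sum_(i <- r | Q i) X i w).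
Proof.
move=> iX.
have := integrable_sum measurableT r (P := Q) (h := fun i => EFin \o X i)
  (fun i _ => iX i).
by apply: eq_integrable => // w _ /=; rewrite sumEFin.
Qed.

Lemma ExD X Y : intg X -> intg Y -> Ex (X \+ Y) = Ex X + Ex Y.
Proof. by move=> iX iY; exact: RintegralD. Qed.

Lemma ExZ c X : intg X -> Ex (c \*o X) = c * Ex X.
Proof. by move=> iX; exact: RintegralZl. Qed.

Lemma Ex_sum I (r : seq I) (Q : pred I) (X : I -> Omega -> R) :
  (forall i, intg (X i)) ->
  Ex (fun w => \sum_(i <- r | Q i) X i w) = \sum_(i <- r | Q i) Ex (X i).
Proof.
move=> iX; elim: r => [|i r IH].
  by rewrite big_nil -[RHS](Ex_cst 0); apply: eq_Ex => w; rewrite big_nil.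
rewrite big_cons -IH; case: ifPn => Qi.
  by rewrite -ExD//; [apply: eq_Ex => w; rewrite big_cons Qi|exact: intg_sum].
by apply: eq_Ex => w; rewrite big_cons (negPf Qi).
Qed.

Lemma Ex_ge0 X : (forall w, 0 <= X w) -> 0 <= Ex X.
Proof. by move=> X0; apply: Rintegral_ge0. Qed.

Lemma le_intg X Y : measurable_fun setT X -> (forall w, `|X w| <= `|Y w|) ->
  intg Y -> intg X.
Proof.
move=> mX XY; apply: le_integrable => //; first exact/measurable_EFinP.
by move=> w _ /=; rewrite lee_fin.
Qed.

Lemma ae_le_Ex X Y : measurable_fun setT X ->
  (forall w, 0 <= X w) -> (forall w, 0 <= Y w) ->
  {ae P, forall w, X w <= Y w} -> intg Y -> intg X /\ Ex X <= Ex Y.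
Proof.
move=> mX X0 Y0 XY iY.
have mX' : measurable_fun setT (EFin \o X) by exact/measurable_EFinP.
have le : (\int[P]_w (X w)%:E <= \int[P]_w (Y w)%:E)%E.
  apply: ae_ge0_le_integral => //.
  - by move=> w _; rewrite lee_fin.
  - by move=> w _; rewrite lee_fin.
  - exact: measurable_int iY.
  - by apply: filterS XY => w XYw _; rewrite lee_fin.
have iX : intg X.
  apply/integrableP; split => //.
  under eq_integral do rewrite /= ger0_norm//.
  by apply: le_lt_trans le _; exact: integrable_lty iY.
split=> //; rewrite /Ex /Rintegral fine_le//; exact: integrable_fin_num.
Qed.

Definition L2 (X : Omega -> R) :=
  measurable_fun setT X /\ intg (fun w => X w ^+ 2).

Lemma L2_mul X Y : L2 X -> L2 Y -> intg (fun w => X w * Y w).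
Proof.
move=> [mX iX] [mY iY]; apply: le_intg (intgD iX iY).
  exact: measurable_funM.
move=> w /=; rewrite [leRHS]ger0_norm ?addr_ge0 ?sqr_ge0//.
rewrite normrM -(real_normK (num_real (X w))) -(real_normK (num_real (Y w))).
have := sqr_ge0 (`|X w| - `|Y w|); have := normr_ge0 (X w).
have := normr_ge0 (Y w); nra.
Qed.

Lemma L2_cst c : L2 (cst c).
Proof. by split => //; exact: (intg_cst (c ^+ 2)). Qed.

Lemma L2_intg X : L2 X -> intg X.
Proof.
by move=> /(L2_mul (L2_cst 1)); apply: eq_intg => w; rewrite /= mul1r.
Qed.

Lemma L2D X Y : L2 X -> L2 Y -> L2 (X \+ Y).
Proof.
move=> LX LY; split; first by apply: measurable_funD; [case: LX|case: LY].
have := intgD (intgD LX.2 LY.2) (intgZ 2 (L2_mul LX LY)).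
by apply: eq_intg => w /=; ring.
Qed.

Lemma L2Z c X : L2 X -> L2 (c \*o X).
Proof.
move=> LX; split; first by apply: measurable_funM => //; case: LX.
have := intgZ (c ^+ 2) LX.2.
by apply: eq_intg => w /=; ring.
Qed.

Lemma L2_sum I (r : seq I) (Q : pred I) (X : I -> Omega -> R) :
  (forall i, L2 (X i)) -> L2 (fun w => \sum_(i <- r | Q i) X i w).
Proof.
move=> LX; elim: r => [|i r IH].
  rewrite (_ : (fun _ => _) = cst 0); first exact: L2_cst.
  by apply/funext => w; rewrite big_nil.
have [Qi|Qi] := boolP (Q i); last first.
  rewrite (_ : (fun _ => _) = fun w => \sum_(i <- r | Q i) X i w)//.
  by apply/funext => w; rewrite big_cons (negPf Qi).
rewrite (_ : (fun _ => _) = X i \+ (fun w => \sum_(i <- r | Q i) X i w)).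
  exact: L2D.
by apply/funext => w; rewrite big_cons Qi.
Qed.

Lemma integral_set_indic (A : set Omega) (X : Omega -> R) : measurable A ->
  (\int[P]_(w in A) (X w)%:E = \int[P]_w (X w * \1_A w)%:E)%E.
Proof.
move=> mA; rewrite integral_mkcond; apply: eq_integral => w _.
by rewrite patchE indicE; case: ifPn; rewrite ?mulr1 ?mulr0.
Qed.

Lemma intg_indic A X : measurable A -> intg X -> intg (fun w => X w * \1_A w).
Proof.
move=> mA iX; have mX := intg_measurable iX; apply: le_intg iX.
  by apply: measurable_funM => //; exact: measurable_indic.
move=> w; rewrite normrM ler_piMr// ger0_norm// indicE.
Qed.

End square_integrable.

(** * Products with increments independent of the past *)

Section independent_increments.
Context d (Omega : measurableType d) (R : realType) (P : probability Omega R).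
Variables (G : set (set Omega)) (m : nat) (D : 'I_m -> Omega -> R) (s : R).
Hypotheses (sG : sigma_algebra setT G) (GM : G `<=` measurable).
Hypothesis mD : forall j, measurable_fun setT (D j).
Hypothesis s0 : 0 < s.
Hypothesis D_indep : forall (A : set Omega) (B : 'I_m -> set R),
  G A -> (forall j, measurable (B j)) ->
  P (A `&` [set w | forall j, B j (D j w)]) =
  (P A * \prod_(j < m) normal_prob 0 s (B j))%E.

Let GT : G setT.
Proof. by have [G0 GC _] := sG; rewrite -(setD0 setT); exact: GC. Qed.

Let preim j (B : set R) : measurable B -> measurable (D j @^-1` B).
Proof. by move=> mB; rewrite -[X in measurable X]setTI; exact: mD. Qed.

Lemma increment_event1 j A B : G A -> measurable B ->
  P (A `&` D j @^-1` B) = (P A * normal_prob 0%R s B)%E.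
Proof.
move=> GA mB.
have := D_indep (B := fun i => if i == j then B else setT) GA.
rewrite (bigD1 j)//= eqxx big1 ?mule1; last first.
  by move=> i /negPf ->; exact: (probability_setT (normal_prob 0 s)).
move=> <-; last by move=> i; case: eqP.
congr (P (_ `&` _)); apply/seteqP; split=> w /=.
  by move=> Bw i; case: eqP => // ->.
by move=> /(_ j); rewrite eqxx.
Qed.

Lemma increment_event2 j k A B C : j != k -> G A -> measurable B ->
  measurable C ->
  P (A `&` D j @^-1` B `&` D k @^-1` C) =
  (P A * normal_prob 0%R s B * normal_prob 0%R s C)%E.
Proof.
move=> jk GA mB mC.
have := D_indep (B := fun i => if i == j then B else if i == k then C else setT) GA.
rewrite (bigD1 j)//= eqxx (bigD1 k)/=; last by rewrite eq_sym.
rewrite eq_sym (negPf jk) eqxx big1 ?mule1; last first.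
  by move=> i /andP[/negPf -> /negPf ->]; exact: (probability_setT (normal_prob 0 s)).
rewrite muleA => <-; last by move=> i; case: eqP => // _; case: eqP.
rewrite -setIA; congr (P (_ `&` _)); apply/seteqP; split=> w /=.
  by move=> [Bw Cw] i; case: eqP => [->//|_]; case: eqP => [->|].
move=> H; split; first by have := H j; rewrite eqxx.
by have := H k; rewrite eqxx eq_sym (negPf jk).
Qed.

Lemma increment_law j (f : R -> R) : measurable_fun setT f ->
  (forall x, 0 <= f x) ->
  (\int[P]_w (f (D j w))%:E = \int[normal_prob 0%R s]_x (f x)%:E)%E.
Proof.
move=> mf f0.
have mf' : measurable_fun setT (EFin \o f) by exact/measurable_EFinP.
have mDj : measurable_fun setT (D j : Omega -> measurableTypeR R) := mD j.
pose X : {mfun Omega >-> measurableTypeR R} :=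
  HB.pack (D j) (isMeasurableFun.Build _ _ _ _ _ mDj).
transitivity (\int[distribution P X]_x (f x)%:E)%E.
  by rewrite ge0_integral_distribution// => x; rewrite lee_fin.
apply: eq_measure_integral => A mA _.
have := increment_event1 j GT mA.
by rewrite setTI [P setT]probability_setT mul1e.
Qed.

Lemma increment_L2 j : L2 P (D j).
Proof.
split; first exact: mD.
apply/integrableP; split; first by apply/measurable_EFinP/measurable_funX.
under eq_integral do rewrite /= ger0_norm ?sqr_ge0//.
rewrite (@increment_law j (fun x => x ^+ 2)) ?normal_second_moment ?ltry//.
by move=> x; exact: sqr_ge0.
Qed.

Lemma increment_var j : Ex P (fun w => D j w ^+ 2) = s ^+ 2.
Proof.
rewrite /Ex /Rintegral (@increment_law j (fun x => x ^+ 2)).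
- by rewrite normal_second_moment.
- exact: measurable_funX.
- by move=> x; exact: sqr_ge0.
Qed.

Lemma increment_mean j : Ex P (D j) = 0.
Proof.
have iD := L2_intg (increment_L2 j).
have mmax (g : R -> R) : measurable_fun setT g ->
    measurable_fun setT (fun x => Num.max (g x) 0).
  by move=> mg; exact: measurable_maxr.
have max0 (x : R) : 0 <= Num.max x 0 by rewrite le_max lexx orbT.
have bnd (x : R) : `|Num.max x 0| <= `|x|.
  by rewrite ger0_norm// ge_max ler_norm/=.
have ip : intg P (fun w => Num.max (D j w) 0).
  by apply: le_intg iD => //; apply: measurable_maxr.
have ineg : intg P (fun w => Num.max (- D j w) 0).
  apply: le_intg iD => //; last by move=> w; rewrite -(normrN (D j w)).
  apply: measurable_maxr => //; exact: measurableT_comp.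
have -> : Ex P (D j) = Ex P (fun w => Num.max (D j w) 0) -
    Ex P (fun w => Num.max (- D j w) 0).
  rewrite -mulN1r -ExZ// -ExD//; last exact: intgZ.
  apply: eq_Ex => w /=; rewrite mulN1r.
  have [u0|u0] := leP (D j w) 0; have [v0|v0] := leP (- D j w) 0; lra.
apply/eqP; rewrite subr_eq0 /Ex /Rintegral; apply/eqP; congr fine.
rewrite (@increment_law j (fun x => Num.max x 0))//; last exact: mmax.
rewrite (@increment_law j (fun x => Num.max (- x) 0))//.
  exact: normal_first_moment.
by apply: mmax; exact: oppr_measurable.
Qed.

(** The events generated by [D j] are independent of [S], so that [1_S] and the
    constant [P S] have the same integral on each of them. *)
Lemma increment_indep_set (S : set Omega) j (f : R -> R) : measurable S ->
  (forall B, measurable B ->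
    P (S `&` D j @^-1` B) = (P S * normal_prob 0%R s B)%E) ->
  measurable_fun setT f -> intg P (fun w => f (D j w)) ->
  Ex P (fun w => f (D j w) * \1_S w) = fine (P S) * Ex P (fun w => f (D j w)).
Proof.
move=> mS indS mf iD; have mDf := intg_measurable iD.
have iS : intg P \1_S by exact: integrable_indic.
rewrite -ExZ// /Ex /Rintegral; congr fine.
under [RHS]eq_integral do rewrite /= mulrC.
apply: (eq_integral_multiplier (G := preimage_set_system setT (D j) measurable)
   (U := fun w => f (D j w)) (X := \1_S) (Y := cst (fine (P S)))) => //.
- exact: sigma_algebra_preimage (sigma_algebra_measurable _).
- by move=> _ [B mB <-]; rewrite setTI; exact: preim.
- move=> B mB; exists (f @^-1` B); first by rewrite -[X in measurable X]setTI; exact: mf.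
  by rewrite setTI.
- exact: intg_cst.
- exact: intg_indic.
- have := intgZ (fine (P S)) iD.
  by apply: eq_intg => w /=; rewrite mulrC.
- move=> _ [B mB <-]; rewrite setTI integral_indic//=; last exact: preim.
  rewrite integral_cst//=; last exact: preim.
  rewrite setIC fineK ?fin_num_measure// setIC indS//.
  have := increment_event1 j GT mB.
  by rewrite setTI [P setT]probability_setT mul1e => ->.
Qed.

Lemma Ex_increment_set A j : G A -> Ex P (fun w => D j w * \1_A w) = 0.
Proof.
move=> GA.
rewrite (@increment_indep_set A j id) ?increment_mean ?mulr0//.
- exact: GM.
- by move=> B mB; exact: increment_event1.
- exact: L2_intg (increment_L2 j).
Qed.

Lemma Ex_increment_sq_set A j : G A ->
  Ex P (fun w => D j w ^+ 2 * \1_A w) = s ^+ 2 * fine (P A).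
Proof.
move=> GA.
rewrite (@increment_indep_set A j (fun x => x ^+ 2)) ?increment_var 1?mulrC//.
- exact: GM.
- by move=> B mB; exact: increment_event1.
- exact: (increment_L2 j).2.
Qed.

(** On an event of [G], [D k] is a multiplier for [D j], and the events it
    generates are independent of [D j] even after intersection with [A]. *)
Lemma Ex_increment_mul_set A j k : j != k -> G A ->
  Ex P (fun w => D j w * D k w * \1_A w) = 0.
Proof.
move=> jk GA.
have mA := GM GA.
have iDA : intg P (fun w => D j w * \1_A w).
  by apply: intg_indic => //; exact: L2_intg (increment_L2 j).
have iDD := L2_mul (increment_L2 j) (increment_L2 k).
have -> : Ex P (fun w => D j w * D k w * \1_A w) =
    Ex P (fun w => D k w * cst 0 w); last first.
  by rewrite -[RHS](Ex_cst P 0); apply: eq_Ex => w /=; rewrite mulr0.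
rewrite /Ex /Rintegral; congr fine.
under eq_integral do rewrite -mulrA mulrCA.
apply: (eq_integral_multiplier (G := preimage_set_system setT (D k) measurable)
   (U := D k) (X := fun w => D j w * \1_A w)) => //.
- exact: sigma_algebra_preimage (sigma_algebra_measurable _).
- by move=> _ [B mB <-]; rewrite setTI; exact: preim.
- by move=> B mB; exists B => //; rewrite setTI.
- exact: intg_cst.
- have := intg_indic mA iDD.
  by apply: eq_intg => w /=; rewrite -mulrA mulrCA.
- by have := intg_cst P 0; apply: eq_intg => w /=; rewrite mulr0.
- move=> _ [B mB <-]; rewrite setTI.
  have mB' := preim k mB.
  rewrite integral_set_indic// integral0.
  have E w : D j w * \1_A w * \1_(D k @^-1` B) w =
      D j w * \1_(A `&` D k @^-1` B) w :> R by rewrite indicI /= mulrA.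
  under eq_integral do rewrite E.
  have mAB : measurable (A `&` D k @^-1` B) by exact: measurableI.
  rewrite -[LHS]fineK; last first.
    apply: integrable_fin_num => //.
    exact: intg_indic mAB (L2_intg (increment_L2 j)).
  congr EFin; rewrite -[LHS]/(Ex P (fun w => D j w * \1_(A `&` D k @^-1` B) w)).
  rewrite (@increment_indep_set _ j id) ?increment_mean ?mulr0//.
    move=> C mC; rewrite increment_event2//; last by rewrite eq_sym.
    by rewrite increment_event1.
  exact: L2_intg (increment_L2 j).
Qed.

Lemma Ex_mul_increment U j : sub_measurable G U -> intg P U ->
  intg P (fun w => U w * D j w) -> Ex P (fun w => U w * D j w) = 0.
Proof.
move=> GU iU iUD.
have -> : Ex P (fun w => U w * D j w) = Ex P (fun w => U w * cst 0 w); last first.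
  by rewrite -[RHS](Ex_cst P 0); apply: eq_Ex => w /=; rewrite mulr0.
rewrite /Ex /Rintegral; congr fine.
apply: (eq_integral_multiplier (G := G) (U := U) (X := D j)) => //.
- exact: L2_intg (increment_L2 j).
- exact: intg_cst.
- by have := intg_cst P 0; apply: eq_intg => w /=; rewrite mulr0.
- move=> A GA; rewrite integral0 integral_set_indic; last exact: GM.
  rewrite -[LHS]fineK; last first.
    apply: integrable_fin_num => //.
    exact: intg_indic (GM GA) (L2_intg (increment_L2 j)).
  by congr EFin; exact: Ex_increment_set.
Qed.

Lemma mul_increment_L2 U j : sub_measurable G U -> L2 P U ->
  L2 P (fun w => U w * D j w) /\
  Ex P (fun w => (U w * D j w) ^+ 2) = s ^+ 2 * Ex P (fun w => U w ^+ 2).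
Proof.
move=> GU LU; have mU := LU.1.
have mUD : measurable_fun setT (fun w => U w * D j w) by exact: measurable_funM.
have GU2 : sub_measurable G (fun w => U w ^+ 2).
  apply/(sub_measurableP _ sG); apply: measurable_funX.
  exact/(sub_measurableP _ sG).
have H : (\int[P]_w ((U w * D j w) ^+ 2)%:E = (s ^+ 2 * Ex P (fun w => U w ^+ 2))%:E)%E.
  under eq_integral do rewrite exprMn.
  rewrite (eq_ge0_integral_multiplier (m2 := P) (Y := cst (s ^+ 2)) sG GM GU2)//.
  - have := ExE (intgZ (s ^+ 2) LU.2); rewrite unlock ExZ//; last exact: LU.2.
    by move=> <-; apply: eq_integral => w _ /=; rewrite mulrC.
  - by move=> w; exact: sqr_ge0.
  - exact: measurable_funX.
  - by move=> w; exact: sqr_ge0.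
  - by move=> w; exact: sqr_ge0.
  - move=> A GA; have mA := GM GA.
    rewrite /= integral_cst//= integral_set_indic// -[in RHS](@fineK _ (P A)) ?fin_num_measure//.
    rewrite -[LHS]fineK; last first.
      apply: integrable_fin_num => //.
      exact: intg_indic mA (increment_L2 j).2.
    by rewrite -EFinM; congr EFin; exact: Ex_increment_sq_set.
split; last by rewrite {1}/Ex /Rintegral H.
split=> //; apply/integrableP; split.
  by apply/measurable_EFinP; exact: measurable_funX.
by under eq_integral do rewrite /= ger0_norm ?sqr_ge0//; rewrite H ltry.
Qed.

Lemma Ex_mul_increment2 U V j k : sub_measurable G U -> sub_measurable G V ->
  L2 P U -> L2 P V ->
  Ex P (fun w => (U w * D j w) * (V w * D k w)) =
  (j == k)%:R * (s ^+ 2 * Ex P (fun w => U w * V w)).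
Proof.
move=> GU GV LU LV.
have [LUD _] := mul_increment_L2 j GU LU.
have [LVD _] := mul_increment_L2 k GV LV.
pose c := (j == k)%:R * s ^+ 2 : R.
have GUV : sub_measurable G (fun w => U w * V w).
  by apply/(sub_measurableP _ sG); apply: measurable_funM; exact/(sub_measurableP _ sG).
have iUV := L2_mul LU LV.
rewrite mulrA -/c -ExZ//.
transitivity (Ex P (fun w => (U w * V w) * (D j w * D k w))).
  by apply: eq_Ex => w; ring.
transitivity (Ex P (fun w => (U w * V w) * cst c w)); last first.
  by apply: eq_Ex => w /=; rewrite mulrC.
rewrite /Ex /Rintegral; congr fine.
apply: (eq_integral_multiplier (G := G) (U := fun w => U w * V w)
  (X := fun w => D j w * D k w)) => //.
- exact: L2_mul (increment_L2 j) (increment_L2 k).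
- exact: intg_cst.
- by have := L2_mul LUD LVD; apply: eq_intg => w /=; ring.
- by have := intgZ c iUV; apply: eq_intg => w /=; rewrite mulrC.
- move=> A GA; have mA := GM GA.
  rewrite /= integral_cst//= integral_set_indic// -[in RHS](@fineK _ (P A)) ?fin_num_measure//.
  rewrite -[LHS]fineK; last first.
    apply: integrable_fin_num => //; apply: intg_indic mA _.
    exact: L2_mul (increment_L2 j) (increment_L2 k).
  rewrite -EFinM; congr EFin; rewrite /c; have [<-|jk] := eqVneq j k.
    by rewrite mul1r; exact: Ex_increment_sq_set.
  by rewrite !mul0r; exact: Ex_increment_mul_set.
Qed.

End independent_increments.

(** * Euclidean norm and inner product *)

Section euclid.
Context (R : realType).

Lemma enorm_sq p q (A : 'M[R]_(p, q)) :
  enorm A ^+ 2 = \sum_i \sum_j A i j ^+ 2.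
Proof.
have trE : \tr (A^T *m A) = \sum_i \sum_j A i j ^+ 2.
  rewrite exchange_big /=; apply: eq_bigr => j _; rewrite mxE.
  by apply: eq_bigr => i _; rewrite mxE expr2.
rewrite /enorm sqr_sqrtr trE//; apply: sumr_ge0 => i _.
by apply: sumr_ge0 => j _; exact: sqr_ge0.
Qed.

Lemma enorm_ge0 p q (A : 'M[R]_(p, q)) : 0 <= enorm A.
Proof. exact: sqrtr_ge0. Qed.

Lemma enorm_sq_col d (x : 'cV[R]_d) : enorm x ^+ 2 = dotp x x.
Proof.
by rewrite enorm_sq; apply: eq_bigr => i _; rewrite big_ord1 expr2.
Qed.

Lemma dotpC d (x y : 'cV[R]_d) : dotp x y = dotp y x.
Proof. by apply: eq_bigr => i _; rewrite mulrC. Qed.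

Lemma dotpDr d (x y z : 'cV[R]_d) : dotp x (y + z) = dotp x y + dotp x z.
Proof. by rewrite -big_split; apply: eq_bigr => i _; rewrite mxE mulrDr. Qed.

Lemma dotpDl d (x y z : 'cV[R]_d) : dotp (x + y) z = dotp x z + dotp y z.
Proof. by rewrite dotpC dotpDr !(dotpC z). Qed.

Lemma dotpZr d a (x y : 'cV[R]_d) : dotp x (a *: y) = a * dotp x y.
Proof. by rewrite mulr_sumr; apply: eq_bigr => i _; rewrite mxE mulrCA. Qed.

Lemma dotpNr d (x y : 'cV[R]_d) : dotp x (- y) = - dotp x y.
Proof. by rewrite -scaleN1r dotpZr mulN1r. Qed.

Lemma enorm_sqD d (x y : 'cV[R]_d) :
  enorm (x + y) ^+ 2 = enorm x ^+ 2 + 2 * dotp x y + enorm y ^+ 2.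
Proof.
by rewrite !enorm_sq_col dotpDr !dotpDl (dotpC y x); ring.
Qed.

Lemma enorm_sqZ p q a (A : 'M[R]_(p, q)) : enorm (a *: A) ^+ 2 = a ^+ 2 * enorm A ^+ 2.
Proof.
rewrite !enorm_sq mulr_sumr; apply: eq_bigr => i _.
by rewrite mulr_sumr; apply: eq_bigr => j _; rewrite mxE exprMn.
Qed.

Lemma enorm_sqN p q (A : 'M[R]_(p, q)) : enorm (- A) ^+ 2 = enorm A ^+ 2.
Proof. by rewrite -scaleN1r enorm_sqZ sqrrN expr1n mul1r. Qed.

Lemma enorm_entry p q (A : 'M[R]_(p, q)) i j : `|A i j| <= enorm A.
Proof.
rewrite -(@ler_pXn2r _ 2)// ?nnegrE ?enorm_ge0// real_normK ?num_real//.
rewrite enorm_sq (bigD1 i)//= (bigD1 j)//= -addrA lerDl addr_ge0//.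
  by apply: sumr_ge0 => k _; exact: sqr_ge0.
by apply: sumr_ge0 => k _; apply: sumr_ge0 => l _; exact: sqr_ge0.
Qed.

Lemma enorm0 p q : enorm (0 : 'M[R]_(p, q)) = 0.
Proof. by rewrite /enorm mulmx0 mxtrace0 sqrtr0. Qed.

(** The polarised form of [0 <= |c x - y|^2]. *)
Lemma dotp_young d (c : R) (x y : 'cV[R]_d) : 0 < c ->
  2 * dotp x y <= c * enorm x ^+ 2 + c^-1 * enorm y ^+ 2.
Proof.
move=> c0; have := sqr_ge0 (enorm (c *: x - y)).
rewrite enorm_sqD enorm_sqN dotpNr (dotpC _ y) dotpZr enorm_sqZ (dotpC y).
move=> H; rewrite -(ler_pM2l c0).
have -> : c * (c * enorm x ^+ 2 + c^-1 * enorm y ^+ 2) =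
  c ^+ 2 * enorm x ^+ 2 + enorm y ^+ 2 by field; exact: lt0r_neq0.
lra.
Qed.

Lemma enorm_sqD_le p q (A B : 'M[R]_(p, q)) :
  enorm (A + B) ^+ 2 <= 2 * enorm A ^+ 2 + 2 * enorm B ^+ 2.
Proof.
rewrite !enorm_sq !mulr_sumr -big_split; apply: ler_sum => i _ /=.
rewrite !mulr_sumr -big_split; apply: ler_sum => j _ /=; rewrite mxE.
have := sqr_ge0 (A i j - B i j); nra.
Qed.

End euclid.

(** * Square integrable random matrices *)

Section square_integrable_mx.
Context dd (Omega : measurableType dd) (R : realType) (P : probability Omega R).

Definition L2mx p q (X : Omega -> 'M[R]_(p, q)) :=
  forall i j, L2 P (fun w => X w i j).

Lemma L2mxD p q (X Y : Omega -> 'M[R]_(p, q)) : L2mx X -> L2mx Y -> L2mx (X \+ Y).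
Proof.
move=> LX LY i j; have := L2D (LX i j) (LY i j).
by congr L2; apply/funext => w /=; rewrite mxE.
Qed.

Lemma intg_enorm_sq p q (X : Omega -> 'M[R]_(p, q)) :
  L2mx X -> intg P (fun w => enorm (X w) ^+ 2).
Proof.
move=> LX; under [X in intg _ X]funext do rewrite enorm_sq.
by apply: intg_sum => i; apply: intg_sum => j; exact: (LX i j).2.
Qed.

Lemma Ex_enorm_sq p q (X : Omega -> 'M[R]_(p, q)) : L2mx X ->
  Ex P (fun w => enorm (X w) ^+ 2) = \sum_i \sum_j Ex P (fun w => X w i j ^+ 2).
Proof.
move=> LX; under [X in Ex _ X]funext do rewrite enorm_sq.
rewrite Ex_sum; last by move=> i; apply: intg_sum => j; exact: (LX i j).2.
by apply: eq_bigr => i _; rewrite Ex_sum// => j; exact: (LX i j).2.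
Qed.

Lemma measurable_enorm_sq p q (A : set Omega) (X : Omega -> 'M[R]_(p, q)) :
  (forall i j, measurable_fun A (fun w => X w i j)) ->
  measurable_fun A (fun w => enorm (X w) ^+ 2).
Proof.
move=> mX; under [X in measurable_fun _ X]funext do rewrite enorm_sq.
by apply: measurable_sum => i; apply: measurable_sum => j; exact: measurable_funX.
Qed.

Lemma L2mx_enorm p q (X : Omega -> 'M[R]_(p, q)) :
  (forall i j, measurable_fun setT (fun w => X w i j)) ->
  intg P (fun w => enorm (X w) ^+ 2) -> L2mx X.
Proof.
move=> mX iX i j; split; first exact: mX.
apply: le_intg iX; first exact: measurable_funX.
move=> w; rewrite !normrX lerXn2r ?nnegrE//.
by rewrite [leRHS]ger0_norm ?enorm_ge0// enorm_entry.
Qed.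

Lemma intg_dotp d (X Y : Omega -> 'cV[R]_d) :
  L2mx X -> L2mx Y -> intg P (fun w => dotp (X w) (Y w)).
Proof. by move=> LX LY; apply: intg_sum => i; exact: L2_mul. Qed.

Lemma Ex_dotp d (X Y : Omega -> 'cV[R]_d) : L2mx X -> L2mx Y ->
  Ex P (fun w => dotp (X w) (Y w)) = \sum_i Ex P (fun w => X w i 0 * Y w i 0).
Proof. by move=> LX LY; rewrite Ex_sum// => i; exact: L2_mul. Qed.

End square_integrable_mx.

(** * Increments of Brownian motion *)

Section brownian_moments.
Context dd (Omega : measurableType dd) (R : realType) (P : probability Omega R).
Variables (T : R) (F : R -> set (set Omega)) (m : nat).
Variable W : R -> Omega -> 'cV[R]_m.
Hypotheses (F_usual : usual_filtration P T F) (W_bm : brownian_motion P T F W).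
Variables s t : R.
Hypotheses (s_ge0 : 0 <= s) (s_lt_t : s < t) (t_leT : t <= T).

Let sT : s \in `[0, T].
Proof. by rewrite in_itv/= s_ge0 (le_trans (ltW s_lt_t)). Qed.

Let tT : t \in `[0, T].
Proof. by rewrite in_itv/= t_leT (le_trans s_ge0) ?ltW. Qed.

Let D (j : 'I_m) (w : Omega) := (W t w - W s w) j 0.

Let mD j : measurable_fun setT (D j).
Proof.
have mW u : u \in `[0, T] -> measurable_fun setT (fun w => W u w j 0).
  move=> uT; apply: sub_measurable_measurable (filt_sub F_usual uT) _.
  exact: (bm_adapted W_bm uT).
rewrite (_ : D j = (fun w => W t w j 0) \- (fun w => W s w j 0)).
  by apply: measurable_funB; exact: mW.
by apply/funext => w; rewrite /D !mxE.
Qed.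

Let sG := filt_sigma F_usual sT.
Let GM := filt_sub F_usual sT.

Let sd0 : 0 < Num.sqrt (t - s). Proof. by rewrite sqrtr_gt0 subr_gt0. Qed.

Let indep := bm_increment W_bm s_ge0 s_lt_t t_leT.

(** Distinct coordinates of the increment are uncorrelated given the past, so only
    the squares of the entries of [A] survive. *)
Lemma mulmx_brownian d (A : Omega -> 'M[R]_(d, m)) :
  measurable_wrt (F s) A -> L2mx P A ->
  L2mx P (fun w => A w *m (W t w - W s w)) /\
  Ex P (fun w => enorm (A w *m (W t w - W s w)) ^+ 2) =
  (t - s) * Ex P (fun w => enorm (A w) ^+ 2).
Proof.
move=> FA LA.
have LAD i j : L2 P (fun w => A w i j * D j w).
  by have [] := mul_increment_L2 sG GM mD sd0 indep j (FA i j) (LA i j).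
have LV : L2mx P (fun w => A w *m (W t w - W s w)).
  move=> i k; rewrite (_ : (fun _ => _) = fun w => \sum_j A w i j * D j w).
    exact: L2_sum.
  by apply/funext => w; rewrite mxE; apply: eq_bigr => j _; rewrite (ord1 k).
split=> //; rewrite !Ex_enorm_sq// mulr_sumr; apply: eq_bigr => i _.
rewrite big_ord1 mulr_sumr.
transitivity (Ex P (fun w => \sum_j \sum_k (A w i j * D j w) * (A w i k * D k w))).
  apply: eq_Ex => w; rewrite mxE expr2 mulr_suml; apply: eq_bigr => j _.
  by rewrite mulr_sumr.
have LL j k := L2_mul (LAD i j) (LAD i k).
rewrite Ex_sum; last by move=> j; exact: intg_sum.
have E j k : Ex P (fun w => (A w i j * D j w) * (A w i k * D k w)) =
    (j == k)%:R * ((t - s) * Ex P (fun w => A w i j * A w i k)).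
  rewrite -[t - s in RHS]sqr_sqrtr ?subr_ge0 1?ltW//.
  apply: (Ex_mul_increment2 sG GM mD sd0 indep).
  - exact: FA.
  - exact: FA.
  - exact: LA.
  - exact: LA.
apply: eq_bigr => j _; rewrite Ex_sum// (bigD1 j)//= big1 ?addr0.
  by rewrite E eqxx mul1r.
by move=> k kj; rewrite E eq_sym (negPf kj) mul0r.
Qed.

Lemma Ex_dotp_brownian d (X : Omega -> 'cV[R]_d) (A : Omega -> 'M[R]_(d, m)) :
  measurable_wrt (F s) X -> measurable_wrt (F s) A -> L2mx P X -> L2mx P A ->
  Ex P (fun w => dotp (X w) (A w *m (W t w - W s w))) = 0.
Proof.
move=> FX FA LX LA.
have [LV _] := mulmx_brownian FA LA.
have LAD i j : L2 P (fun w => A w i j * D j w).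
  by have [] := mul_increment_L2 sG GM mD sd0 indep j (FA i j) (LA i j).
rewrite Ex_dotp// big1// => i _.
transitivity (Ex P (fun w => \sum_j X w i 0 * (A w i j * D j w))).
  by apply: eq_Ex => w; rewrite mxE mulr_sumr.
rewrite Ex_sum; last by move=> j; exact: L2_mul.
rewrite big1// => j _.
have <- : Ex P (fun w => (X w i 0 * A w i j) * D j w) = 0.
  apply: (Ex_mul_increment sG GM mD sd0 indep).
  - apply/(sub_measurableP _ sG); apply: measurable_funM.
      by apply/(sub_measurableP _ sG); exact: FX.
    by apply/(sub_measurableP _ sG); exact: FA.
  - exact: L2_mul.
  - by have := L2_mul (LX i 0) (LAD i j); apply: eq_intg => w; rewrite mulrA.
by apply: eq_Ex => w; rewrite mulrA.
Qed.

End brownian_moments.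

(** * Random matrices measurable for a sub-sigma-algebra *)

Section measurable_wrt_theory.
Context dd (Omega : measurableType dd) (R : realType).
Variable G : set (set Omega).
Hypothesis sG : sigma_algebra setT G.

Lemma measurable_wrtP p q (X : Omega -> 'M[R]_(p, q)) :
  measurable_wrt G X <->
  forall i j, measurable_fun setT
    ((fun w => X w i j) : g_sigma_algebraType G -> R).
Proof.
by split=> GX i j; [apply/(sub_measurableP _ sG)|apply/(sub_measurableP _ sG)];
  exact: GX.
Qed.

Lemma measurable_wrt_cst p q (A : 'M[R]_(p, q)) : measurable_wrt G (cst A).
Proof. by apply/measurable_wrtP => i j; exact: measurable_cst. Qed.

Lemma measurable_wrtD p q (X Y : Omega -> 'M[R]_(p, q)) :
  measurable_wrt G X -> measurable_wrt G Y -> measurable_wrt G (X \+ Y).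
Proof.
move=> /measurable_wrtP GX /measurable_wrtP GY; apply/measurable_wrtP => i j.
under eq_fun do rewrite mxE; exact: measurable_funD.
Qed.

Lemma measurable_wrtN p q (X : Omega -> 'M[R]_(p, q)) :
  measurable_wrt G X -> measurable_wrt G (fun w => - X w).
Proof.
move=> /measurable_wrtP GX; apply/measurable_wrtP => i j.
under eq_fun do rewrite mxE; exact: measurableT_comp.
Qed.

Lemma measurable_wrtB p q (X Y : Omega -> 'M[R]_(p, q)) :
  measurable_wrt G X -> measurable_wrt G Y ->
  measurable_wrt G (fun w => X w - Y w).
Proof. by move=> GX GY; apply: measurable_wrtD => //; exact: measurable_wrtN. Qed.

Lemma measurable_wrtM n p q (X : Omega -> 'M[R]_(n, p))
    (Y : Omega -> 'M[R]_(p, q)) :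
  measurable_wrt G X -> measurable_wrt G Y ->
  measurable_wrt G (fun w => X w *m Y w).
Proof.
move=> /measurable_wrtP GX /measurable_wrtP GY; apply/measurable_wrtP => i j.
under eq_fun do rewrite mxE; apply: measurable_sum => k.
exact: measurable_funM.
Qed.

Lemma measurable_wrt_sum p q n (X : nat -> Omega -> 'M[R]_(p, q)) :
  (forall i, (i < n)%N -> measurable_wrt G (X i)) ->
  measurable_wrt G (fun w => \sum_(i < n) X i w).
Proof.
elim: n => [|n IH] GX.
  under eq_fun do rewrite big_ord0; exact: measurable_wrt_cst.
under eq_fun do rewrite big_ord_recr; apply: measurable_wrtD; last exact: GX.
by apply: IH => i ni; apply: GX; rewrite ltnS ltnW.
Qed.

Lemma sub_measurable_enorm_sq p q (X : Omega -> 'M[R]_(p, q)) :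
  measurable_wrt G X -> sub_measurable G (fun w => enorm (X w) ^+ 2).
Proof.
move=> /measurable_wrtP GX; apply/(sub_measurableP _ sG).
under eq_fun do rewrite enorm_sq.
by apply: measurable_sum => i; apply: measurable_sum => j; exact: measurable_funX.
Qed.

Lemma measurable_wrtZ p q (f : Omega -> R) (X : Omega -> 'M[R]_(p, q)) :
  sub_measurable G f -> measurable_wrt G X ->
  measurable_wrt G (fun w => f w *: X w).
Proof.
move=> /(sub_measurableP _ sG) Gf /measurable_wrtP GX; apply/measurable_wrtP => i j.
under eq_fun do rewrite mxE; exact: measurable_funM.
Qed.

End measurable_wrt_theory.

Lemma measurable_wrtS dd (Omega : measurableType dd) (R : realType)
    (G G' : set (set Omega)) p q (X : Omega -> 'M[R]_(p, q)) :
  G `<=` G' -> measurable_wrt G X -> measurable_wrt G' X.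
Proof. by move=> GG' GX i j B mB; exact/GG'/GX. Qed.

Lemma measurable_wrt_entry dd (Omega : measurableType dd) (R : realType)
    (G : set (set Omega)) p q (X : Omega -> 'M[R]_(p, q)) i j :
  G `<=` measurable -> measurable_wrt G X ->
  measurable_fun setT (fun w => X w i j).
Proof. by move=> GM GX; exact: sub_measurable_measurable GM (GX i j). Qed.

(** * Discrete stochastic integrals *)

Section discrete_ito.
Context dd (Omega : measurableType dd) (R : realType) (P : probability Omega R).
Variables (T : R) (F : R -> set (set Omega)) (m : nat).
Variable W : R -> Omega -> 'cV[R]_m.
Hypotheses (F_usual : usual_filtration P T F) (W_bm : brownian_motion P T F W).
Variables (n : nat) (s : nat -> R).
Hypotheses (s0 : 0 <= s 0) (snT : s n <= T).
Hypothesis s_incr : forall i, (i < n)%N -> s i < s i.+1.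

Let s_mono i j : (i <= j)%N -> (j <= n)%N -> s i <= s j.
Proof.
elim: j => [|j IH]; first by rewrite leqn0 => /eqP ->.
rewrite leq_eqVlt => /predU1P[->//|ij] jn.
by apply: le_trans (IH _ _) (ltW (s_incr jn)) => //; exact: ltnW.
Qed.

Let s_in i : (i <= n)%N -> s i \in `[0, T].
Proof.
move=> ni; rewrite in_itv/= (le_trans s0 (s_mono (leq0n i) ni))/=.
exact: le_trans (s_mono ni (leqnn n)) snT.
Qed.

Let F_mono i j : (i <= j)%N -> (j <= n)%N -> F (s i) `<=` F (s j).
Proof.
move=> ij jn; have := s_in jn; have := s_in (leq_trans ij jn).
rewrite !in_itv/= => /andP[si0 _] /andP[_ sjT].
by apply: (filt_mono F_usual) => //; exact: s_mono.
Qed.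

Definition ito_sum d (H : nat -> Omega -> 'M[R]_(d, m)) (k : nat) (w : Omega) :=
  \sum_(i < k) H i w *m (W (s i.+1) w - W (s i) w).

Definition quad_sum d (H : nat -> Omega -> 'M[R]_(d, m)) (k : nat) (w : Omega) :=
  \sum_(i < k) (s i.+1 - s i) * enorm (H i w) ^+ 2.

Lemma ito_sum_adapted d (H : nat -> Omega -> 'M[R]_(d, m)) k : (k <= n)%N ->
  (forall i, (i < k)%N -> measurable_wrt (F (s i)) (H i)) ->
  measurable_wrt (F (s k)) (ito_sum H k).
Proof.
move=> kn FH; have sF := filt_sigma F_usual (s_in kn).
apply: (measurable_wrt_sum sF
  (X := fun i w => H i w *m (W (s i.+1) w - W (s i) w))) => i ik.
apply: (measurable_wrtM sF).
  by apply: measurable_wrtS (FH i ik); exact: F_mono (ltnW ik) kn.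
apply: (measurable_wrtB sF).
  apply: measurable_wrtS (bm_adapted W_bm (s_in (leq_trans ik kn))).
  exact: F_mono.
apply: measurable_wrtS (bm_adapted W_bm (s_in (ltnW (leq_trans ik kn)))).
exact: F_mono (ltnW ik) kn.
Qed.

(** Successive terms are orthogonal, because each increment of [W] is centred
    given the past. *)
Lemma ito_isometry d (H : nat -> Omega -> 'M[R]_(d, m)) k : (k <= n)%N ->
  (forall i, (i < k)%N -> measurable_wrt (F (s i)) (H i)) ->
  (forall i, (i < k)%N -> L2mx P (H i)) ->
  L2mx P (ito_sum H k) /\
  Ex P (fun w => enorm (ito_sum H k w) ^+ 2) = Ex P (quad_sum H k).
Proof.
elim: k => [|k IH] kn FH LH.
  have -> : ito_sum H 0 = cst 0 by apply/funext => w; rewrite /ito_sum big_ord0.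
  split; first by move=> i j; under eq_fun do rewrite mxE; exact: L2_cst.
  apply: eq_Ex => w; rewrite /quad_sum big_ord0/= enorm0 expr0n.
  by [].
have FH' i : (i < k)%N -> measurable_wrt (F (s i)) (H i).
  by move=> ik; apply: FH; rewrite ltnS ltnW.
have LH' i : (i < k)%N -> L2mx P (H i).
  by move=> ik; apply: LH; rewrite ltnS ltnW.
have [LI EI] := IH (ltnW kn) FH' LH'.
have FI := ito_sum_adapted (ltnW kn) FH'.
have := s_in (ltnW kn); have := s_in kn.
rewrite !in_itv/= => /andP[_ sT] /andP[sk0 _].
have [LD ED] := mulmx_brownian F_usual W_bm sk0 (s_incr kn) sT
  (FH k (ltnSn k)) (LH k (ltnSn k)).
have EID := Ex_dotp_brownian F_usual W_bm sk0 (s_incr kn) sT FI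
  (FH k (ltnSn k)) LI (LH k (ltnSn k)).
set D := fun w => H k w *m (W (s k.+1) w - W (s k) w) in LD ED EID.
have IE : ito_sum H k.+1 = ito_sum H k \+ D.
  by apply/funext => w; rewrite /ito_sum big_ord_recr.
rewrite IE; split; first exact: L2mxD.
have iI := intg_enorm_sq LI; have iD := intg_enorm_sq LD.
have iID := intg_dotp LI LD.
transitivity (Ex P ((fun w => enorm (ito_sum H k w) ^+ 2) \+
   (2 \*o (fun w => dotp (ito_sum H k w) (D w))) \+
   (fun w => enorm (D w) ^+ 2))).
  by apply: eq_Ex => w /=; rewrite enorm_sqD.
rewrite ExD//; last by apply: intgD => //; exact: intgZ.
rewrite ExD//; last exact: intgZ.
rewrite ExZ// [in X in _ + X + _]EID mulr0 addr0 EI ED.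
have iH : intg P (fun w => enorm (H k w) ^+ 2) by exact: intg_enorm_sq (LH k _).
have iQ : intg P (quad_sum H k).
  rewrite /quad_sum.
  apply: (@intg_sum _ _ _ P 'I_k (index_enum _) xpredT
    (fun i w => (s i.+1 - s i) * enorm (H i w) ^+ 2)) => i.
  by apply: intgZ; apply: intg_enorm_sq; exact: LH'.
rewrite -ExZ// -ExD//; last exact: intgZ.
by apply: eq_Ex => w; rewrite /quad_sum big_ord_recr.
Qed.

Lemma measurable_ge dd' (Om : measurableType dd') (X : Om -> R) (c : R) :
  measurable_fun setT X -> measurable [set w | c <= X w].
Proof.
move=> mX; rewrite (_ : [set _ | _] = X @^-1` `[c, +oo[).
  by rewrite -[X in measurable X]setTI; exact: mX.
by apply/seteqP; split=> w /=; rewrite in_itv/= andbT.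
Qed.

(** The integrand is switched off just before its quadratic sum would exceed
    [e]: the switched integrand is square integrable whatever [H] is, and
    differs from [H] only where the full quadratic sum exceeds [e]. *)
Lemma ito_sum_in_prob d (H : nat -> Omega -> 'M[R]_(d, m)) (e c : R) :
  0 < e -> 0 < c ->
  (forall i, (i < n)%N -> measurable_wrt (F (s i)) (H i)) ->
  (P [set w | (c <= enorm (ito_sum H n w))%R] <=
   P [set w | (e <= quad_sum H n w)%R] + (e / c ^+ 2)%:E)%E.
Proof.
move=> e0 c0 FH.
have ds i : (i < n)%N -> 0 < s i.+1 - s i.
  by move=> ni; rewrite subr_gt0 s_incr.
have q0 i w : (i < n)%N -> 0 <= (s i.+1 - s i) * enorm (H i w) ^+ 2.
  by move=> ni; rewrite mulr_ge0 ?sqr_ge0// ltW// ds.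
have Q_mono k l w : (k <= l)%N -> (l <= n)%N -> quad_sum H k w <= quad_sum H l w.
  elim: l => [|l IH]; first by rewrite leqn0 => /eqP ->.
  rewrite leq_eqVlt => /predU1P[->//|kl] ln.
  apply: le_trans (IH kl (ltnW ln)) _.
  by rewrite [leRHS]/quad_sum big_ord_recr lerDl q0.
have FQ i : (i < n)%N -> sub_measurable (F (s i)) (quad_sum H i.+1).
  move=> ni; have sF := filt_sigma F_usual (s_in (ltnW ni)).
  apply/(sub_measurableP _ sF); rewrite /quad_sum.
  apply: measurable_sum => j; apply: measurable_funM => //.
  apply/(sub_measurableP _ sF); apply: (sub_measurable_enorm_sq sF).
  have ji : (j <= i)%N by rewrite -ltnS.
  apply: measurable_wrtS (FH j (leq_ltn_trans ji ni)).
  exact: F_mono ji (ltnW ni).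
pose b i w : R := (quad_sum H i.+1 w <= e)%R%:R.
have Fb i : (i < n)%N -> sub_measurable (F (s i)) (b i).
  move=> ni; have sF := filt_sigma F_usual (s_in (ltnW ni)).
  apply/(sub_measurableP _ sF).
  have /(sub_measurableP _ sF) mQ := FQ i ni.
  have mA := @measurable_ge _ (g_sigma_algebraType (F (s i))) _ (- e)
     (measurableT_comp (@oppr_measurable R setT) mQ).
  rewrite (_ : b i = \1_[set w | - e <= - quad_sum H i.+1 w]).
    exact: measurable_indic.
  apply/funext => w; rewrite /b indicE; have [h|h] := leP (quad_sum H i.+1 w) e.
    by rewrite mem_set//= lerN2.
  by rewrite memNset//= lerN2 leNgt h.
pose H' i w := b i w *: H i w.
have FH' i : (i < n)%N -> measurable_wrt (F (s i)) (H' i).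
  move=> ni; apply: measurable_wrtZ; [|exact: Fb|exact: FH].
  exact: (filt_sigma F_usual (s_in (ltnW ni))).
have mH' i : (i < n)%N -> forall k l, measurable_fun setT (fun w => H' i w k l).
  move=> ni k l; apply: measurable_wrt_entry (FH' i ni).
  exact: (filt_sub F_usual (s_in (ltnW ni))).
have H'e k w : (k <= n)%N -> quad_sum H' k w <= e.
  elim: k => [|k IH] kn; first by rewrite /quad_sum big_ord0 ltW.
  rewrite /quad_sum big_ord_recr/= -/(quad_sum H' k w) /H' /b.
  have [Qe|_] := leP (quad_sum H k.+1 w) e; last first.
    by rewrite enorm_sqZ expr0n/= mul0r mulr0 addr0; exact: IH (ltnW kn).
  rewrite enorm_sqZ expr1n mul1r; apply: le_trans Qe.
  rewrite [leRHS]/quad_sum big_ord_recr/= lerD2r; apply: ler_sum => i _.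
  apply: ler_wpM2l; first by rewrite ltW// ds// (ltn_trans _ kn).
  rewrite enorm_sqZ ler_piMl ?sqr_ge0// /b.
  by rewrite expr_le1// lern1 leq_b1.
have LH' i : (i < n)%N -> L2mx P (H' i).
  move=> ni; apply: L2mx_enorm; first exact: mH'.
  have := intg_cst P (e / (s i.+1 - s i)); apply: le_intg.
    by apply: measurable_enorm_sq; exact: mH'.
  move=> w; rewrite ger0_norm ?sqr_ge0// ger0_norm/=; last first.
    by rewrite divr_ge0// ltW// ds.
  rewrite ler_pdivlMr ?ds// mulrC; apply: le_trans (H'e i.+1 w ni).
  rewrite /quad_sum big_ord_recr/= lerDr sumr_ge0// => j _.
  by rewrite mulr_ge0 ?sqr_ge0// ltW// ds// (ltn_trans _ ni).
have [LI EI] := ito_isometry (leqnn n) FH' LH'.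
have iI := intg_enorm_sq LI.
have EIe : Ex P (fun w => enorm (ito_sum H' n w) ^+ 2) <= e.
  have mQ : measurable_fun setT (quad_sum H' n).
    apply: measurable_sum => i; apply: measurable_funM => //.
    exact: measurable_enorm_sq (mH' i (ltn_ord i)).
  rewrite EI -[leRHS](Ex_cst P e).
  apply: (ae_le_Ex mQ _ _ _ (intg_cst P e)).2.
  - by move=> w; apply: sumr_ge0 => i _; rewrite mulr_ge0 ?sqr_ge0// ltW// ds.
  - by move=> w; exact: ltW.
  - by apply: aeW => w; exact: H'e.
have mI (K : nat -> Omega -> 'M[R]_(d, m)) :
    (forall i, (i < n)%N -> measurable_wrt (F (s i)) (K i)) ->
    measurable [set w | c <= enorm (ito_sum K n w)].
  move=> FK; rewrite (_ : [set _ | _] =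
      [set w | c ^+ 2 <= enorm (ito_sum K n w) ^+ 2]).
    apply: measurable_ge; apply: measurable_enorm_sq => i j.
    apply: measurable_wrt_entry (ito_sum_adapted (leqnn n) FK).
    exact: (filt_sub F_usual (s_in (leqnn n))).
  apply/seteqP; split=> w /=.
    by move=> cI; rewrite lerXn2r ?nnegrE ?enorm_ge0// ltW.
  by rewrite ler_pXn2r// nnegrE ?enorm_ge0// ltW.
set A := [set w | c <= enorm (ito_sum H' n w)].
have mA : measurable A by exact: mI.
have PA : (P A <= (e / c ^+ 2)%:E)%E.
  rewrite -[P A]fineK ?fin_num_measure// lee_fin ler_pdivlMr ?exprn_gt0// mulrC.
  apply: le_trans EIe; have iA : intg P \1_A by exact: integrable_indic.
  have -> : fine (P A) = Ex P \1_A.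
    by rewrite /Ex /Rintegral integral_indic// setIT.
  rewrite -ExZ//; apply: (ae_le_Ex _ _ _ _ iI).2.
  - by apply: measurable_funM => //; exact: measurable_indic.
  - by move=> w /=; rewrite mulr_ge0 ?sqr_ge0.
  - by move=> w; exact: sqr_ge0.
  - apply: aeW => w /=; rewrite indicE; have [|_] := boolP (w \in A).
      by rewrite inE/= mulr1 => cI; rewrite lerXn2r ?nnegrE ?enorm_ge0// ltW.
    by rewrite mulr0 sqr_ge0.
have mQ : measurable [set w | e <= quad_sum H n w].
  apply: measurable_ge; apply: measurable_sum => i; apply: measurable_funM => //.
  apply: measurable_enorm_sq => k l.
  apply: measurable_wrt_entry (FH i (ltn_ord i)).
  exact: (filt_sub F_usual (s_in (ltnW (ltn_ord i)))).
apply: le_trans (leeD (lexx _) PA).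
apply: le_trans; last exact: measureU2.
apply: le_measure; rewrite ?inE; [exact: mI|exact: measurableU|].
move=> w /= cI; have [eQ|Qe] := leP e (quad_sum H n w); [by left|right].
rewrite /A/= (_ : ito_sum H' n w = ito_sum H n w)//.
apply: eq_bigr => i _; congr (_ *m _); rewrite /H' /b.
rewrite (le_trans (Q_mono i.+1 n w _ _) (ltW Qe)) ?scale1r//.
Qed.

End discrete_ito.

(** * Simple processes on finer partitions *)

Section refinement.
Context (R : realType).
Implicit Types s : seq R.

Lemma sorted_telescope (V : zmodType) s (f : R -> V) (t u : R) :
  sorted <%R s -> t \in s -> u \in s -> t <= u ->
  \sum_(i < (size s).-1 | (t <= s`_i) && (s`_i < u)) (f s`_i.+1 - f s`_i) =
  f u - f t.
Proof.
move=> srt ts us tu.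
set p := index t s; set q := index u s.
have ps : (p < size s)%N by rewrite index_mem.
have qs : (q < size s)%N by rewrite index_mem.
have tE : t = s`_p by rewrite nth_index.
have uE : u = s`_q by rewrite nth_index.
have s0 : (0 < size s)%N by exact: leq_ltn_trans ps.
have pq : (p <= q)%N.
  by rewrite -(lt_sorted_leq_nth 0 srt)// -tE -uE.
rewrite uE tE -(telescope_sumr (fun i => f s`_i) pq).
rewrite (big_nat_widen _ _ (size s).-1); last by rewrite -ltnS prednK.
rewrite (big_nat_widenl _ 0)// big_mkord.
apply: eq_bigl => i.
have is' : (i < size s)%N by rewrite (leq_trans (ltn_ord i))// leq_pred.
by rewrite (lt_sorted_leq_nth 0 srt)// (lt_sorted_ltn_nth 0 srt)// andbC.
Qed.

Lemma sorted_cell s (t v : R) i : sorted <%R s -> t \in s ->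
  (i.+1 < size s)%N -> s`_i <= v < s`_i.+1 -> (t <= v) = (t <= s`_i).
Proof.
move=> srt ts is' /andP[iv vi].
have ps : (index t s < size s)%N by rewrite index_mem.
rewrite -(nth_index 0 ts).
have [pi|ip] := leqP (index t s) i.
  have pi' : s`_(index t s) <= s`_i.
    by rewrite (lt_sorted_leq_nth 0 srt)// inE (ltn_trans _ is').
  by rewrite pi' (le_trans pi').
have : s`_i.+1 <= s`_(index t s) by rewrite (lt_sorted_leq_nth 0 srt).
move=> H; apply/idP/idP => H'.
  by have := le_lt_trans (le_trans H H') vi; rewrite ltxx.
by have := le_lt_trans (le_trans H H') (le_lt_trans iv vi); rewrite ltxx.
Qed.

End refinement.

Section simple_process_theory.
Context dd (Omega : measurableType dd) (R : realType) (P : probability Omega R).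
Variables (T : R) (F : R -> set (set Omega)) (m : nat).
Variable W : R -> Omega -> 'cV[R]_m.

Definition knots p q (h : simple_process Omega R p q) : seq R :=
  [seq sp_time h j | j <- iota 0 (sp_size h).+1].

Lemma mem_knots p q (h : simple_process Omega R p q) j : (j <= sp_size h)%N ->
  sp_time h j \in knots h.
Proof. by move=> jh; apply/mapP; exists j => //; rewrite mem_iota/= add0n ltnS. Qed.

Lemma indic_itv (a b v : R) :
  \1_(`[a, b[%classic) v = ((a <= v) && (v < b))%:R :> R.
Proof.
rewrite indicE; case: (boolP (_ && _)) => h; first by rewrite mem_set//= in_itv.
by rewrite memNset//= in_itv/=; exact/negP.
Qed.

(** Simple processes come with unrelated partitions; their integrals can be added
    once they are all written over one partition containing all the knots. *)
Lemma simple_integral_refine d (h : simple_process Omega R d m) (s : seq R) w :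
  sorted <%R s -> {subset knots h <= s} ->
  (forall j, (j < sp_size h)%N -> sp_time h j < sp_time h j.+1) ->
  \sum_(i < (size s).-1) simple_fun h s`_i w *m (W s`_i.+1 w - W s`_i w) =
  simple_integral W h w.
Proof.
move=> srt hs incr.
under eq_bigr do rewrite mulmx_suml.
rewrite exchange_big /=; apply: eq_bigr => j _.
have tin : sp_time h j \in s by apply/hs/mem_knots; exact: ltnW.
have uin : sp_time h j.+1 \in s by apply/hs/mem_knots.
rewrite -(sorted_telescope (fun t => W t w) srt tin uin (ltW (incr j (ltn_ord j)))).
rewrite [RHS]mulmx_sumr [RHS]big_mkcond; apply: eq_bigr => i _.
rewrite indic_itv; case: ifP => _; last by rewrite scale0r mul0mx.
by rewrite scale1r.
Qed.

Lemma simple_fun_cell p q (h : simple_process Omega R p q) (s : seq R) w v i :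
  sorted <%R s -> {subset knots h <= s} ->
  (i.+1 < size s)%N -> s`_i <= v < s`_i.+1 ->
  simple_fun h v w = simple_fun h s`_i w.
Proof.
move=> srt hs is' vi; apply: eq_bigr => j _; congr (_ *: _).
rewrite !indic_itv (sorted_cell srt _ is' vi); last by apply/hs/mem_knots; exact: ltnW.
by rewrite !ltNge (sorted_cell srt _ is' vi)//; apply/hs/mem_knots.
Qed.

Lemma simple_time_mono p q (h : simple_process Omega R p q) (a b : R) k l :
  simple_on F a b h -> (k <= l)%N -> (l <= sp_size h)%N ->
  sp_time h k <= sp_time h l.
Proof.
move=> hs; elim: l => [|l IH]; first by rewrite leqn0 => /eqP ->.
rewrite leq_eqVlt => /predU1P[->//|kl] ln.
by apply: le_trans (IH kl (ltnW ln)) (ltW (simple_incr hs ln)).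
Qed.

Lemma simple_fun_out p q (h : simple_process Omega R p q) (a b v : R) w :
  simple_on F a b h -> ~~ ((a <= v) && (v < b)) -> simple_fun h v w = 0.
Proof.
move=> hs vab; rewrite /simple_fun big1// => j _; rewrite indic_itv.
case: (boolP (_ && _)) => [/andP[tv vt]|]; last by rewrite scale0r.
have mono := simple_time_mono hs.
move/negP: vab => []; apply/andP; split.
  rewrite -(simple_first hs); apply: le_trans tv; apply: mono => //.
  exact: ltnW.
by rewrite -(simple_last hs); apply: lt_le_trans vt _; exact: mono.
Qed.

Lemma knots_itv p q (h : simple_process Omega R p q) (a b t : R) :
  simple_on F a b h -> t \in knots h -> a <= t <= b.
Proof.
move=> hs /mapP[j]; rewrite mem_iota/= add0n ltnS => jh ->.
have mono := simple_time_mono hs.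
by rewrite -(simple_first hs) -(simple_last hs) !mono.
Qed.

Lemma simple_fun_adapted (F_usual : usual_filtration P T F) p q
    (h : simple_process Omega R p q) (a b v : R) :
  simple_on F a b h -> 0 <= a -> b <= T -> v \in `[0, T] ->
  measurable_wrt (F v) (simple_fun h v).
Proof.
move=> hs a0 bT vT; have sF := filt_sigma F_usual vT.
apply: (measurable_wrt_sum sF
  (X := fun j w => (\1_(`[sp_time h j, sp_time h j.+1[%classic) v : R) *: sp_val h j w)).
move=> j jh; rewrite indic_itv; case: (boolP (_ && _)) => [/andP[tv vt]|_].
  have := knots_itv hs (mem_knots (ltnW jh)) => /andP[tj0 _].
  under eq_fun do rewrite scale1r.
  apply: measurable_wrtS (simple_adapted hs jh).
  move: vT; rewrite in_itv/= => /andP[v0 vT].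
  by apply: (filt_mono F_usual) => //; exact: le_trans tj0.
under eq_fun do rewrite scale0r.
exact: measurable_wrt_cst.
Qed.

End simple_process_theory.

(** * Time integrals of random functions *)

Section step_integral.
Context (R : realType).
Notation mu := (@lebesgue_measure R).

Lemma step_sum_integral (s : seq R) (f : R -> R) k :
  sorted <%R s -> measurable_fun setT f -> (forall v, 0 <= f v) ->
  (forall i v, (i.+1 < size s)%N -> s`_i <= v < s`_i.+1 -> f v = f s`_i) ->
  (k < size s)%N ->
  (\int[mu]_(v in `[(s`_0), s`_k[) (f v)%:E =
   (\sum_(i < k) (s`_i.+1 - s`_i) * f s`_i)%:E)%E.
Proof.
move=> srt mf f0 fs; elim: k => [|k IH] ks.
  by rewrite big_ord0 set_itvco0 integral_set0.
have mf' : measurable_fun setT (EFin \o f) by exact/measurable_EFinP.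
have lek : s`_0 <= s`_k.
  by rewrite (lt_sorted_leq_nth 0 srt) ?inE ?(ltn_trans _ ks)// ltnW.
have ltk : s`_k < s`_k.+1 by rewrite (lt_sorted_ltn_nth 0 srt) ?inE// ltnW.
rewrite (@itv_bndbnd_setU _ _ _ (BLeft s`_k)) ?bnd_simp//; last exact: ltW.
rewrite ge0_integral_setU//=; last 3 first.
- exact: measurable_funTS.
- by move=> v _; rewrite lee_fin.
- apply/disj_setPS => v [/=]; rewrite !in_itv/= => /andP[_ vk] /andP[kv _].
  by move: (lt_le_trans vk kv); rewrite ltxx.
rewrite IH ?(ltnW ks)// big_ord_recr/= EFinD; congr (_ + _)%E.
rewrite (eq_integral (cst (f s`_k)%:E)); last first.
  by move=> v; rewrite inE/= in_itv/= => vk; rewrite /= (fs k).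
rewrite integral_cst//= lebesgue_measure_itv/= lte_fin ltk.
by rewrite -EFinB -EFinM mulrC.
Qed.

End step_integral.

Section time_measurability.
Context dd (Omega : measurableType dd) (R : realType).
Notation mu := (@lebesgue_measure R).

Lemma measurable_path (A : set R) (f : R -> Omega -> R) w : measurable A ->
  measurable_fun (A `*` setT) (fun u : R * Omega => f u.1 u.2) ->
  measurable_fun A (fun v => f v w).
Proof.
move=> mA mf.
apply: (@measurable_comp _ _ _ _ _ _ (A `*` setT) (fun u : R * Omega => f u.1 u.2)
  A (fun v => (v, w))) => //.
- exact: measurableX.
- by move=> _ [v Av <-].
- exact: measurable_funTS.
Qed.

Lemma measurable_time_integral (a b : R) (f : R -> Omega -> R) :
  measurable_fun (`[a, b] `*` setT) (fun u : R * Omega => f u.1 u.2) ->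
  (forall v w, 0 <= f v w) ->
  measurable_fun setT (fun w => \int[mu]_(v in `[a, b]) (f v w)%:E)%E.
Proof.
move=> mf f0.
pose D := `[a, b]%classic `*` @setT Omega.
have mD : measurable D by exact: measurableX.
pose g : (measurableTypeR R * Omega -> \bar R) :=
  (fun u => (f u.1 u.2)%:E) \_ D.
have mg : measurable_fun setT g.
  by apply/(measurable_restrictT _ mD); exact/measurable_EFinP.
have g0 u : (0 <= g u)%E.
  by rewrite /g patchE; case: ifPn => // _; rewrite lee_fin.
have := @measurable_fun_fubini_tonelli_G _ _ _ _ _ mu g mg g0.
congr (measurable_fun _ _); apply/funext => w.
rewrite /fubini_G [RHS]integral_mkcond; apply: eq_integral => v _.
rewrite /g !patchE; congr (if _ then _ else _).
apply/idP/idP; rewrite !inE/= /D; first by case.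
by split.
Qed.

End time_measurability.

(** * Additivity of the Ito integral *)

Section ito_additivity.
Context dd (Omega : measurableType dd) (R : realType) (P : probability Omega R).
Variables (T : R) (F : R -> set (set Omega)) (m : nat).
Variable W : R -> Omega -> 'cV[R]_m.
Hypotheses (F_usual : usual_filtration P T F) (W_bm : brownian_motion P T F W).
Notation mu := (@lebesgue_measure R).

Lemma in_prob_small (X : nat -> Omega -> \bar R) (e c : R) :
  cvg_to_0_in_prob P X -> 0 < e -> 0 < c ->
  \forall k \near \oo, (P [set w | (e%:E <= X k w)%E] <= c%:E)%E.
Proof.
move=> X0 e0 c0; have /fine_cvgP[Xfin Xc] := X0 e e0.
near=> k.
have Pfin : P [set w | (e%:E <= X k w)%E] \is a fin_num by near: k.
rewrite -(fineK Pfin) lee_fin.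
have : `|fine (P [set w | (e%:E <= X k w)%E])| < c.
  by near: k; move/cvgr0Pnorm_lt: Xc; apply.
by move=> /ltW; exact: le_trans (ler_norm _).
Unshelve. all: by end_near. Qed.

Lemma simple_fun_measurable p q (h : simple_process Omega R p q) (a b : R) i j :
  simple_on F a b h -> 0 <= a -> b <= T ->
  measurable_fun setT (fun u : R * Omega => simple_fun h u.1 u.2 i j).
Proof.
move=> hs a0 bT.
under eq_fun do rewrite summxE.
apply: measurable_sum => k; under eq_fun do rewrite mxE.
apply: measurable_funM.
  by apply: measurableT_comp => //; exact: measurable_indic.
have mv : measurable_fun setT (fun w => sp_val h k w i j).
  apply: measurable_wrt_entry (simple_adapted hs (ltn_ord k)).
  apply: (filt_sub F_usual); rewrite in_itv/=.
  have /andP[ta tb] := knots_itv hs (mem_knots (ltnW (ltn_ord k))).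
  by rewrite (le_trans a0 ta) (le_trans tb bT).
by apply: (measurableT_comp mv); exact: measurable_snd.
Qed.

Lemma simple_dist_measurable p q (h : simple_process Omega R p q) (a b : R)
    (g : R -> Omega -> 'M[R]_(p, q)) :
  simple_on F a b h -> 0 <= a -> b <= T -> adapted_Lp P F a b 2 g ->
  measurable_fun (`[a, b] `*` setT)
    (fun u : R * Omega => enorm (simple_fun h u.1 u.2 - g u.1 u.2) ^+ 2).
Proof.
move=> hs a0 bT gs; apply: measurable_enorm_sq => i j.
rewrite (_ : (fun _ => _) = (fun u : R * Omega =>
    simple_fun h u.1 u.2 i j - g u.1 u.2 i j)); last first.
  by apply/funext => u; rewrite !mxE.
apply: measurable_funB; last exact: (Lp_measurable gs i j).
by apply: measurable_funTS; exact: simple_fun_measurable hs a0 bT.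
Qed.

(** If the three [X]'s are below [e], then [Q] is below three times [2 e]. *)
Lemma prob_three_le (X1 X2 X3 : Omega -> \bar R) (Q : Omega -> R) (e : R) :
  measurable_fun setT X1 -> measurable_fun setT X2 -> measurable_fun setT X3 ->
  measurable_fun setT Q ->
  (forall w, 0 <= X1 w)%E -> (forall w, 0 <= X2 w)%E -> (forall w, 0 <= X3 w)%E ->
  (forall w, (Q w)%:E <= 2%:E * X1 w + 2%:E * X2 w + 2%:E * X3 w)%E ->
  (P [set w | (6 * e <= Q w)%R] <= P [set w | e%:E <= X1 w] +
    P [set w | e%:E <= X2 w] + P [set w | e%:E <= X3 w])%E.
Proof.
move=> mX1 mX2 mX3 mQ X10 X20 X30 QX.
have mge (Y : Omega -> \bar R) : measurable_fun setT Y ->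
    measurable [set w | (e%:E <= Y w)%E].
  move=> mY; rewrite -[X in measurable X]setTI.
  exact: emeasurable_fun_c_infty.
have m1 := mge _ mX1; have m2 := mge _ mX2; have m3 := mge _ mX3.
have m12 := measurableU _ _ m1 m2.
apply: le_trans (leeD (measureU2 P m1 m2) (lexx _)).
apply: le_trans (measureU2 P m12 m3).
apply: le_measure; rewrite ?inE.
- exact: measurable_ge.
- exact: measurableU.
move=> w /= eQ; move: (QX w) (X10 w) (X20 w) (X30 w).
have [|l1] := leP e%:E (X1 w); first by left; left.
have [|l2] := leP e%:E (X2 w); first by left; right.
have [|l3] := leP e%:E (X3 w); first by right.
move: l1 l2 l3; case: (X1 w) => [x1| |]//; case: (X2 w) => [x2| |]//.
case: (X3 w) => [x3| |]//.
by rewrite -!EFinM -!EFinD !lte_fin !lee_fin => *; exfalso; lra.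
Qed.

Definition simple_dist p q (h : simple_process Omega R p q) (a b : R)
    (g : R -> Omega -> 'M[R]_(p, q)) w : \bar R :=
  (\int[mu]_(s in `[a, b]) (enorm (simple_fun h s w - g s w) ^+ 2)%:E)%E.

Section three_processes.
Variables (d : nat) (a b : R) (a0 : 0 <= a) (ab : a < b) (bT : b <= T).
Variables (g : R -> Omega -> 'M[R]_(d, m)) (xi : Omega -> 'M[R]_(d, m)).
Hypothesis Fxi : measurable_wrt (F a) xi.
Let g' s w := g s w - xi w.
Hypotheses (Lb : adapted_Lp P F 0 b 2 g) (La : adapted_Lp P F 0 a 2 g).
Hypothesis Lab : adapted_Lp P F a b 2 g'.
Variables hb ha hab : simple_process Omega R d m.
Hypotheses (hbs : simple_on F 0 b hb) (has : simple_on F 0 a ha).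
Hypothesis habs : simple_on F a b hab.

(* the process equal to xi on [a, b[; it need not be bounded *)
Let x := SimpleProcess 1 (fun j => if j is 0%N then a else b) (fun=> xi).
Let s := sort <=%R (undup (knots hb ++ knots ha ++ knots hab)).
Let H v w := simple_fun hb v w - simple_fun ha v w - simple_fun hab v w
  - simple_fun x v w.

Let b0 : 0 <= b. Proof. exact: le_trans (ltW ab). Qed.
Let aT : a <= T. Proof. exact: le_trans (ltW ab) bT. Qed.

Let srt : sorted <%R s.
Proof. by rewrite /s sort_lt_sorted undup_uniq. Qed.

Let mem_s t : (t \in s) = [|| t \in knots hb, t \in knots ha | t \in knots hab].
Proof. by rewrite mem_sort mem_undup !mem_cat. Qed.

Let sub_b : {subset knots hb <= s}. Proof. by move=> t; rewrite mem_s => ->. Qed.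
Let sub_a : {subset knots ha <= s}.
Proof. by move=> t; rewrite mem_s => ->; rewrite orbT. Qed.
Let sub_ab : {subset knots hab <= s}.
Proof. by move=> t; rewrite mem_s => ->; rewrite !orbT. Qed.
Let sub_x : {subset knots x <= s}.
Proof.
move=> t; rewrite /knots/= !inE => /orP[]/eqP ->; apply: sub_ab.
  by rewrite -(simple_first habs); exact: mem_knots.
by rewrite -(simple_last habs); exact: mem_knots.
Qed.

Let s_itv t : t \in s -> 0 <= t <= b.
Proof.
rewrite mem_s => /or3P[/(knots_itv hbs)//|/(knots_itv has)/andP[-> ta]|].
  by rewrite (le_trans ta) ?ltW.
by move=> /(knots_itv habs)/andP[/(le_trans a0) ->].
Qed.

Let s_gt0 : (0 < size s)%N.
Proof.
have : b \in s by apply: sub_b; rewrite -(simple_last hbs); exact: mem_knots.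
by case: s.
Qed.

Let si_itv i : (i < size s)%N -> 0 <= s`_i <= b.
Proof. by move=> si; apply: s_itv; exact: mem_nth. Qed.

Let si_T i : (i < size s)%N -> s`_i \in `[0, T].
Proof.
move=> /si_itv/andP[s0 sb]; rewrite in_itv/= s0/=; exact: le_trans sb bT.
Qed.

Let simple_fun_x v w : simple_fun x v w =
  (\1_(`[a, b[%classic) v : R) *: xi w.
Proof. by rewrite /simple_fun/= big_ord1. Qed.

Let H_below v w : v < a -> H v w = simple_fun hb v w - simple_fun ha v w.
Proof.
move=> va; rewrite /H (simple_fun_out _ habs) ?leNgt ?va// simple_fun_x indic_itv.
by rewrite leNgt va/= scale0r !subr0.
Qed.

Let H_above v w : a <= v -> v < b ->
  H v w = simple_fun hb v w - simple_fun hab v w - xi w.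
Proof.
move=> av vb; rewrite /H (simple_fun_out _ has) ?(ltNge v) ?av ?andbF//.
by rewrite simple_fun_x indic_itv av vb scale1r subr0.
Qed.

Let H_end v w : b <= v -> H v w = 0.
Proof.
move=> bv; have av := le_trans (ltW ab) bv.
rewrite /H (simple_fun_out _ hbs) ?(ltNge v) ?bv ?andbF//.
rewrite (simple_fun_out _ has) ?(ltNge v) ?av ?andbF//.
rewrite (simple_fun_out _ habs) ?(ltNge v) ?bv ?andbF//.
by rewrite simple_fun_x indic_itv (ltNge v) bv andbF scale0r !subr0.
Qed.

Lemma ito_sum_three w :
  ito_sum W (fun i => s`_i) (fun i => H s`_i) (size s).-1 w =
  simple_integral W hb w - simple_integral W ha w - simple_integral W hab w
  - xi w *m (W b w - W a w).
Proof.
rewrite /ito_sum /H; under eq_bigr do rewrite !mulmxBl.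
rewrite !sumrB.
rewrite (simple_integral_refine _ _ srt sub_b)//; last exact: simple_incr hbs.
rewrite (simple_integral_refine _ _ srt sub_a)//; last exact: simple_incr has.
rewrite (simple_integral_refine _ _ srt sub_ab)//; last exact: simple_incr habs.
rewrite (simple_integral_refine _ _ srt sub_x)//; last by case.
by congr (_ - _); rewrite /simple_integral/= big_ord1.
Qed.

Lemma ito_three_adapted i : (i < (size s).-1)%N ->
  measurable_wrt (F s`_i) (H s`_i).
Proof.
move=> ni; have si : (i < size s)%N by rewrite (leq_trans ni)// leq_pred.
have siT := si_T si; have sF := filt_sigma F_usual siT.
have add := measurable_wrtB sF.
apply: (add); first apply: (add); first apply: (add).
- exact: (simple_fun_adapted F_usual hbs (lexx (0 : R)) bT siT).
- exact: (simple_fun_adapted F_usual has (lexx (0 : R)) aT siT).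
- exact: (simple_fun_adapted F_usual habs a0 bT siT).
rewrite (_ : simple_fun x s`_i = fun w => ((a <= s`_i) && (s`_i < b))%:R *: xi w);
  last by apply/funext => w; rewrite simple_fun_x indic_itv.
have [av|_] := leP a s`_i; last first.
  by under eq_fun do rewrite scale0r; exact: measurable_wrt_cst.
apply: measurable_wrtZ => //.
  by apply/(sub_measurableP _ sF); exact: measurable_cst.
apply: measurable_wrtS Fxi; apply: (filt_mono F_usual) => //.
by move: siT; rewrite in_itv/= => /andP[].
Qed.

Lemma measurable_H w i j : measurable_fun setT (fun v => H v w i j).
Proof.
have ms (h : simple_process Omega R d m) :
    measurable_fun setT (fun v => simple_fun h v w i j).
  under eq_fun do rewrite summxE.
  apply: measurable_sum => k; under eq_fun do rewrite mxE.
  by apply: measurable_funM => //; exact: measurable_indic.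
rewrite /H; under eq_fun do rewrite !mxE.
by do 3 (apply: measurable_funB => //).
Qed.

(** The three approximating processes are combined so that [g] cancels: before [a]
    the error of [hb] minus that of [ha] remains, after [a] the error of [hb]
    minus that of [hab]; the square of a difference gives the factors 2. *)
Lemma quad_sum_three w :
  ((quad_sum (fun i => s`_i) (fun i => H s`_i) (size s).-1 w)%:E <=
   2%:E * simple_dist hb 0 b g w + 2%:E * simple_dist ha 0 a g w
   + 2%:E * simple_dist hab a b g' w)%E.
Proof.
have mH : measurable_fun setT (fun v => enorm (H v w) ^+ 2).
  by apply: measurable_enorm_sq => i j; exact: measurable_H.
have cell i v : (i.+1 < size s)%N -> s`_i <= v < s`_i.+1 ->
    enorm (H v w) ^+ 2 = enorm (H s`_i w) ^+ 2.
  by move=> si vi; rewrite /H !(simple_fun_cell w srt _ si vi).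
rewrite -(step_sum_integral srt mH (fun v => sqr_ge0 _) cell); last by rewrite prednK.
have mH' : measurable_fun setT (fun v => (enorm (H v w) ^+ 2)%:E).
  exact/measurable_EFinP.
apply: (@le_trans _ _ (\int[mu]_v (enorm (H v w) ^+ 2)%:E)%E).
  apply: ge0_subset_integral => //; by move=> v _; rewrite lee_fin sqr_ge0.
pose D (h : simple_process Omega R d m) (c e : R)
    (f : R -> Omega -> 'M[R]_(d, m)) : R -> \bar R :=
  (fun v => (enorm (simple_fun h v w - f v w) ^+ 2)%:E) \_ `[c, e].
have D0 h c e f v : (0 <= D h c e f v)%E.
  by rewrite /D patchE; case: ifP => // _; rewrite lee_fin sqr_ge0.
have mD h (c e : R) f : simple_on F c e h -> 0 <= c -> e <= T ->
    adapted_Lp P F c e 2 f -> measurable_fun setT (D h c e f).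
  move=> hs c0 eT fs; apply/(measurable_restrictT _ (measurable_itv _)).
  apply/measurable_EFinP.
  apply: (measurable_path (f := fun v w => enorm (simple_fun h v w - f v w) ^+ 2)).
    exact: measurable_itv.
  exact: simple_dist_measurable hs c0 eT fs.
have m1 := mD _ _ _ _ hbs (lexx (0 : R)) bT Lb.
have m2 := mD _ _ _ _ has (lexx (0 : R)) aT La.
have m3 := mD _ _ _ _ habs a0 bT Lab.
have m2D (f : R -> \bar R) : measurable_fun setT f ->
    measurable_fun setT (fun v => 2%:E * f v)%E.
  by move=> mf; exact: emeasurable_funM.
have intD h c e f : measurable_fun setT (D h c e f) ->
    (2%:E * simple_dist h c e f w = \int[mu]_v (2%:E * D h c e f v))%E.
  move=> mDh; rewrite ge0_integralZl//; congr (_ * _)%E.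
  exact: integral_mkcond.
have D20 h c e f v : (0 <= 2%:E * D h c e f v)%E by rewrite mule_ge0.
pose u1 v := (2%:E * D hb 0%R b g v)%E.
pose u2 v := (2%:E * D ha 0%R a g v)%E.
pose u3 v := (2%:E * D hab a b g' v)%E.
have u10 v : setT v -> (0 <= u1 v)%E by move=> _; exact: D20.
have u20 v : setT v -> (0 <= u2 v)%E by move=> _; exact: D20.
have u30 v : setT v -> (0 <= u3 v)%E by move=> _; exact: D20.
have u120 v : setT v -> (0 <= u1 v + u2 v)%E.
  by move=> _; apply: adde_ge0; exact: D20.
have mu1 : measurable_fun setT u1 by exact: m2D.
have mu2 : measurable_fun setT u2 by exact: m2D.
have mu3 : measurable_fun setT u3 by exact: m2D.
have mu12 : measurable_fun setT (fun v => u1 v + u2 v)%E.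
  exact: emeasurable_funD.
have eqI : (\int[mu]_v u1 v + \int[mu]_v u2 v + \int[mu]_v u3 v =
    2%:E * simple_dist hb 0 b g w + 2%:E * simple_dist ha 0 a g w
    + 2%:E * simple_dist hab a b g' w)%E.
  congr (_ + _ + _)%E; apply/esym; [exact: intD m1|exact: intD m2|exact: intD m3].
apply: (@le_trans _ _ (\int[mu]_v u1 v + \int[mu]_v u2 v + \int[mu]_v u3 v)%E);
  last by rewrite eqI.
rewrite -(ge0_integralD mu measurableT u10 mu1 u20 mu2).
rewrite -(ge0_integralD mu measurableT u120 mu12 u30 mu3).
apply: ge0_le_integral.
- exact: measurableT.
- by move=> v _; rewrite lee_fin sqr_ge0.
- exact: mH'.
- exact: emeasurable_funD.
move=> v _.
have DE h c e f : c <= v -> v <= e ->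
    D h c e f v = (enorm (simple_fun h v w - f v w) ^+ 2)%:E.
  by move=> cv ve; rewrite /D patchE mem_set//= in_itv/= cv ve.
have [bv|vb] := leP b v.
  by rewrite H_end// enorm0 expr0n/= adde_ge0 ?u120 ?u30.
have [av|va] := leP a v.
  have le13 : ((enorm (H v w) ^+ 2)%:E <= u1 v + u3 v)%E.
    have v0 : 0 <= v by exact: le_trans av.
    rewrite /u1 /u3 (DE _ _ _ _ v0 (ltW vb)) (DE _ _ _ _ av (ltW vb)).
    rewrite -EFinD lee_fin H_above//.
    rewrite -(enorm_sqN (simple_fun hab v w - _)).
    apply: le_trans (enorm_sqD_le _ _).
    rewrite le_eqVlt; apply/orP; left; apply/eqP; congr (enorm _ ^+ 2).
    by rewrite /g' opprB -[g v w - _ - _]addrA subrKA addrA [RHS]addrAC.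
  by apply: (le_trans le13); rewrite leeD2r// leeDl ?u20.
have [v0|v0] := leP 0 v; last first.
  have vN c : ~~ ((0 <= v) && (v < c)) by rewrite leNgt v0.
  rewrite H_below// (simple_fun_out _ hbs (vN b)) (simple_fun_out _ has (vN a)).
  by rewrite subr0 enorm0 expr0n/= adde_ge0 ?u120 ?u30.
have le12 : ((enorm (H v w) ^+ 2)%:E <= u1 v + u2 v)%E.
  rewrite /u1 /u2 (DE _ _ _ _ v0 (ltW vb)) (DE _ _ _ _ v0 (ltW va)).
  rewrite -EFinD lee_fin H_below//.
  rewrite -(enorm_sqN (simple_fun ha v w - _)).
  apply: le_trans (enorm_sqD_le _ _).
  by rewrite opprB addrA subrK.
by apply: (le_trans le12); rewrite leeDl ?u30.
Qed.

Lemma ito_three_in_prob (e c : R) : 0 < e -> 0 < c ->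
  (P [set w | (c <= enorm (simple_integral W hb w - simple_integral W ha w
      - simple_integral W hab w - xi w *m (W b w - W a w)))%R] <=
   P [set w | e%:E <= simple_dist hb 0%R b g w]
   + P [set w | e%:E <= simple_dist ha 0%R a g w]
   + P [set w | e%:E <= simple_dist hab a b g' w] + (6 * e / c ^+ 2)%:E)%E.
Proof.
move=> e0 c0.
have s00 : 0 <= s`_0 by have /andP[] := si_itv s_gt0.
have snT : s`_(size s).-1 <= T.
  have ns : ((size s).-1 < size s)%N by rewrite prednK.
  by have /andP[_ sb] := si_itv ns; exact: le_trans bT.
have incr i : (i < (size s).-1)%N -> s`_i < s`_i.+1.
  by rewrite -ltnS prednK// => si; rewrite (lt_sorted_ltn_nth 0 srt) ?inE// ltnW.
have e6 : 0 < 6 * e by rewrite mulr_gt0.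
have := ito_sum_in_prob F_usual W_bm s00 snT incr e6 c0 ito_three_adapted.
under [X in (P X <= _)%E -> _]eq_set do rewrite ito_sum_three.
move=> /le_trans; apply; apply: leeD => //.
have mX h (p r : R) (f : R -> Omega -> 'M[R]_(d, m)) : simple_on F p r h ->
    0 <= p -> r <= T -> adapted_Lp P F p r 2 f ->
    measurable_fun setT (simple_dist h p r f).
  move=> hs p0 rT fs.
  apply: (measurable_time_integral
    (f := fun v w => enorm (simple_fun h v w - f v w) ^+ 2)).
    exact: simple_dist_measurable hs p0 rT fs.
  by move=> v w; exact: sqr_ge0.
have X0 h (p r : R) (f : R -> Omega -> 'M[R]_(d, m)) w :
    (0 <= simple_dist h p r f w)%E.
  by apply: integral_ge0 => v _; rewrite lee_fin sqr_ge0.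
have mQ : measurable_fun setT
    (quad_sum (fun i => s`_i) (fun i => H s`_i) (size s).-1).
  apply: measurable_sum => i.
  apply: measurable_funM => //; apply: measurable_enorm_sq => k l.
  apply: measurable_wrt_entry (ito_three_adapted (ltn_ord i)).
  apply: (filt_sub F_usual); apply: si_T.
  by rewrite (leq_trans (ltn_ord i))// leq_pred.
exact: (prob_three_le e (mX _ _ _ _ hbs (lexx (0 : R)) bT Lb)
  (mX _ _ _ _ has (lexx (0 : R)) aT La) (mX _ _ _ _ habs a0 bT Lab) mQ
  (X0 hb 0 b g) (X0 ha 0 a g) (X0 hab a b g') quad_sum_three).
Qed.

End three_processes.

Lemma measurable_enorm_ge p q (X : Omega -> 'M[R]_(p, q)) (c : R) : 0 < c ->
  (forall i j, measurable_fun setT (fun w => X w i j)) ->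
  measurable [set w | c <= enorm (X w)].
Proof.
move=> c0 mX; rewrite (_ : [set _ | _] = [set w | c ^+ 2 <= enorm (X w) ^+ 2]).
  by apply: measurable_ge; exact: measurable_enorm_sq.
apply/seteqP; split=> w /=.
  by move=> cX; rewrite lerXn2r ?nnegrE ?enorm_ge0// ltW.
by rewrite ler_pXn2r// nnegrE ?enorm_ge0// ltW.
Qed.

Lemma ae_eq0_in_prob p q (X : Omega -> 'M[R]_(p, q)) :
  (forall i j, measurable_fun setT (fun w => X w i j)) ->
  (forall c eta : R, 0 < c -> 0 < eta ->
    (P [set w | (c <= enorm (X w))%R] <= eta%:E)%E) ->
  {ae P, forall w, X w = 0}.
Proof.
move=> mX PX.
pose N n := [set w | n.+1%:R^-1 <= enorm (X w)].
have mN n : measurable (N n) by apply: measurable_enorm_ge; rewrite ?invr_gt0.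
have PN n : P (N n) = 0%E.
  apply/eqP; rewrite eq_le measure_ge0 andbT.
  apply/lee_addgt0Pr => eta eta0; rewrite add0e.
  by apply: PX; rewrite ?invr_gt0.
have negN : P.-negligible (\bigcup_n N n).
  apply: negligible_bigcup => n; exists (N n).
  by split; [exact: mN|exact: PN|exact: subset_refl].
apply: negligibleS negN => w /= Xw.
have X0 : 0 < enorm (X w).
  rewrite lt_neqAle enorm_ge0 andbT eq_sym; apply/eqP => X0; apply: Xw.
  apply/matrixP => i j; rewrite mxE; apply/eqP; rewrite -normr_le0 -X0.
  exact: enorm_entry.
exists (Num.truncn (enorm (X w))^-1) => //; rewrite /N/=.
rewrite invf_ple ?posrE//; apply/ltW; exact: truncnS_gt.
Qed.

Lemma simple_integral_adapted d (h : simple_process Omega R d m) (a b : R) :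
  simple_on F a b h -> 0 <= a -> b <= T ->
  measurable_wrt (F b) (simple_integral W h).
Proof.
move=> hs a0 bT.
have ab : a <= b.
  rewrite -(simple_first hs) -(simple_last hs); exact: simple_time_mono hs _ _.
have bin : b \in `[0, T] by rewrite in_itv/= bT (le_trans a0).
have sF := filt_sigma F_usual bin.
have Ft t : a <= t <= b -> t \in `[0, T] /\ F t `<=` F b.
  move=> /andP[at_ tb]; rewrite in_itv/= (le_trans a0 at_) (le_trans tb bT).
  by split=> //; apply: (filt_mono F_usual) => //; exact: le_trans at_.
apply: (measurable_wrt_sum sF (X := fun j w =>
  sp_val h j w *m (W (sp_time h j.+1) w - W (sp_time h j) w))) => j jh.
have [t1 F1] := Ft _ (knots_itv hs (mem_knots (ltnW jh))).
have [t2 F2] := Ft _ (knots_itv hs (mem_knots jh)).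
apply: (measurable_wrtM sF).
  by apply: measurable_wrtS (simple_adapted hs jh).
by apply: (measurable_wrtB sF); [apply: measurable_wrtS (bm_adapted W_bm t2)|
  apply: measurable_wrtS (bm_adapted W_bm t1)].
Qed.

(** All approximating processes are put on one common refinement, where the defect
    of additivity is a discrete stochastic integral with small quadratic sum; the
    difference of the two sides is therefore small in probability, hence zero. *)
Lemma ito_integral_additive d (a b : R) (g : R -> Omega -> 'M[R]_(d, m))
    (xi : Omega -> 'M[R]_(d, m)) (Ja J Jb : Omega -> 'cV[R]_d) :
  0 <= a -> a < b -> b <= T -> measurable_wrt (F a) xi ->
  ito_integral P F W 0 a g Ja ->
  ito_integral P F W a b (fun s w => g s w - xi w) J ->
  ito_integral P F W 0 b g Jb ->
  {ae P, forall w, Jb w = Ja w + J w + xi w *m (W b w - W a w)}.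
Proof.
move=> a0 ab bT Fxi [La FJa [ha [has Xa Ia]]] [Lab FJ [h [hs X I]]]
  [Lb FJb [hb [hbs Xb Ib]]].
have Xa' : cvg_to_0_in_prob P (fun k => simple_dist (ha k) 0 a g) := Xa.
have Xb' : cvg_to_0_in_prob P (fun k => simple_dist (hb k) 0 b g) := Xb.
have X' : cvg_to_0_in_prob P
  (fun k => simple_dist (h k) a b (fun s w => g s w - xi w)) := X.
have aT : a <= T by exact: le_trans (ltW ab) bT.
have b0 : 0 <= b by exact: le_trans (ltW ab).
have ain : a \in `[0, T] by rewrite in_itv/= a0.
have bin : b \in `[0, T] by rewrite in_itv/= b0.
have sF := filt_sigma F_usual bin.
have Fab : F a `<=` F b by apply: (filt_mono F_usual) => //; exact: ltW.
have FxiW : measurable_wrt (F b) (fun w => xi w *m (W b w - W a w)).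
  apply: (measurable_wrtM sF); first exact: measurable_wrtS Fxi.
  apply: (measurable_wrtB sF); first exact: (bm_adapted W_bm bin).
  exact: measurable_wrtS (bm_adapted W_bm ain).
pose L w := Jb w - Ja w - J w - xi w *m (W b w - W a w).
have FL : measurable_wrt (F b) L.
  apply: (measurable_wrtB sF) FxiW; apply: (measurable_wrtB sF) FJ.
  by apply: (measurable_wrtB sF) FJb _; exact: measurable_wrtS FJa.
have mwrt p q (Y : Omega -> 'M[R]_(p, q)) : measurable_wrt (F b) Y ->
    forall i j, measurable_fun setT (fun w => Y w i j).
  by move=> FY i j; apply: measurable_wrt_entry FY; exact: (filt_sub F_usual).
suff : {ae P, forall w, L w = 0}.
  apply: filterS => w /eqP; rewrite /L -!addrA -!opprD subr_eq0 => /eqP ->.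
  by rewrite !addrA.
apply: (ae_eq0_in_prob (mwrt _ _ _ FL)) => c eta c0 eta0.
(* c = 4 c' splits evenly over the four parts of L, and e makes the last term of
   the bound on the discrete integral equal to eta / 7 *)
pose c' := c / 4; have c'0 : 0 < c' by rewrite divr_gt0.
pose eta' := eta / 7; have eta'0 : 0 < eta' by rewrite divr_gt0.
pose e := eta' * c' ^+ 2 / 6.
have e0 : 0 < e by rewrite divr_gt0// mulr_gt0// exprn_gt0.
have eE : 6 * e / c' ^+ 2 = eta'.
  by rewrite /e; field; rewrite gt_eqF.
have [k [b1 [a1 [ab1 [b2 [a2 ab2]]]]]] := filter_ex
  (filterI (in_prob_small Xb' e0 eta'0) (filterI (in_prob_small Xa' e0 eta'0)
  (filterI (in_prob_small X' e0 eta'0) (filterI (in_prob_small Ib c'0 eta'0)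
  (filterI (in_prob_small Ia c'0 eta'0) (in_prob_small I c'0 eta'0)))))).
pose Ik w := simple_integral W (hb k) w - simple_integral W (ha k) w
  - simple_integral W (h k) w - xi w *m (W b w - W a w).
pose Eb w := simple_integral W (hb k) w - Jb w.
pose Ea w := simple_integral W (ha k) w - Ja w.
pose E w := simple_integral W (h k) w - J w.
have PI : (P [set w | (c' <= enorm (Ik w))%R] <= (4 * eta')%:E)%E.
  apply: le_trans (ito_three_in_prob a0 ab bT Fxi Lb La Lab (hbs k) (has k) (hs k)
    e0 c'0) _.
  rewrite eE.
  have -> : (4 * eta')%:E = (eta'%:E + eta'%:E + eta'%:E + eta'%:E)%E.
    by rewrite -!EFinD; congr EFin; ring.
  apply: leeD (lexx _); apply: leeD; first apply: leeD.
  - exact: b1.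
  - exact: a1.
  - exact: ab1.
have PEb : (P [set w | (c' <= enorm (Eb w))%R] <= eta'%:E)%E by exact: b2.
have PEa : (P [set w | (c' <= enorm (Ea w))%R] <= eta'%:E)%E by exact: a2.
have PE : (P [set w | (c' <= enorm (E w))%R] <= eta'%:E)%E by exact: ab2.
have FSb := simple_integral_adapted (hbs k) (lexx (0 : R)) bT.
have FSa := simple_integral_adapted (has k) (lexx (0 : R)) aT.
have FS := simple_integral_adapted (hs k) a0 bT.
have FEb : measurable_wrt (F b) Eb by exact: measurable_wrtB.
have FEa : measurable_wrt (F b) Ea.
  by apply: (measurable_wrtB sF); [exact: measurable_wrtS FSa|
    exact: measurable_wrtS FJa].
have FE : measurable_wrt (F b) E by exact: measurable_wrtB.
have FI : measurable_wrt (F b) Ik.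
  apply: (measurable_wrtB sF) FxiW; apply: (measurable_wrtB sF) FS.
  by apply: (measurable_wrtB sF) FSb _; exact: measurable_wrtS FSa.
have mge p q (Y : Omega -> 'M[R]_(p, q)) (r : R) : 0 < r ->
    measurable_wrt (F b) Y -> measurable [set w | r <= enorm (Y w)].
  by move=> r0 FY; apply: measurable_enorm_ge => //; exact: mwrt.
have m1 := mge _ _ _ _ c'0 FI; have m2 := mge _ _ _ _ c'0 FEb.
have m3 := mge _ _ _ _ c'0 FEa; have m4 := mge _ _ _ _ c'0 FE.
have -> : eta%:E = ((4 * eta')%:E + eta'%:E + (eta'%:E + eta'%:E))%E.
  by rewrite -!EFinD; congr EFin; rewrite /eta'; field.
apply: le_trans (leeD (leeD PI PEb) (leeD PEa PE)).
apply: le_trans (leeD (measureU2 P m1 m2) (measureU2 P m3 m4)).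
have m12 := measurableU _ _ m1 m2; have m34 := measurableU _ _ m3 m4.
apply: le_trans (measureU2 P m12 m34).
apply: le_measure; rewrite ?inE; [exact: mge FL|exact: measurableU|].
move=> w /= cL.
have [|l1] := leP c' (enorm (Ik w)); first by left; left.
have [|l2] := leP c' (enorm (Eb w)); first by left; right.
have [|l3] := leP c' (enorm (Ea w)); first by right; left.
have [|l4] := leP c' (enorm (E w)); first by right; right.
exfalso.
have LE : L w = (Ik w - Eb w) + (Ea w + E w).
  rewrite /L /Ik /Eb /Ea /E.
  by apply/matrixP => i j; rewrite !mxE; ring.
have sq (r : R) : 0 <= r -> r < c' -> r ^+ 2 < c' ^+ 2.
  by move=> r0 rc; rewrite ltr_pXn2r// nnegrE// ltW.
have := sq _ (enorm_ge0 _) l1; have := sq _ (enorm_ge0 _) l2.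
have := sq _ (enorm_ge0 _) l3; have := sq _ (enorm_ge0 _) l4.
have := enorm_sqD_le (Ik w - Eb w) (Ea w + E w).
have := enorm_sqD_le (Ik w) (- Eb w); have := enorm_sqD_le (Ea w) (E w).
rewrite -LE enorm_sqN.
have : c ^+ 2 <= enorm (L w) ^+ 2 by rewrite lerXn2r ?nnegrE ?enorm_ge0// ltW.
have -> : c ^+ 2 = 16 * c' ^+ 2 by rewrite /c'; field.
lra.
Qed.

End ito_additivity.

(** * Continuity of the diffusion coefficient *)

Section locally_bounded.
Context (R : realType) (d : nat).

Definition l1 (z : 'cV[R]_d) : R := \sum_i `|z i 0|.

Lemma l1_ge0 z : 0 <= l1 z. Proof. exact: sumr_ge0. Qed.

Lemma dotp_le_l1 (u z : 'cV[R]_d) (B : R) : (forall i, `|u i 0| <= B) ->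
  `|dotp u z| <= B * l1 z.
Proof.
move=> uB; rewrite /l1 mulr_sumr; apply: le_trans (ler_norm_sum _ _ _) _.
by apply: ler_sum => i _; rewrite normrM ler_wpM2r.
Qed.

(** A monotone map defined everywhere is locally bounded: monotonicity against
    the two points [x + e_i] and [x - e_i] controls the [i]-th component of the
    map near [x]. *)
Lemma monotone_locally_bounded (g : 'cV[R]_d -> 'cV[R]_d) (x : 'cV[R]_d) :
  (forall u v, 0 <= dotp (u - v) (g u - g v)) ->
  exists eta B : R, 0 < eta /\ forall x' : 'cV[R]_d, (forall i, `|x' i 0 - x i 0| <= eta) ->
    l1 (g x') <= B.
Proof.
move=> mono.
pose e (b : bool) i : 'cV[R]_d := x + (-1) ^+ b *: delta_mx i 0.
pose eta : R := (2 * d.+1%:R)^-1.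
have eta0 : 0 < eta by rewrite invr_gt0 mulr_gt0.
have eta1 : eta <= 1 by rewrite invf_le1// ?mulr_gt0// -natrM ler1n.
exists eta, (4 * \sum_i (l1 (g (e false i)) + l1 (g (e true i)))); split=> // x' xx'.
have step i : `|g x' i 0| - eta * l1 (g x') <=
    2 * (l1 (g (e false i)) + l1 (g (e true i))).
  pose b := g x' i 0 < 0.
  have := mono (e b i) x'.
  rewrite dotpDr dotpNr subr_ge0 => H.
  have up : dotp (e b i - x') (g (e b i)) <= 2 * l1 (g (e b i)).
    apply: le_trans (ler_norm _) _; apply: dotp_le_l1 => k.
    rewrite !mxE -addrA addrCA addrC.
    apply: le_trans (ler_normD _ _) _; rewrite distrC.
    have := xx' k; rewrite normrM normrX normrN1 expr1n mul1r.
    move=> H1; have : `|(eqtype.eq_op k i && true)%:R : R| <= 1.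
      by rewrite ger0_norm// lern1 leq_b1.
    rewrite /=; lra.
  have low : `|g x' i 0| - eta * l1 (g x') <= dotp (e b i - x') (g x').
    have -> : dotp (e b i - x') (g x') = `|g x' i 0| + dotp (x - x') (g x').
      have eE : e b i - x' = (-1) ^+ b *: delta_mx i 0 + (x - x').
        by rewrite /e addrAC addrC.
      rewrite eE [LHS]dotpDl.
      suff -> : dotp ((-1) ^+ b *: delta_mx i 0) (g x') = `|g x' i 0| by [].
      rewrite dotpC dotpZr /dotp (bigD1 i)//= big1 ?addr0; last first.
        by move=> k ki; rewrite mxE (negPf ki) mulr0.
      rewrite mxE !eqxx mulr1 /b; have [gi|gi] := ltP (g x' i 0) 0.
        by rewrite expr1 mulN1r ltr0_norm.
      by rewrite expr0 mul1r ger0_norm.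
    have := @dotp_le_l1 (x - x') (g x') eta.
    rewrite ler_norml => /(_ _)/andP[|+ _]; last lra.
    by move=> k; rewrite !mxE distrC.
  have lb : l1 (g (e b i)) <= l1 (g (e false i)) + l1 (g (e true i)).
    by case: (b); rewrite ?lerDl ?lerDr l1_ge0.
  lra.
have : \sum_i (`|g x' i 0| - eta * l1 (g x')) <=
    \sum_i (2 * (l1 (g (e false i)) + l1 (g (e true i)))).
  by apply: ler_sum => i _.
rewrite sumrB -/(l1 (g x')) sumr_const card_ord -mulr_sumr.
have : (eta * l1 (g x')) *+ d <= l1 (g x') / 2.
  rewrite -mulr_natr mulrAC mulrC ler_wpM2l ?sumr_ge0//.
  rewrite /eta invfM mulrAC -mulrA ler_piMr ?invr_ge0//.
  by rewrite ler_pdivrMr// mul1r ler_nat.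
lra.
Qed.

End locally_bounded.

Section monotone_continuity.
Context (R : realType) (d m : nat).
Variables (alpha : 'cV[R]_d -> 'cV[R]_d -> 'cV[R]_d).
Variables (beta : 'cV[R]_d -> 'cV[R]_d -> 'M[R]_(d, m)).
Variables (K q : R) (K_gt0 : 0 < K) (q_gt2 : 2 < q).
Hypothesis coupled_monotone : forall x y x' y' : 'cV[R]_d,
  dotp (x - x') (alpha x y - alpha x' y')
    + (q - 1) / 2 * enorm (beta x y - beta x' y') ^+ 2
  <= K * (enorm (x - x') ^+ 2 + enorm (y - y') ^+ 2).

Let c := (q - 1) / 2.
Let c_gt0 : 0 < c. Proof. rewrite /c; have := q_gt2; lra. Qed.

(** With equal first arguments the drift drops out of the coupled condition. *)
Lemma beta_lipschitz_delay x y y' :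
  enorm (beta x y - beta x y') ^+ 2 <= K / c * enorm (y - y') ^+ 2.
Proof.
have := coupled_monotone x y x y'.
rewrite subrr enorm0 expr0n/= add0r -/c (_ : dotp 0 _ = 0) ?add0r; last first.
  by rewrite /dotp big1// => i _; rewrite mxE mul0r.
by move=> H; rewrite mulrAC ler_pdivlMr// mulrC.
Qed.

(** For fixed [y], the map [x |-> K x - alpha x y] is monotone, hence locally
    bounded; so is [alpha], and then the coupled condition makes [beta] locally
    Hoelder continuous of exponent 1/2. *)
Lemma beta_continuous (x y : 'cV[R]_d) (e : R) : 0 < e ->
  exists2 eta : R, 0 < eta & forall x' y' : 'cV[R]_d,
    (forall i, `|x' i 0 - x i 0| <= eta) ->
    (forall i, `|y' i 0 - y i 0| <= eta) ->
    enorm (beta x' y' - beta x y) ^+ 2 <= e.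
Proof.
move=> e0; have c0 := c_gt0.
pose g (u : 'cV[R]_d) := K *: u - alpha u y.
have gE u v : dotp (u - v) (g u - g v) =
    K * enorm (u - v) ^+ 2 - dotp (u - v) (alpha u y - alpha v y).
  have -> : g u - g v = K *: (u - v) - (alpha u y - alpha v y).
    by apply/matrixP => i j; rewrite !mxE; ring.
  by rewrite [LHS]dotpDr dotpNr dotpZr -enorm_sq_col.
have beta_g u v : c * enorm (beta u y - beta v y) ^+ 2 <= dotp (u - v) (g u - g v).
  have := coupled_monotone u y v y.
  rewrite (subrr y) enorm0 expr0n addr0 -/c gE; lra.
have [|eta1 [B [eta10 gB]]] := @monotone_locally_bounded _ _ g x.
  by move=> u v; apply: le_trans (beta_g u v); rewrite mulr_ge0 ?sqr_ge0// ltW.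
have B0 : 0 <= B.
  apply: le_trans (l1_ge0 _) (gB x _) => i; rewrite subrr normr0; exact: ltW.
pose Q : R := (4 * B + 2 * K * d%:R) / c.
have Q0 : 0 <= Q.
  by rewrite divr_ge0 ?(ltW c0)// addr_ge0 ?mulr_ge0// ltW.
pose eta := Num.min eta1 (Num.min 1 (e / (Q + 1))).
have eta0 : 0 < eta by rewrite !lt_min eta10 ltr01 divr_gt0// ltr_wpDl.
have eta_le1 : eta <= 1 by rewrite !ge_min lexx orbT.
have etaQ : eta * (Q + 1) <= e.
  rewrite -ler_pdivlMr ?ltr_wpDl//.
  by rewrite /eta !ge_min lexx !orbT.
exists eta => // x' y' xx' yy'.
have near_x : c * enorm (beta x' y - beta x y) ^+ 2 <= eta * (2 * B).
  apply: le_trans (beta_g x' x) _; rewrite dotpDr dotpNr.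
  have xx'' i : `|(x' - x) i 0| <= eta by rewrite !mxE.
  have := dotp_le_l1 (g x') xx''; have := dotp_le_l1 (g x) xx''.
  have B1 : l1 (g x') <= B.
    by apply: gB => i; apply: le_trans (xx' i) _; rewrite /eta ge_min lexx.
  have B2 : l1 (g x) <= B.
    by apply: gB => i; rewrite subrr normr0 ltW.
  have := ler_wpM2l (ltW eta0) B1; have := ler_wpM2l (ltW eta0) B2.
  rewrite !ler_norml => ? ? /andP[? ?] /andP[? ?]; lra.
have near_y : enorm (beta x' y' - beta x' y) ^+ 2 <= K / c * (d%:R * eta).
  apply: le_trans (beta_lipschitz_delay _ _ _) _.
  apply: ler_wpM2l; first by rewrite divr_ge0// ltW.
  rewrite enorm_sq.
  apply: (@le_trans _ _ (\sum_(i < d) eta)); last first.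
    by rewrite sumr_const card_ord mulr_natl.
  apply: ler_sum => i _; rewrite big_ord1 !mxE.
  rewrite -real_normK ?num_real// expr2.
  have := yy' i; have := normr_ge0 (y' i 0 - y i 0); nra.
have := enorm_sqD_le (beta x' y' - beta x' y) (beta x' y - beta x y).
rewrite addrA subrK => /le_trans; apply.
have nx : enorm (beta x' y - beta x y) ^+ 2 <= eta * (2 * B) / c.
  by rewrite ler_pdivlMr// mulrC.
apply: le_trans etaQ.
have -> : eta * (Q + 1) = 2 * (eta * (2 * B) / c) + 2 * (K / c * (d%:R * eta)) + eta.
  by rewrite /Q; field; rewrite gt_eqF.
lra.
Qed.

End monotone_continuity.

(** * Measurability of continuous compositions *)

Section measurable_composition.
Context dd (T : measurableType dd) (R : realType) (d : nat).

Definition grid_vec (k : nat) (v : 'cV[int]_d) : 'cV[R]_d :=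
  \col_i ((v i 0)%:~R / k.+1%:R).

Definition floor_vec (k : nat) (x : 'cV[R]_d) : 'cV[int]_d :=
  \col_i Num.floor (x i 0 * k.+1%:R).

Lemma grid_floor_near k x i :
  `|grid_vec k (floor_vec k x) i 0 - x i 0| <= k.+1%:R^-1.
Proof.
rewrite !mxE; set z := x i 0.
have k0 : 0 < k.+1%:R :> R by [].
have /andP[lo hi] := floor_itv (z * k.+1%:R).
rewrite intrD in hi.
set f := (Num.floor _)%:~R in lo hi *.
have -> : f / k.+1%:R - z = (f - z * k.+1%:R) / k.+1%:R.
  by field; rewrite gt_eqF.
have k0' : 0 <= k.+1%:R^-1 :> R by rewrite invr_ge0 ltW.
rewrite normrM (ger0_norm k0') ler_piMl// ler_norml; lra.
Qed.

Lemma measurable_floor_vec k (X : T -> 'cV[R]_d) v :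
  (forall i, measurable_fun setT (fun t => X t i 0)) ->
  measurable [set t | floor_vec k (X t) = v].
Proof.
move=> mX.
rewrite (_ : [set _ | _] = \bigcap_(i in @setT 'I_d)
    ((fun t => X t i 0 * k.+1%:R) @^-1` `[(v i 0)%:~R, (v i 0 + 1)%:~R[)).
  apply: fin_bigcap_measurable; first exact: finite_finset.
  move=> i _; rewrite -[X in measurable X]setTI.
  have : measurable_fun setT (fun t => X t i 0 * k.+1%:R) by exact: measurable_funM.
  by apply => //; exact: measurable_itv.
apply/seteqP; split=> t /=.
  by move=> <- i _; rewrite /= in_itv/= mxE; exact: floor_itv.
move=> H; apply/matrixP => i j; rewrite (ord1 j) mxE.
by apply: floor_def; have := H i I; rewrite /= in_itv.
Qed.

(** Rounding the arguments down to a grid makes the composition take countably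
    many values; the grid is then refined. *)
Lemma measurable_continuous_comp (f : 'cV[R]_d -> 'cV[R]_d -> R)
    (X Y : T -> 'cV[R]_d) :
  (forall (x y : 'cV[R]_d) (e : R), 0 < e -> exists2 eta : R, 0 < eta & forall x' y' : 'cV[R]_d,
    (forall i, `|x' i 0 - x i 0| <= eta) ->
    (forall i, `|y' i 0 - y i 0| <= eta) -> `|f x' y' - f x y| <= e) ->
  (forall i, measurable_fun setT (fun t => X t i 0)) ->
  (forall i, measurable_fun setT (fun t => Y t i 0)) ->
  measurable_fun setT (fun t => f (X t) (Y t)).
Proof.
move=> cf mX mY.
pose h k t := f (grid_vec k (floor_vec k (X t))) (grid_vec k (floor_vec k (Y t))).
apply: (measurable_fun_cvg (h := h)).
  move=> k _ B mB; rewrite setTI.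
  pose V : choiceType := ('cV[int]_d * 'cV[int]_d)%type.
  pose E (n : nat) : set T :=
    if unpickle n is Some (u, v) then
      [set t | [/\ floor_vec k (X t) = u, floor_vec k (Y t) = v &
        B (f (grid_vec k u) (grid_vec k v))]] else set0.
  rewrite (_ : h k @^-1` B = \bigcup_n E n).
    apply: bigcupT_measurable => n; rewrite /E; case: unpickle => [[u v]|//].
    have [Bf|nBf] := pselect (B (f (grid_vec k u) (grid_vec k v))).
      rewrite (_ : [set _ | _] = [set t | floor_vec k (X t) = u] `&`
          [set t | floor_vec k (Y t) = v]).
        by apply: measurableI; exact: measurable_floor_vec.
      by apply/seteqP; split=> t /=; [case|case].
    rewrite (_ : [set _ | _] = set0)//.
    by apply/seteqP; split=> t //= -[].
  apply/seteqP; split=> t /=.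
    move=> Bt; exists (pickle (floor_vec k (X t), floor_vec k (Y t))) => //.
    by rewrite /E pickleK.
  by move=> [n _]; rewrite /E; case: unpickle => [[u v]|//] [<- <-].
move=> t _; apply/cvgrPdist_le => e e0.
have [eta eta0 H] := cf (X t) (Y t) e e0.
near=> k; rewrite distrC.
have k_eta : k.+1%:R^-1 <= eta.
  by apply: ltW; near: k; exact: (near_infty_natSinv_lt (PosNum eta0)).
by apply: H => i; exact: le_trans (grid_floor_near _ _ _) k_eta.
Unshelve. all: by end_near. Qed.

End measurable_composition.

(** * Gronwall inequality with delay *)

Section stability.
Context (R : realType).

Lemma discrete_gronwall (a : nat -> R) (g h : R) n : 0 <= h ->
  (forall k, (k <= n)%N -> a k <= g + h * \sum_(i < k) a i) ->
  a n <= g * (1 + h) ^+ n.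
Proof.
move=> h0 H.
have S k : (k <= n)%N -> g + h * \sum_(i < k) a i <= g * (1 + h) ^+ k.
  elim: k => [|k IH] kn; first by rewrite big_ord0 mulr0 addr0 expr0 mulr1.
  have IHk := IH (ltnW kn); have Hk := le_trans (H k (ltnW kn)) IHk.
  rewrite big_ord_recr/= mulrDr addrA exprS mulrCA mulrDl mul1r.
  by apply: lerD => //; rewrite ler_wpM2l.
exact: le_trans (H n (leqnn n)) (S n (leqnn n)).
Qed.

(** Summing the hypothesis over the steps telescopes [a] and [b] and leaves
    [kappa + D] times the sum of the past [a]'s; the sum of the delayed terms,
    [a] being 0 at 0, is at most one more such sum, as [0 < M]. *)
Lemma delayed_gronwall (a b rho : nat -> R) (kappa D : R) (M n : nat) :
  (0 < M)%N -> 0 <= kappa -> kappa < 1 -> 0 <= D -> a 0%N = 0 -> b 0%N = 0 ->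
  (forall k, 0 <= a k) -> (forall k, 0 <= b k) -> (forall k, 0 <= rho k) ->
  (forall k, (k < n)%N -> (1 - kappa) * a k.+1 + b k.+1 <=
     (1 + D) * a k + b k + kappa * a (k.+1 - M)%N + rho k.+1) ->
  a n <= (\sum_(i < n) rho i.+1) / (1 - kappa) *
    (1 + (2 * kappa + D) / (1 - kappa)) ^+ n.
Proof.
move=> M0 k0 k1 D0 a0 b0 apos bpos rpos step.
have k1' : 0 < 1 - kappa by rewrite subr_gt0.
apply: discrete_gronwall.
  by apply: divr_ge0; [rewrite addr_ge0// mulr_ge0|exact: ltW].
pose S k := \sum_(i < k) a i.
have S_mono k l : (k <= l)%N -> S k <= S l.
  move=> kl; rewrite -(subnK kl); elim: (l - k)%N => [//|j IH].
  by rewrite addSn; apply: le_trans IH _; rewrite /S big_ord_recr/= lerDl.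
have T k : \sum_(i < k) a (i.+1 - M)%N = S (k - M).+1.
  elim: k => [|k IH]; first by rewrite big_ord0 sub0n /S big_ord1 a0.
  rewrite big_ord_recr/= IH; have [kM|Mk] := leqP k.+1 M.
    have -> : (k.+1 - M = 0)%N by apply/eqP; rewrite subn_eq0.
    have -> : (k - M = 0)%N by apply/eqP; rewrite subn_eq0 ltnW.
    by rewrite a0 addr0.
  by rewrite subSn// [RHS]/S big_ord_recr.
have main k : (k <= n)%N -> (1 - kappa) * a k + b k <=
    \sum_(i < k) rho i.+1 + (kappa + D) * S k
    + kappa * \sum_(i < k) a (i.+1 - M)%N.
  elim: k => [|k IH] kn; first by rewrite /S !big_ord0 a0 b0 !mulr0 !addr0.
  rewrite /S !big_ord_recr/=; have := IH (ltnW kn); have := step k kn.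
  rewrite -/(S k); lra.
move=> k kn.
rewrite -/(S k) mulrAC -mulrDl ler_pdivlMr// mulrC.
have := main k kn; rewrite T.
have TS : S (k - M).+1 <= S k.
  case: k kn => [|k] kn; first by rewrite sub0n /S big_ord1 big_ord0 a0.
  by apply: S_mono; rewrite ltnS leq_subLR -add1n leq_add2r.
have rk : \sum_(i < k) rho i.+1 <= \sum_(i < n) rho i.+1.
  rewrite -(subnK kn); elim: (n - k)%N => [//|j IH].
  by rewrite addSn; apply: le_trans IH _; rewrite big_ord_recr/= lerDl.
have := ler_wpM2l k0 TS; have := bpos k; lra.
Qed.

Lemma square_expansion_le (uu vv uv rr ur vr q g : R) :
  2 * vr <= (q - 2) * vv + g * rr ->
  uu + 2 * uv + vv + 2 * (ur + vr) + rr <=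
    uu + (q - 1) * vv + (1 + g) * rr + 2 * uv + 2 * ur.
Proof. lra. Qed.

Lemma step_bound_arith (E u A r D cr c g h hi k : R) :
  E <= u + c * (h * A) + g * r + 2 * D -> 2 * D <= h * u + hi * cr ->
  E + k <= (1 + h) * u + c * h * A + k + (g * r + hi * cr).
Proof. lra. Qed.

End stability.

(** * One step of the error recursion *)

Section cond_expectation_theory.
Context dd (Omega : measurableType dd) (R : realType) (P : probability Omega R).

Lemma Ex_dotp_cond_expectation d (G : set (set Omega))
    (u r cr : Omega -> 'cV[R]_d) :
  sigma_algebra setT G -> G `<=` measurable ->
  measurable_wrt G u -> L2mx P u -> L2mx P r -> L2mx P cr ->
  cond_expectation P G r cr ->
  Ex P (fun w => dotp (u w) (r w)) = Ex P (fun w => dotp (u w) (cr w)).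
Proof.
move=> sG GM Gu Lu Lr Lcr [_ ce]; rewrite !Ex_dotp//; apply: eq_bigr => i _.
have [ir icr eqA] := ce i.
rewrite /Ex /Rintegral; congr fine.
apply: (eq_integral_multiplier sG GM (Gu i 0)) => //.
- exact: L2_mul.
- exact: L2_mul.
- by move=> A GA; rewrite eqA.
Qed.

End cond_expectation_theory.

Section error_step.
Context dd (Omega : measurableType dd) (R : realType) (P : probability Omega R).
Variables (T : R) (F : R -> set (set Omega)) (m : nat).
Variable W : R -> Omega -> 'cV[R]_m.
Hypotheses (F_usual : usual_filtration P T F) (W_bm : brownian_motion P T F W).
Variables s t : R.
Hypotheses (s_ge0 : 0 <= s) (s_lt_t : s < t) (t_leT : t <= T).

(** Expanding the square, the cross term of [u] with the noise vanishes, that of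
    [u] with [r] only sees the conditional expectation of [r], and that of the
    noise with [r] is split by Young's inequality with weight [q - 2], which
    is what the gap between [1] and [q - 1] pays for. *)
Lemma error_step d (u r cr en ed : Omega -> 'cV[R]_d)
    (A B : Omega -> 'M[R]_(d, m)) (kappa q : R) :
  2 < q -> 0 <= kappa -> kappa < 1 ->
  measurable_wrt (F s) u -> measurable_wrt (F s) A ->
  L2mx P u -> L2mx P A -> L2mx P r -> L2mx P cr -> L2mx P ed ->
  cond_expectation P (F s) r cr ->
  (forall i j, measurable_fun setT (fun w => en w i j)) ->
  (forall i j, measurable_fun setT (fun w => B w i j)) ->
  {ae P, forall w, (1 - kappa) * enorm (en w) ^+ 2
      + (q - 1) * (t - s) * enorm (B w) ^+ 2 <=
    enorm (u w + A w *m (W t w - W s w) + r w) ^+ 2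
      + kappa * enorm (ed w) ^+ 2} ->
  [/\ L2mx P en, L2mx P B &
    (1 - kappa) * Ex P (fun w => enorm (en w) ^+ 2)
      + (q - 1) * (t - s) * Ex P (fun w => enorm (B w) ^+ 2) <=
    (1 + (t - s)) * Ex P (fun w => enorm (u w) ^+ 2)
      + (q - 1) * (t - s) * Ex P (fun w => enorm (A w) ^+ 2)
      + kappa * Ex P (fun w => enorm (ed w) ^+ 2)
      + ((q - 1) / (q - 2) * Ex P (fun w => enorm (r w) ^+ 2)
      + (t - s)^-1 * Ex P (fun w => enorm (cr w) ^+ 2))].
Proof.
move=> q2 k0 k1 Fu FA Lu LA Lr Lcr Led ce men mB le_ae.
have D0 : 0 < t - s by rewrite subr_gt0.
have q1 : 0 < q - 1 by lra.
have qD0 : 0 < (q - 1) * (t - s) by rewrite mulr_gt0.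
have q20 : 0 < q - 2 by lra.
have k1' : 0 < 1 - kappa by lra.
have sT : s \in `[0, T] by rewrite in_itv/= s_ge0 (le_trans (ltW s_lt_t)).
have sF := filt_sigma F_usual sT; have FM := filt_sub F_usual sT.
pose v w := A w *m (W t w - W s w).
have [Lv Ev] := mulmx_brownian F_usual W_bm s_ge0 s_lt_t t_leT FA LA.
have Euv := Ex_dotp_brownian F_usual W_bm s_ge0 s_lt_t t_leT Fu FA Lu LA.
rewrite -/v in Lv Ev Euv.
have Eur := Ex_dotp_cond_expectation sF FM Fu Lu Lr Lcr ce.
pose nsq p p' (X : Omega -> 'M[R]_(p, p')) w := enorm (X w) ^+ 2.
have iu := intg_enorm_sq Lu; have iA := intg_enorm_sq LA.
have ir := intg_enorm_sq Lr; have icr := intg_enorm_sq Lcr.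
have ied := intg_enorm_sq Led; have iv := intg_enorm_sq Lv.
have iuv := intg_dotp Lu Lv; have iur := intg_dotp Lu Lr.
have iucr := intg_dotp Lu Lcr.
pose X w := (1 - kappa) * nsq _ _ en w + (q - 1) * (t - s) * nsq _ _ B w.
pose Y := nsq _ _ (fun w => u w + v w + r w) \+ (kappa \*o nsq _ _ ed).
have Lsum : L2mx P (fun w => u w + v w + r w) by apply: L2mxD => //; exact: L2mxD.
have iY : intg P Y by apply: intgD; [exact: intg_enorm_sq|exact: intgZ].
have X0 w : 0 <= X w.
  by apply: addr_ge0; apply: mulr_ge0; rewrite /nsq ?sqr_ge0// ltW.
have mX : measurable_fun setT X.
  by apply: measurable_funD; apply: measurable_funM => //; exact: measurable_enorm_sq.
have Y0 w : 0 <= Y w.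
  by apply: addr_ge0; [exact: sqr_ge0|apply: mulr_ge0 => //; exact: sqr_ge0].
have [iX XY] := ae_le_Ex mX X0 Y0 le_ae iY.
have ien : intg P (nsq _ _ en).
  have := intgZ (1 - kappa)^-1 iX; apply: le_intg; first exact: measurable_enorm_sq.
  move=> w /=; rewrite !ger0_norm ?sqr_ge0//; last first.
    by rewrite mulr_ge0// invr_ge0 ltW.
  rewrite mulrC ler_pdivlMr// mulrC /X lerDl.
  by apply: mulr_ge0; [exact: ltW|exact: sqr_ge0].
have iB : intg P (nsq _ _ B).
  have := intgZ ((q - 1) * (t - s))^-1 iX; apply: le_intg.
    exact: measurable_enorm_sq.
  move=> w /=; rewrite !ger0_norm ?sqr_ge0//; last first.
    by rewrite mulr_ge0// invr_ge0 ltW.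
  rewrite mulrC ler_pdivlMr// mulrC /X lerDr.
  by apply: mulr_ge0; [exact: ltW|exact: sqr_ge0].
split; [exact: L2mx_enorm|exact: L2mx_enorm|].
have EX : Ex P X = (1 - kappa) * Ex P (nsq _ _ en)
    + (q - 1) * (t - s) * Ex P (nsq _ _ B).
  by rewrite -!ExZ// -ExD//; exact: intgZ.
rewrite -[leLHS]EX; apply: le_trans XY _.
rewrite /Y ExD ?ExZ//; [|exact: intg_enorm_sq|exact: intgZ].
pose Z := nsq _ _ u \+ ((q - 1) \*o nsq _ _ v) \+
  (((q - 1) / (q - 2)) \*o nsq _ _ r) \+
  (2 \*o (fun w => dotp (u w) (v w))) \+ (2 \*o (fun w => dotp (u w) (r w))).
have i2 := intgZ (q - 1) iv; have i3 := intgZ ((q - 1) / (q - 2)) ir.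
have i4 := intgZ 2 iuv; have i5 := intgZ 2 iur.
have i12 := intgD iu i2; have i123 := intgD i12 i3; have i1234 := intgD i123 i4.
have iZ : intg P Z := intgD i1234 i5.
have le1 : Ex P (nsq _ _ (fun w => u w + v w + r w)) <= Ex P Z.
  have pw w : nsq _ _ (fun w => u w + v w + r w) w <= Z w.
    rewrite /nsq /Z/= /nsq !enorm_sqD dotpDl.
    have := dotp_young (v w) (r w) q20.
    have -> : (q - 1) / (q - 2) = 1 + (q - 2)^-1 by field; rewrite gt_eqF.
    exact: square_expansion_le.
  apply: (ae_le_Ex _ _ _ _ iZ).2.
  - exact: intg_measurable (intg_enorm_sq Lsum).
  - by move=> w; exact: sqr_ge0.
  - by move=> w; apply: le_trans (pw w); exact: sqr_ge0.
  - by apply: aeW => w; exact: pw.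
have EZ : Ex P Z = Ex P (nsq _ _ u) + (q - 1) * ((t - s) * Ex P (nsq _ _ A))
   + (q - 1) / (q - 2) * Ex P (nsq _ _ r)
   + 2 * Ex P (fun w => dotp (u w) (cr w)).
  rewrite /Z (ExD i1234 i5) (ExD i123 i4) (ExD i12 i3) (ExD iu i2).
  by rewrite (ExZ _ iv) (ExZ _ ir) (ExZ _ iuv) (ExZ _ iur) Euv Eur Ev; ring.
have le2 : 2 * Ex P (fun w => dotp (u w) (cr w)) <=
    (t - s) * Ex P (nsq _ _ u) + (t - s)^-1 * Ex P (nsq _ _ cr).
  pose V := ((t - s) \*o nsq _ _ u) \+ ((t - s)^-1 \*o nsq _ _ cr) \+
    ((- 2) \*o (fun w => dotp (u w) (cr w))).
  have V0 : 0 <= Ex P V.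
    apply: Ex_ge0 => w; rewrite /V/= /nsq.
    by rewrite mulNr subr_ge0; exact: dotp_young.
  have := V0; rewrite /V.
  have j1 := intgZ (t - s) iu; have j2 := intgZ (t - s)^-1 icr.
  have j3 := intgZ (- 2) iucr.
  rewrite (ExD (intgD j1 j2) j3) (ExD j1 j2) (ExZ _ iu) (ExZ _ icr) (ExZ _ iucr).
  by rewrite mulNr subr_ge0.
by rewrite EZ in le1; exact: step_bound_arith le1 le2.
Qed.

End error_step.

(** * Additivity of the drift integral *)

Section time_integral_theory.
Context dd (Omega : measurableType dd) (R : realType) (P : probability Omega R).
Notation mu := (@lebesgue_measure R).

Lemma Rintegral_itv_additive (f : R -> R) (a b T : R) : 0 <= a -> a < b -> b <= T ->
  mu.-integrable `[0, T] (EFin \o f) ->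
  \int[mu]_(s in `[0, b]) f s =
    \int[mu]_(s in `[0, a]) f s + \int[mu]_(s in `[a, b]) f s.
Proof.
move=> a0 ab bT intf.
have intS u v : 0 <= u -> v <= T -> mu.-integrable `[u, v] (EFin \o f).
  move=> u0 vT; apply: integrableS intf => //.
  by apply: subset_itv; rewrite bnd_simp.
have b0 : 0 <= b by exact: le_trans (ltW ab).
have := @Rintegral_itvB R f (BLeft 0) (BRight b) a (intS _ _ (lexx 0) bT).
rewrite !bnd_simp => /(_ a0 (ltW ab)) /eqP; rewrite subr_eq addrC => /eqP ->.
congr (_ + _); rewrite Rintegral_itv_obnd_cbnd//.
apply: integrableS (intS _ _ a0 bT) => //.
by apply: subset_itv; rewrite bnd_simp.
Qed.

Lemma time_integral_additive (F : R -> set (set Omega)) (T a b : R) d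
    (g : R -> Omega -> 'cV[R]_d) (c : Omega -> 'cV[R]_d) :
  0 <= a -> a < b -> b <= T -> adapted_Lp P F 0 T 1 g ->
  {ae P, forall w, time_integral 0 b g w = time_integral 0 a g w
    + (time_integral a b (fun s w' => g s w' - c w') w + (b - a) *: c w)}.
Proof.
move=> a0 ab bT [mg _ Lg]; apply: filterS Lg => w gfin.
have intg0 i : mu.-integrable `[0, T] (EFin \o (fun s => g s w i 0)).
  have mp i' : measurable_fun `[0, T] (fun s => g s w i' 0).
    by apply: (measurable_path (f := fun s w' => g s w' i' 0)).
  apply/integrableP; split; [apply/measurable_EFinP; exact: mp|].
  apply: le_lt_trans gfin; apply: ge0_le_integral => //=.
  - by apply/measurable_EFinP; apply: measurableT_comp (mp i).
  - apply/measurable_EFinP.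
    apply: (eq_measurable_fun (fun s => Num.sqrt (enorm (g s w) ^+ 2))).
      by move=> s _; rewrite sqrtr_sqr ger0_norm ?enorm_ge0// expr1.
    apply: (measurableT_comp (f := @Num.sqrt R)).
      by apply: continuous_measurable_fun; exact: sqrt_continuous.
    by apply: measurable_enorm_sq => i' j; rewrite (ord1 j); exact: mp.
  - by move=> s _; rewrite lee_fin expr1 enorm_entry.
apply/matrixP => i j; rewrite !mxE.
rewrite (Rintegral_itv_additive a0 ab bT (intg0 i)); congr (_ + _).
under [X in _ = X + _]eq_Rintegral do rewrite !mxE.
have intab : mu.-integrable `[a, b] (EFin \o (fun s => g s w i 0)).
  apply: integrableS (intg0 i) => //; apply: subset_itv; rewrite bnd_simp//.
rewrite RintegralB//.
  by rewrite Rintegral_cst//= lebesgue_measure_itv/= lte_fin ab/= (ord1 j) mulrC subrK.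
apply/integrableP; split; first exact: measurable_cst.
rewrite /= integral_cst//= lebesgue_measure_itv/= lte_fin ab.
by rewrite -EFinB -EFinM ltry.
Qed.

End time_integral_theory.

(** * The error of the backward Euler method *)

Section bem_error.
Context disp (Omega : measurableType disp) (R : realType).
Variable P : probability Omega R.
Variables (d m : nat) (T tau : R).
Variables (F : R -> set (set Omega)) (W : R -> Omega -> 'cV[R]_m).
Hypotheses (F_usual : usual_filtration P T F) (W_bm : brownian_motion P T F W).
Variable phi : R -> 'cV[R]_d.
Variable alpha : 'cV[R]_d -> 'cV[R]_d -> 'cV[R]_d.
Variable beta : 'cV[R]_d -> 'cV[R]_d -> 'M[R]_(d, m).
Variables (K q : R) (K_gt0 : 0 < K) (q_gt2 : 2 < q).
Hypothesis coupled_monotone : forall x y x' y' : 'cV[R]_d,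
  dotp (x - x') (alpha x y - alpha x' y')
    + (q - 1) / 2 * enorm (beta x y - beta x' y') ^+ 2
  <= K * (enorm (x - x') ^+ 2 + enorm (y - y') ^+ 2).
Variable x : R -> Omega -> 'cV[R]_d.
Hypothesis x_sol : sdde_solution P T tau F W phi alpha beta x.
Variables (N M : nat) (Delta : R) (Z : int -> Omega -> 'cV[R]_d).
Hypotheses (Delta_gt0 : 0 < Delta) (M_gt0 : (0 < M)%N).
Hypotheses (M_Delta : M%:R * Delta = tau) (N_Delta : N%:R * Delta = T).
Hypothesis Z_sol : bem_solution P F W phi alpha beta N M Delta Z.

Definition bem_err (k : int) (w : Omega) : 'cV[R]_d := x (grid Delta k) w - Z k w.

Definition bem_diffusion_err (k : int) (w : Omega) : 'M[R]_(d, m) :=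
  beta (x (grid Delta k) w) (x (grid Delta (k - M%:Z)) w)
    - beta (Z k w) (Z (k - M%:Z) w).

Local Notation t_ := (grid Delta).

Lemma grid_delay k : t_ (k - M%:Z) = t_ k - tau.
Proof. by rewrite /grid intrB mulrBl -pmulrn M_Delta. Qed.

Lemma gridB1 k : t_ k - t_ (k - 1) = Delta.
Proof. by rewrite /grid intrB mulrBl mul1r opprB addrC subrK. Qed.

Lemma grid_lt : {mono t_ : k l / k < l}.
Proof. by move=> k l; rewrite /grid ltr_pM2r// ltr_int. Qed.

Lemma grid_le : {mono t_ : k l / k <= l}.
Proof. by move=> k l; rewrite /grid ler_pM2r// ler_int. Qed.

Lemma grid0 : t_ 0 = 0. Proof. by rewrite /grid mul0r. Qed.

Lemma gridN : t_ N%:Z = T. Proof. by rewrite /grid -pmulrn. Qed.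

Lemma grid_itv k : 0 <= k -> k <= N%:Z -> t_ k \in `[0, T].
Proof. by move=> k0 kN; rewrite in_itv/= -grid0 -gridN !grid_le k0. Qed.

Lemma bem_err_initial (k : int) w : - M%:Z <= k -> k <= 0 -> bem_err k w = 0.
Proof.
move=> Mk k0; rewrite /bem_err (bem_initial Z_sol)// (sdde_initial x_sol) ?subrr//.
rewrite in_itv/=; apply/andP; split; last by rewrite -grid0 grid_le.
by rewrite -M_Delta -mulNr pmulrn -mulrNz -/(grid Delta _) grid_le.
Qed.

Lemma bem_diffusion_err0 w : bem_diffusion_err 0 w = 0.
Proof.
have xZ (k : int) : - M%:Z <= k -> k <= 0 -> x (t_ k) w = Z k w.
  by move=> Mk k0; apply/eqP; rewrite -subr_eq0; apply/eqP/bem_err_initial.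
by rewrite /bem_diffusion_err !xZ ?subrr// ?sub0r ?oppr_le0.
Qed.

(** Subtracting the scheme from the equation integrated over one step: freezing the
    drift at the right end point and the diffusion at the left one leaves exactly
    the local truncation error. *)
Lemma bem_err_recursion (k : int) (r : Omega -> 'cV[R]_d) : 1 <= k -> k <= N%:Z ->
  bem_remainder P tau F W alpha beta x M Delta k r ->
  {ae P, forall w, bem_err k w = bem_err (k - 1) w
    + Delta *: (alpha (x (t_ k) w) (x (t_ (k - M%:Z)) w)
        - alpha (Z k w) (Z (k - M%:Z) w))
    + bem_diffusion_err (k - 1) w *m (W (t_ k) w - W (t_ (k - 1)) w) + r w}.
Proof.
move=> k1 kN [J ItoJ rE].
have k0 : 0 <= k - 1 by rewrite subr_ge0.
have ta : t_ (k - 1) \in `[0, T].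
  by apply: grid_itv => //; rewrite (le_trans _ kN)// gerBl.
have tb : t_ k \in `[0, T] by apply: grid_itv => //; exact: le_trans k1.
have ab : t_ (k - 1) < t_ k by rewrite grid_lt gtrBl.
have a0 : 0 <= t_ (k - 1) by case/andP: (ta).
have bT : t_ k <= T by case/andP: (tb).
have [Ja ItoJa eqa] := sdde_eq x_sol ta.
have [Jb ItoJb eqb] := sdde_eq x_sol tb.
have Fxi : measurable_wrt (F (t_ (k - 1)))
    (fun w => beta (x (t_ (k - 1)) w) (x (t_ (k - 1 - M%:Z)) w)).
  rewrite grid_delay; exact: (Lp_adapted (sdde_diffusion x_sol) ta).
have ito := ito_integral_additive F_usual W_bm a0 ab bT Fxi ItoJa ItoJ ItoJb.
have dt := time_integral_additive (fun w =>
  alpha (x (t_ k) w) (x (t_ (k - M%:Z)) w)) a0 ab bT (sdde_drift x_sol).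
have step := bem_step Z_sol k1 kN.
apply: filterS (filterI eqa (filterI eqb (filterI ito (filterI dt step)))).
move=> w [xa [xb [JE [tE zE]]]].
have phiE : phi 0 = x (t_ (k - 1)) w - time_integral 0 (t_ (k - 1))
    (fun s w' => alpha (x s w') (x (s - tau) w')) w - Ja w.
  by rewrite [X in X - _ - _]xa addrAC !addrK.
rewrite /bem_err /bem_diffusion_err [in LHS]zE rE mulmxBl scalerBr.
rewrite [X in X - _]xb JE tE phiE gridB1.
by apply/matrixP => i j; rewrite !(mxE, big_ord1) /=; ring.
Qed.

(** The implicit drift only enters through the monotonicity condition, which lets
    the left-hand side keep the diffusion error with weight [q - 1]. *)
Lemma bem_err_ineq (k : int) (r : Omega -> 'cV[R]_d) : 1 <= k -> k <= N%:Z ->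
  bem_remainder P tau F W alpha beta x M Delta k r ->
  {ae P, forall w, (1 - 2 * K * Delta) * enorm (bem_err k w) ^+ 2
      + (q - 1) * Delta * enorm (bem_diffusion_err k w) ^+ 2 <=
    enorm (bem_err (k - 1) w
      + bem_diffusion_err (k - 1) w *m (W (t_ k) w - W (t_ (k - 1)) w) + r w) ^+ 2
    + 2 * K * Delta * enorm (bem_err (k - M%:Z) w) ^+ 2}.
Proof.
move=> k1 kN rk; apply: filterS (bem_err_recursion k1 kN rk) => w.
set v := bem_err (k - 1) w; set u := _ *m _; set da := alpha _ _ - _ => eE.
have -> : v + u + r w = bem_err k w - Delta *: da.
  by rewrite eE; apply/matrixP => i j; rewrite !mxE; ring.
rewrite enorm_sqD enorm_sqN enorm_sqZ dotpNr dotpZr.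
have := coupled_monotone (x (t_ k) w) (x (t_ (k - M%:Z)) w)
  (Z k w) (Z (k - M%:Z) w).
rewrite -/da -/(bem_err k w) -/(bem_err (k - M%:Z) w) -/(bem_diffusion_err k w).
move: (dotp _ _) (enorm da) (enorm _ ^+ 2) (enorm _ ^+ 2) (enorm _ ^+ 2).
move=> p a eb bb ed H.
have := ler_wpM2l (ltW Delta_gt0) H; have := sqr_ge0 (Delta * a).
rewrite exprMn; lra.
Qed.

Lemma bem_err_measurable (k : nat) : (k <= N)%N ->
  measurable_wrt (F (t_ k%:Z)) (bem_err k%:Z).
Proof.
move=> kN; have tk : t_ k%:Z \in `[0, T] by exact: grid_itv.
apply: (measurable_wrtB (filt_sigma F_usual tk)).
  exact: sdde_adapted x_sol _ tk.
exact: (bem_adapted Z_sol kN).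
Qed.

(** The solution part is adapted by hypothesis, the part coming from the scheme
    because [beta] is continuous. *)
Lemma bem_diffusion_err_measurable (k : nat) : (k <= N)%N ->
  measurable_wrt (F (t_ k%:Z)) (bem_diffusion_err k%:Z).
Proof.
move=> kN; have tk : t_ k%:Z \in `[0, T] by exact: grid_itv.
have sF := filt_sigma F_usual tk.
apply: (measurable_wrtB sF).
  by rewrite grid_delay; exact: (Lp_adapted (sdde_diffusion x_sol) tk).
have FZ : measurable_wrt (F (t_ k%:Z)) (Z (k%:Z - M%:Z)).
  have [Mk|kM] := leqP M k.
    rewrite subzn//; apply: measurable_wrtS; last first.
      by apply: (bem_adapted Z_sol); exact: leq_trans (leq_subr _ _) kN.
    apply: (filt_mono F_usual); rewrite ?grid_le ?lez_nat ?leq_subr//.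
      by rewrite -grid0 grid_le.
    by case/andP: tk.
  rewrite (_ : Z _ = cst (phi (t_ (k%:Z - M%:Z)))); last first.
    apply/funext => w; rewrite (bem_initial Z_sol)//.
      by rewrite lerDr.
    by rewrite subr_le0 lez_nat ltnW.
  exact: measurable_wrt_cst.
have FZk := bem_adapted Z_sol kN.
apply/(measurable_wrtP sF) => i j.
apply: (measurable_continuous_comp (f := fun u v => beta u v i j)).
- move=> u v e e0.
  have [eta eta0 H] := beta_continuous K_gt0 q_gt2 coupled_monotone u v
    (exprn_gt0 2 e0).
  exists eta => // u' v' uu' vv'.
  have := H u' v' uu' vv'; rewrite ler_pXn2r ?nnegrE ?enorm_ge0// ?(ltW e0)//.
  by apply: le_trans; have := enorm_entry (beta u' v' - beta u v) i j; rewrite !mxE.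
- by move=> i'; apply: (measurable_wrtP sF _).1 FZk i' 0.
- by move=> i'; apply: (measurable_wrtP sF _).1 FZ i' 0.
Qed.

Lemma bem_err_delay (k : nat) : bem_err (k%:Z - M%:Z) = bem_err (k - M)%N%:Z.
Proof.
have [Mk|kM] := leqP M k; first by rewrite subzn.
apply/funext => w; rewrite (_ : (k - M = 0)%N); last by apply/eqP; rewrite subn_eq0 ltnW.
by rewrite !bem_err_initial ?oppr_le0 ?lerDr// subr_le0 lez_nat ltnW.
Qed.

Let predS (k : nat) : k.+1%:Z - 1 = k%:Z.
Proof. by rewrite -addn1 PoszD addrK. Qed.

Hypothesis small_step : 2 * K * Delta < 1.

Lemma bem_err_step (k : nat) (r cr : Omega -> 'cV[R]_d) : (k < N)%N ->
  bem_remainder P tau F W alpha beta x M Delta k.+1%:Z r ->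
  cond_expectation P (F (t_ (k.+1%:Z - 1))) r cr -> L2mx P r -> L2mx P cr ->
  (forall j : nat, (j <= k)%N -> L2mx P (bem_err j)) ->
  L2mx P (bem_diffusion_err k) ->
  [/\ L2mx P (bem_err k.+1), L2mx P (bem_diffusion_err k.+1) &
    (1 - 2 * K * Delta) * Ex P (fun w => enorm (bem_err k.+1 w) ^+ 2)
      + (q - 1) * Delta * Ex P (fun w => enorm (bem_diffusion_err k.+1 w) ^+ 2) <=
    (1 + Delta) * Ex P (fun w => enorm (bem_err k w) ^+ 2)
      + (q - 1) * Delta * Ex P (fun w => enorm (bem_diffusion_err k w) ^+ 2)
      + 2 * K * Delta * Ex P (fun w => enorm (bem_err (k.+1 - M)%N%:Z w) ^+ 2)
      + ((q - 1) / (q - 2) * Ex P (fun w => enorm (r w) ^+ 2)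
      + Delta^-1 * Ex P (fun w => enorm (cr w) ^+ 2))].
Proof.
move=> kN rk crk Lr Lcr Le LB; rewrite predS in crk.
have tk : t_ k%:Z \in `[0, T] by apply: grid_itv => //; rewrite lez_nat ltnW.
have tk1 : t_ k.+1%:Z \in `[0, T] by exact: grid_itv.
have [/andP[s0 _] /andP[_ tT]] := (tk, tk1).
have st : t_ k%:Z < t_ k.+1%:Z by rewrite grid_lt ltz_nat.
have mwrt j p p' (X : Omega -> 'M[R]_(p, p')) : t_ j \in `[0, T] ->
    measurable_wrt (F (t_ j)) X -> forall i i', measurable_fun setT (fun w => X w i i').
  by move=> tj FX i i'; exact: measurable_wrt_entry (filt_sub F_usual tj) FX.
have dt := gridB1 k.+1%:Z; rewrite predS in dt.
have := error_step F_usual W_bm s0 st tT (u := bem_err k) (r := r) (cr := cr)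
  (en := bem_err k.+1) (ed := bem_err (k.+1 - M)%N) (A := bem_diffusion_err k)
  (B := bem_diffusion_err k.+1) (kappa := 2 * K * Delta) q_gt2.
rewrite dt; apply=> //.
- by rewrite !mulr_ge0// ltW.
- by apply: bem_err_measurable; exact: ltnW.
- by apply: bem_diffusion_err_measurable; exact: ltnW.
- exact: Le.
- by apply: Le; rewrite leq_subLR -add1n leq_add2r.
- exact: mwrt tk1 (bem_err_measurable kN).
- exact: mwrt tk1 (bem_diffusion_err_measurable kN).
- have := @bem_err_ineq k.+1%:Z r isT kN rk.
  by rewrite predS bem_err_delay.
Qed.

(** Square integrability of the errors is carried along by the step inequality,
    starting from the exact initial data. *)
Lemma bem_err_moment (n : nat) (Rem CRem : nat -> Omega -> 'cV[R]_d) :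
  (n <= N)%N ->
  (forall i : nat, (1 <= i <= n)%N ->
     bem_remainder P tau F W alpha beta x M Delta i%:Z (Rem i)) ->
  (forall i : nat, (1 <= i <= n)%N ->
     cond_expectation P (F (t_ (i%:Z - 1))) (Rem i) (CRem i)) ->
  (forall i : nat, (1 <= i <= n)%N -> L2mx P (Rem i) /\ L2mx P (CRem i)) ->
  L2mx P (bem_err n) /\
  Ex P (fun w => enorm (bem_err n w) ^+ 2) <=
    (\sum_(i < n) ((q - 1) / (q - 2) * Ex P (fun w => enorm (Rem i.+1 w) ^+ 2)
      + Delta^-1 * Ex P (fun w => enorm (CRem i.+1 w) ^+ 2)))
    / (1 - 2 * K * Delta)
    * (1 + (2 * (2 * K * Delta) + Delta) / (1 - 2 * K * Delta)) ^+ n.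
Proof.
move=> nN rem crem L2rem.
have e0 : bem_err 0%N = cst 0.
  by apply/funext => w; rewrite bem_err_initial ?oppr_le0.
have B0 : bem_diffusion_err 0%N = cst 0.
  by apply/funext => w; rewrite bem_diffusion_err0.
have L0 p p' : L2mx P (cst (0 : 'M[R]_(p, p'))).
  by move=> i j; rewrite [X in L2 _ X](_ : _ = cst 0); [exact: L2_cst|
    apply/funext => w; rewrite /= mxE].
have Ex0 p p' : Ex P (fun=> enorm (0 : 'M[R]_(p, p')) ^+ 2) = 0.
  by rewrite enorm0 expr0n/= Ex_cst.
have Lall k : (k <= n)%N ->
    (forall j : nat, (j <= k)%N -> L2mx P (bem_err j)) /\ L2mx P (bem_diffusion_err k).
  elim: k => [|k IH] kn.
    rewrite B0; split; last exact: L0.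
    by move=> j; rewrite leqn0 => /eqP ->; rewrite e0; exact: L0.
  have [Le LB] := IH (ltnW kn); have [Lr Lcr] := L2rem k.+1 kn.
  have [Le1 LB1 _] := bem_err_step (leq_trans kn nN) (rem k.+1 kn) (crem k.+1 kn)
    Lr Lcr Le LB.
  by split=> // j; rewrite leq_eqVlt => /orP[/eqP ->//|]; exact: Le.
split; first by have [Le _] := Lall n (leqnn n); exact: Le.
have q2 : 0 < q - 2 by rewrite subr_gt0.
have q1 : 0 < q - 1 by have := q_gt2; lra.
pose a (k : nat) := Ex P (fun w => enorm (bem_err k w) ^+ 2).
pose b (k : nat) := (q - 1) * Delta *
  Ex P (fun w => enorm (bem_diffusion_err k w) ^+ 2).
apply: (@delayed_gronwall _ a b (fun k =>
  (q - 1) / (q - 2) * Ex P (fun w => enorm (Rem k w) ^+ 2)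
  + Delta^-1 * Ex P (fun w => enorm (CRem k w) ^+ 2)) _ _ _ _ M_gt0) => //.
- by rewrite !mulr_ge0// ltW.
- exact: ltW.
- by rewrite /a e0 Ex0.
- by rewrite /b B0 Ex0 mulr0.
- by move=> k; apply: Ex_ge0 => w; exact: sqr_ge0.
- move=> k; apply: mulr_ge0; first by rewrite mulr_ge0// ltW.
  by apply: Ex_ge0 => w; exact: sqr_ge0.
- move=> k; apply: addr_ge0; apply: mulr_ge0.
  + by rewrite divr_ge0// ltW.
  + by apply: Ex_ge0 => w; exact: sqr_ge0.
  + by rewrite invr_ge0 ltW.
  + by apply: Ex_ge0 => w; exact: sqr_ge0.
- move=> k kn; have [Le LB] := Lall k (ltnW kn); have [Lr Lcr] := L2rem k.+1 kn.
  by have [] := bem_err_step (leq_trans kn nN) (rem k.+1 kn) (crem k.+1 kn)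
    Lr Lcr Le LB.
Qed.

End bem_error.

(** * The constant and the conclusion *)

Section constant.
Context (R : realType).

(** The hypothesis on the step forces [N > 2 K T], so that over all admissible
    steps [2 K Delta] stays away from 1: it is at most its value at the smallest
    such integer [N]. *)
Lemma gronwall_constant (K T c : R) : 0 < K -> 0 < T -> 1 <= c ->
  exists C : R, 0 < C /\ forall (N n : nat) (Delta S1 S2 : R),
    (0 < N)%N -> (n <= N)%N -> Delta = T / N%:R -> 2 * K * Delta < 1 ->
    0 <= S1 -> 0 <= S2 ->
    (c * S1 + S2) / (1 - 2 * K * Delta)
      * (1 + (2 * (2 * K * Delta) + Delta) / (1 - 2 * K * Delta)) ^+ n
    <= C * (S1 + S2).
Proof.
move=> K0 T0 c1.
have KT0 : 0 < 2 * K * T by rewrite !mulr_gt0.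
pose N0 := (Num.truncn (2 * K * T)).+1.
pose k0 := 2 * K * T / N0%:R.
have k01 : 0 < 1 - k0.
  by rewrite subr_gt0 ltr_pdivrMr// mul1r truncnS_gt.
pose L := (4 * K + 1) * T / (1 - k0).
exists (c / (1 - k0) * expR L); split.
  by rewrite mulr_gt0 ?expR_gt0// divr_gt0// (lt_le_trans ltr01).
move=> N n Delta S1 S2 N_gt0 nN DE k1 S10 S20.
have N0r : 0 < N%:R :> R by rewrite ltr0n.
have D0 : 0 < Delta by rewrite DE divr_gt0.
have N0N : (N0 <= N)%N.
  rewrite /N0 -(ltr_nat R); apply: (@le_lt_trans _ _ (2 * K * T)).
    by rewrite truncn_le ltW.
  by move: k1; rewrite DE mulrA ltr_pdivrMr// mul1r.
have kk0 : 2 * K * Delta <= k0.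
  rewrite DE mulrA /k0 ler_wpM2l ?(ltW KT0)// lef_pV2 ?posrE ?ltr0n//.
  by rewrite ler_nat.
set k := 2 * K * Delta in k1 kk0 *.
have k1' : 0 < 1 - k by rewrite subr_gt0.
have inv_le : (1 - k)^-1 <= (1 - k0)^-1 by rewrite lef_pV2 ?posrE// lerD2l lerN2.
have -> : c / (1 - k0) * expR L * (S1 + S2) =
    (c * (S1 + S2)) / (1 - k0) * expR L by ring.
have iv0 : 0 <= (1 - k)^-1 by rewrite invr_ge0 ltW.
have D4 : 0 <= 2 * k + Delta by rewrite addr_ge0 ?(ltW D0)// mulr_ge0// /k !mulr_ge0 // ltW.
apply: ler_pM.
- by rewrite mulr_ge0// addr_ge0// mulr_ge0// (le_trans ler01).
- by rewrite exprn_ge0// addr_ge0// mulr_ge0.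
- apply: ler_pM => //; first by rewrite addr_ge0// mulr_ge0// (le_trans ler01).
  by rewrite mulrDr lerD2l ler_peMl.
- apply: (@le_trans _ _ (expR ((2 * k + Delta) / (1 - k)) ^+ n)).
    apply: lerXn2r; rewrite ?nnegrE ?expR_ge0 ?expR_ge1Dx//.
    by rewrite addr_ge0// mulr_ge0.
  rewrite -expRM_natl ler_expR /L.
  have -> : n%:R * ((2 * k + Delta) / (1 - k)) =
      (4 * K + 1) * (n%:R * Delta) * (1 - k)^-1 by rewrite /k; ring.
  apply: ler_pM => //.
    by rewrite !mulr_ge0 ?addr_ge0 ?mulr_ge0// ltW.
  rewrite ler_wpM2l ?addr_ge0 ?mulr_ge0 ?(ltW K0)// DE mulrA ler_pdivrMr// mulrC.
  by rewrite ler_wpM2l ?(ltW T0)// ler_nat.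
Qed.

End constant.

Section finite_second_moment.
Context dd (Omega : measurableType dd) (R : realType) (P : probability Omega R).

(** The statement of the bound allows infinite moments; this is the bridge to real
    expectations when they are finite. *)
Lemma L2mx_expectation_fin p q (X : Omega -> 'M[R]_(p, q)) :
  (forall i j, measurable_fun setT (fun w => X w i j)) ->
  ('E_P[fun w => (enorm (X w) ^+ 2)%R] < +oo)%E -> L2mx P X.
Proof.
move=> mX fin; apply: L2mx_enorm => //; apply/integrableP; split.
  by apply/measurable_EFinP; exact: measurable_enorm_sq.
move: fin; rewrite unlock; congr (_ < _)%E; apply: eq_integral => w _ /=.
by rewrite ger0_norm// sqr_ge0.
Qed.

Lemma expectation_enorm_ge0 p q (X : Omega -> 'M[R]_(p, q)) :
  (0 <= 'E_P[fun w => (enorm (X w) ^+ 2)%R])%E.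
Proof. by rewrite expectation_ge0// => w; rewrite sqr_ge0. Qed.

End finite_second_moment.

Theorem theorem2p5
  (R : realType) (disp : measure_display) (Omega : measurableType disp)
  (P : probability Omega R)
  (d m : nat) (T tau : R) (T_gt0 : 0 < T) (tau_gt0 : 0 < tau)
  (F : R -> set (set Omega)) (F_usual : usual_filtration P T F)
  (W : R -> Omega -> 'cV[R]_m) (W_bm : brownian_motion P T F W)
  (phi : R -> 'cV[R]_d) (phi_cont : {within `[- tau, 0], continuous phi})
  (alpha : 'cV[R]_d -> 'cV[R]_d -> 'cV[R]_d)
  (beta : 'cV[R]_d -> 'cV[R]_d -> 'M[R]_(d, m))
  (K q : R) (K_gt0 : 0 < K) (q_gt2 : 2 < q)
  (coupled_monotone : forall x y x' y' : 'cV[R]_d,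
     dotp (x - x') (alpha x y - alpha x' y')
       + (q - 1) / 2 * enorm (beta x y - beta x' y') ^+ 2
     <= K * (enorm (x - x') ^+ 2 + enorm (y - y') ^+ 2))
  (x : R -> Omega -> 'cV[R]_d)
  (x_sol : sdde_unique_solution P T tau F W phi alpha beta x)
  (x_L2 : (ereal_sup [set 'E_P[fun w => (enorm (x s w) ^+ 2)%R]
             | s in `[0%R, T]] < +oo)%E)
  (alpha_L2 : (ereal_sup
     [set 'E_P[fun w => (enorm (alpha (x s w) (x (s - tau) w)) ^+ 2)%R]
       | s in `[0%R, T]] < +oo)%E) :
  exists C : R, 0 < C /\
  forall (N M : nat) (Delta : R),
    (0 < N)%N -> (0 < M)%N -> Delta = T / N%:R -> Delta = tau / M%:R ->
    0 < 2 * K * Delta -> 2 * K * Delta < 1 ->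
  forall Z : int -> Omega -> 'cV[R]_d,
    bem_unique_solution P F W phi alpha beta N M Delta Z ->
  forall Rem CRem : nat -> Omega -> 'cV[R]_d,
    (forall i : nat, (1 <= i <= N)%N ->
       bem_remainder P tau F W alpha beta x M Delta i%:Z (Rem i)) ->
    (forall i : nat, (1 <= i <= N)%N ->
       cond_expectation P (F (grid Delta (i%:Z - 1))) (Rem i) (CRem i)) ->
  forall n : nat, (1 <= n <= N)%N ->
    ('E_P[fun w => (enorm (x (grid Delta n%:Z) w - Z n%:Z w) ^+ 2)%R]
     <= C%:E *
        (\sum_(1 <= i < n.+1) 'E_P[fun w => (enorm (Rem i w) ^+ 2)%R]
         + (Delta^-1)%:E *
           \sum_(1 <= i < n.+1) 'E_P[fun w => (enorm (CRem i w) ^+ 2)%R]))%E.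

Proof.
have q1 : 0 < q - 1 by lra.
have q2 : 0 < q - 2 by rewrite subr_gt0.
have c1 : 1 <= (q - 1) / (q - 2) by rewrite ler_pdivlMr// mul1r; lra.
have [C [C0 CP]] := gronwall_constant K_gt0 T_gt0 c1.
exists C; split=> // N M Delta N0 M0 DN DM _ K1 Z [Z_sol _] Rem CRem rem crem n.
move=> /andP[n1 nN]; have [xs _] := x_sol.
have N0r : 0 < N%:R :> R by rewrite ltr0n.
have M0r : 0 < M%:R :> R by rewrite ltr0n.
have D0 : 0 < Delta by rewrite DN divr_gt0.
have ND : N%:R * Delta = T by rewrite DN mulrC divfK// gt_eqF.
have MD : M%:R * Delta = tau by rewrite DM mulrC divfK// gt_eqF.
set S1 := (\sum_(1 <= i < n.+1) _)%E.
set S2 := (\sum_(1 <= i < n.+1) 'E_P[fun w => (enorm (CRem i w) ^+ 2)%R])%E.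
have S10 : (0 <= S1)%E by apply: sume_ge0 => i _; exact: expectation_enorm_ge0.
have S20 : (0 <= S2)%E by apply: sume_ge0 => i _; exact: expectation_enorm_ge0.
have Di0 : 0 < Delta^-1 by rewrite invr_gt0.
have DS20 : (0 <= (Delta^-1)%:E * S2)%E by rewrite mule_ge0// lee_fin ltW.
have [S1y|] := boolP (S1 == +oo)%E.
  by rewrite (eqP S1y) addye ?gt0_muley ?leey ?lte_fin// gt_eqF// (lt_le_trans _ DS20).
rewrite -ltey => S1fin.
have [S2y|] := boolP (S2 == +oo)%E.
  rewrite (eqP S2y) gt0_muley ?lte_fin// addey ?gt0_muley ?leey ?lte_fin//.
  by rewrite gt_eqF// (lt_le_trans _ S10).
rewrite -ltey => S2fin.
have term_fin (X : nat -> Omega -> 'cV[R]_d) i : (1 <= i <= n)%N ->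
    (\sum_(1 <= i < n.+1) 'E_P[fun w => (enorm (X i w) ^+ 2)%R] < +oo)%E ->
    ('E_P[fun w => (enorm (X i w) ^+ 2)%R] < +oo)%E.
  move=> /andP[i1 ik]; apply: le_lt_trans.
  rewrite (bigD1_seq i) ?iota_uniq ?mem_index_iota ?i1//=.
  by rewrite leeDl// sume_ge0// => j _; exact: expectation_enorm_ge0.
have inN i : (1 <= i <= n)%N -> (1 <= i <= N)%N.
  by move=> /andP[-> /leq_trans]; exact.
have tN i : (1 <= i <= n)%N -> grid Delta (i%:Z - 1) \in `[0, T].
  move=> /andP[i1 ik]; apply: (grid_itv D0 ND); first by rewrite subr_ge0.
  by apply: (@le_trans _ _ i%:Z); rewrite ?gerBl// lez_nat (leq_trans ik).
have L2rem i : (1 <= i <= n)%N -> L2mx P (Rem i) /\ L2mx P (CRem i).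
  move=> i1n; have [FC ce] := crem i (inN i i1n).
  split; apply: L2mx_expectation_fin.
  - move=> j l; rewrite (ord1 l); apply/measurable_EFinP.
    by have [/measurable_int] := ce j.
  - exact: (@term_fin Rem).
  - by move=> j l; exact: measurable_wrt_entry (filt_sub F_usual (tN i i1n)) FC.
  - exact: (@term_fin CRem).
have [Le EnC] := bem_err_moment F_usual W_bm K_gt0 q_gt2 coupled_monotone xs D0 M0 MD
  ND Z_sol K1 nN (fun i H => rem i (inN i H)) (fun i H => crem i (inN i H)) L2rem.
have sumE (X : nat -> Omega -> 'cV[R]_d) : (forall i, (1 <= i <= n)%N -> L2mx P (X i)) ->
    (\sum_(1 <= i < n.+1) 'E_P[fun w => (enorm (X i w) ^+ 2)%R] =
     (\sum_(i < n) Ex P (fun w => enorm (X i.+1 w) ^+ 2))%:E)%E.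
  move=> LX; rewrite big_add1 big_mkord -sumEFin; apply: eq_bigr => i _.
  by rewrite ExE//; apply/intg_enorm_sq/LX => /=.
rewrite /S1 /S2 (sumE Rem) ?(sumE CRem); [|by move=> i /L2rem[]..].
rewrite -(EFinM Delta^-1) -EFinD -EFinM (_ : 'E_P[_] = (Ex P (fun w =>
  enorm (bem_err x Delta Z n w) ^+ 2))%:E)%E; last exact/ExE/intg_enorm_sq.
rewrite lee_fin; apply: le_trans EnC _; rewrite big_split/= -!mulr_sumr.
apply: (CP N) => //.
  by apply: sumr_ge0 => i _; apply: Ex_ge0 => w; exact: sqr_ge0.
apply: mulr_ge0; first exact: ltW.
by apply: sumr_ge0 => i _; apply: Ex_ge0 => w; exact: sqr_ge0.
Qed.
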